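(* Let $n\in\mathbb N^+$. There is a family of convolution operators (given by a kernel $K$ on $\mathbb C^n$) $$S_rf(x)=r^{-n}\int_{\mathbb R^n}K\big(r^{-1}(x-y)\big)f(y)\,dy,\qquad 0<r\le1,$$ from $C^0(\mathbb R^n)$ into the space of entire functions on $\mathbb C^n$ with the following property. For every $k\in\mathbb N$ there exists a constant $c(n,k)>0$ such that, for every $f\in C_{k,\varpi}(\mathbb R^n)$ with a semi separable modulus of continuity $\varpi$ (defined on $(0,\delta]$), every multi-index $\alpha\in\mathbb N^n$ with $|\alpha|\le k$, every $0<r\le\min\{1,\delta\}$, and every $x\in\mathbb C^n$ with $|\operatorname{Im}x|\le r$, we have $$\big|\partial^\alpha S_rf(x)-P_{\partial^\alpha f,\,k-|\alpha|}(\operatorname{Re}x;\mathrm i\operatorname{Im}x)\big|\le c(n,k)\,\|f\|_\varpi\,r^{k-|\alpha|}\varpi(r),$$ where the Taylor polynomial $P$ is $$P_{f,k}(x;y):=\sum_{|\beta|\le k}\frac1{\beta!}\partial^\beta f(x)\,y^\beta.$$ Moreover, $S_rf$ is real analytic whenever $f$ is real valued.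
   Context: $|\cdot|$ is the sup-norm; for a multi-index $\alpha$, $|\alpha|$ is the sum of its entries. $C^0(\mathbb R^n)$ is the space of continuous functions on $\mathbb R^n$ with finite norm $|f|_{C^0}:=\sup_{\mathbb R^n}|f|$. Modulus of continuity: a nondecreasing continuous function $\varpi>0$ on some interval $(0,\delta]$, $\delta>0$, with $\lim_{x\to0^+}\varpi(x)=0$ and $\limsup_{x\to0^+}x/\varpi(x)<+\infty$. $[f]_\varpi:=\sup_{x,y\in\mathbb R^n,\,0<|x-y|\le\delta}\frac{|f(x)-f(y)|}{\varpi(|x-y|)}$. $C_{k,\varpi}(\mathbb R^n)$ is the space of functions having continuous partial derivatives $\partial^\alpha f$ for $|\alpha|\le k$ with $\|f\|_\varpi:=\sum_{|\alpha|\le k}(|\partial^\alpha f|_{C^0}+[\partial^\alpha f]_\varpi)<+\infty$. Semi separable: $\psi(x):=\sup_{0<r<\delta/x}\frac{\varpi(rx)}{\varpi(r)}=\mathcal O(x)$ as $x\to+\infty$ ($x\ge1$). A function on $\mathbb C^n$ is called real analytic if it is analytic and takes real values for real arguments. *)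

(* Defs.v *)
From HB Require Import structures.
From mathcomp Require Import all_boot all_order all_algebra.
From mathcomp Require Import all_classical all_reals all_analysis.
From mathcomp Require Import complex.

Set Implicit Arguments.
Unset Strict Implicit.
Unset Printing Implicit Defensive.
Import Order.TTheory GRing.Theory Num.Theory.
Import numFieldNormedType.Exports.
Local Open Scope classical_set_scope.
Local Open Scope complex_scope.
Local Open Scope ring_scope.

(* [R[i]] as a normed space over itself. *)
HB.instance Definition _ (R : rcfType) := PseudoPointedMetric.copy R[i] R[i]^o.
HB.instance Definition _ (R : rcfType) := NormedModule.copy R[i] R[i]^o.

(* Lebesgue measure on R^n, carried by [n.-tuple R] with its product (Borel)
   sigma-algebra: the n-fold product of the one-dimensional measure, transported
   at each step along [R * R^n -> R^(n+1)]. *)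
Section lebesgue_tuple.
Variable R : realType.
Local Notation mR := (measurableTypeR R).

Definition pair_cons n (p : mR * n.-tuple mR) : n.+1.-tuple mR :=
  [the n.+1.-tuple mR of p.1 :: p.2].

Lemma measurable_pair_cons n : measurable_fun [set: mR * n.-tuple mR] (@pair_cons n).
Proof. exact: measurable_cons. Qed.

Section step.
Variables (n : nat) (m : {sigma_finite_measure set (n.-tuple mR) -> \bar R}).
Local Open Scope ereal_scope.

Definition lebesgue_cons : set (n.+1.-tuple mR) -> \bar R :=
  pushforward (@lebesgue_measure R \x m) (@pair_cons n).

Let mcons := @measurable_pair_cons n.

Let lebesgue_cons0 : lebesgue_cons set0 = 0.
Proof. by rewrite /lebesgue_cons /pushforward preimage_set0 measure0. Qed.

Let lebesgue_cons_ge0 A : 0 <= lebesgue_cons A.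
Proof. exact: measure_ge0. Qed.

Let lebesgue_cons_sigma_additive : semi_sigma_additive lebesgue_cons.
Proof.
move=> F mF tF mUF; rewrite /lebesgue_cons /pushforward preimage_bigcup.
apply: measure_semi_sigma_additive.
- by move=> k; rewrite -[X in measurable X]setTI; exact: mcons.
- apply/trivIsetP => /= i j _ _ ij; rewrite -preimage_setI.
  by move/trivIsetP : tF => /(_ _ _ _ _ ij) ->//; rewrite preimage_set0.
- by rewrite -preimage_bigcup -[X in measurable X]setTI; exact: mcons.
Qed.

HB.instance Definition _ := isMeasure.Build _ _ _ lebesgue_cons
  lebesgue_cons0 lebesgue_cons_ge0 lebesgue_cons_sigma_additive.

Let uncons (t : n.+1.-tuple mR) : mR * n.-tuple mR :=
  (tnth t ord0, [tuple of behead t]).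

Let measurable_uncons : measurable_fun [set: n.+1.-tuple mR] uncons.
Proof.
by apply/measurable_fun_pair; [exact: measurable_tnth|exact: measurable_behead].
Qed.

Let pair_consK : cancel (@pair_cons n) uncons.
Proof.
by move=> [x t]; rewrite /uncons /pair_cons; congr pair; apply: val_inj.
Qed.

Let lebesgue_cons_sigma_finite : sigma_finite setT lebesgue_cons.
Proof.
have /sigma_finiteP[F [TF ndF Foo]] := sigma_finiteT (@lebesgue_measure R).
have /sigma_finiteP[G [TG ndG Goo]] := sigma_finiteT m.
exists (fun k => uncons @^-1` (F k `*` G k)).
  rewrite -preimage_bigcup (_ : \bigcup_k (F k `*` G k) = setT) ?preimage_setT//.
  rewrite -setXTT TF TG predeqE => -[x y]; split.
    by move=> [i _ []/= ? ?]; split; exists i.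
  move=> [/= [i _ Fix] [j _ Gjy]]; exists (maxn i j) => //; split.
  - by move: x Fix; exact/subsetPset/ndF/leq_maxl.
  - by move: y Gjy; exact/subsetPset/ndG/leq_maxr.
move=> k; have [mF Fk] := Foo k; have [mG Gk] := Goo k; split.
  by rewrite -[X in measurable X]setTI; apply: measurable_uncons => //; exact: measurableX.
rewrite /lebesgue_cons /pushforward -comp_preimage.
rewrite (_ : uncons \o _ = id); last by apply/funext => p /=; exact: pair_consK.
by rewrite preimage_id product_measure1E// lte_mul_pinfty// ge0_fin_numE.
Qed.

HB.instance Definition _ := Measure_isSigmaFinite.Build _ _ _ lebesgue_cons
  lebesgue_cons_sigma_finite.

End step.

Fixpoint lebesgue_tuple n : {sigma_finite_measure set (n.-tuple mR) -> \bar R} :=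
  match n return {sigma_finite_measure set (n.-tuple mR) -> \bar R} with
  | 0 => (\d_ ([tuple] : 0.-tuple mR) : set _ -> \bar R)
  | n'.+1 => lebesgue_cons (lebesgue_tuple n')
  end.

End lebesgue_tuple.

Section multi_indices.
Variable n : nat.
Implicit Types alpha beta : 'I_n -> nat.

Definition mi_abs alpha : nat := (\sum_i alpha i)%N.

Definition mi_fact alpha : nat := (\prod_i (alpha i)`!)%N.

Definition mi_pow (K : numFieldType) (y : 'rV[K]_n) alpha : K :=
  \prod_i y ord0 i ^+ alpha i.

(* The multi-indices of absolute value at most k have all their entries at most
   k, so that sums over them range over a finite type. *)
Definition mi_of k (beta : {ffun 'I_n -> 'I_k.+1}) : 'I_n -> nat :=
  fun i => beta i.

Section partial_derivatives.
Variable K : numFieldType.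
Implicit Types F : 'rV[K]_n -> K.

Definition partial (j : 'I_n) F : 'rV[K]_n -> K :=
  fun x => 'D_(delta_mx ord0 j) F x.

(* The order of differentiation is fixed; it is immaterial for C^k and for
   holomorphic functions. *)
Definition mi_partial alpha F : 'rV[K]_n -> K :=
  foldr (fun j G => iter (alpha j) (partial j) G) F (enum 'I_n).

End partial_derivatives.
End multi_indices.

Section function_spaces.
Variables (R : realType) (n : nat).
Local Notation C := R[i].
Local Notation normc := (@ComplexField.Normc.normc R).

Definition re_fun (f : 'rV[R]_n -> C) : 'rV[R]_n -> R := fun x => complex.Re (f x).
Definition im_fun (f : 'rV[R]_n -> C) : 'rV[R]_n -> R := fun x => complex.Im (f x).

(* All iterated partial derivatives up to order k, in any order of
   differentiation, exist everywhere and are continuous. *)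
Fixpoint real_Ck (k : nat) (g : 'rV[R]_n -> R) : Prop :=
  continuous g /\
  match k with
  | 0 => True
  | k'.+1 => forall j : 'I_n,
      (forall x, derivable g x (delta_mx ord0 j)) /\ real_Ck k' (partial j g)
  end.

(* Functions of a real vector variable are complex valued; they are
   differentiated componentwise. *)
Definition Ck (k : nat) (f : 'rV[R]_n -> C) : Prop :=
  real_Ck k (re_fun f) /\ real_Ck k (im_fun f).

Definition cpartial (alpha : 'I_n -> nat) (f : 'rV[R]_n -> C) : 'rV[R]_n -> C :=
  fun x => mi_partial alpha (re_fun f) x +i* mi_partial alpha (im_fun f) x.

Definition C0_norm (f : 'rV[R]_n -> C) : \bar R :=
  ereal_sup [set (normc (f x))%:E | x in [set: 'rV[R]_n]].

Definition in_C0 (f : 'rV[R]_n -> C) : Prop := Ck 0 f /\ (C0_norm f < +oo)%E.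

Record modulus_of_continuity (delta : R) (w : R -> R) : Prop := {
  modulus_delta_gt0 : 0 < delta ;
  modulus_gt0 : forall x : R, 0 < x <= delta -> 0 < w x ;
  modulus_nondecreasing :
    forall x y : R, 0 < x -> x <= y -> y <= delta -> w x <= w y ;
  modulus_continuous : {within `]0, delta]%classic, continuous w} ;
  modulus_cvg0 : w x @[x --> 0^'+] --> (0 : R) ;
  modulus_limsup : (limf_esup (fun x : R => (x / w x)%:E) (0 : R)^'+ < +oo)%E
}.

(* [psi] is [\bar R]-valued: the real [sup] of an unbounded set would be 0. *)
Definition semi_separable (delta : R) (w : R -> R) : Prop :=
  let psi (x : R) : \bar R :=
    ereal_sup [set (w (r * x) / w r)%:E | r in [set r | 0 < r < delta / x]] in
  exists M : R, \forall x \near +oo, (psi x <= (M * x)%:E)%E.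

Definition modulus_seminorm (delta : R) (w : R -> R) (f : 'rV[R]_n -> C) : \bar R :=
  ereal_sup [set (normc (f p.1 - f p.2) / w `|p.1 - p.2|)%:E |
    p in [set p : 'rV[R]_n * 'rV[R]_n | 0 < `|p.1 - p.2| <= delta]].

Definition modulus_norm (k : nat) (delta : R) (w : R -> R) (f : 'rV[R]_n -> C)
    : \bar R :=
  (\sum_(beta : {ffun 'I_n -> 'I_k.+1} | (mi_abs (mi_of beta) <= k)%N)
    (C0_norm (cpartial (mi_of beta) f) +
     modulus_seminorm delta w (cpartial (mi_of beta) f)))%E.

Definition in_Ck_modulus (k : nat) (delta : R) (w : R -> R) (f : 'rV[R]_n -> C)
    : Prop :=
  Ck k f /\ (modulus_norm k delta w f < +oo)%E.

End function_spaces.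

Section convolution.
Variables (R : realType) (n : nat).
Local Notation C := R[i].

Definition toC (x : 'rV[R]_n) : 'rV[C]_n := map_mx (fun t : R => t%:C) x.
Definition re_vec (x : 'rV[C]_n) : 'rV[R]_n := map_mx (@complex.Re R) x.
Definition im_vec (x : 'rV[C]_n) : 'rV[R]_n := map_mx (@complex.Im R) x.

Definition taylor (f : 'rV[R]_n -> C) (k : nat) (x : 'rV[R]_n) (y : 'rV[C]_n) : C :=
  \sum_(beta : {ffun 'I_n -> 'I_k.+1} | (mi_abs (mi_of beta) <= k)%N)
    ((mi_fact (mi_of beta))%:R)^-1 * cpartial (mi_of beta) f x *
    mi_pow y (mi_of beta).

Definition integrand_of (g : 'rV[R]_n -> C) (t : n.-tuple (measurableTypeR R)) : C :=
  g (\row_i tnth t i).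

Definition integrableRn (g : 'rV[R]_n -> C) : Prop :=
  (lebesgue_tuple R n).-integrable setT
    (fun t => (complex.Re (integrand_of g t))%:E) /\
  (lebesgue_tuple R n).-integrable setT
    (fun t => (complex.Im (integrand_of g t))%:E).

Definition integralRn (g : 'rV[R]_n -> C) : C :=
  (\int[lebesgue_tuple R n]_(t in setT) complex.Re (integrand_of g t)) +i*
  (\int[lebesgue_tuple R n]_(t in setT) complex.Im (integrand_of g t)).

Definition conv_integrand (K : 'rV[C]_n -> C) (r : R) (f : 'rV[R]_n -> C)
    (x : 'rV[C]_n) : 'rV[R]_n -> C :=
  fun y => K ((r^-1)%:C *: (x - toC y)) * f y.

Definition conv_op (K : 'rV[C]_n -> C) (r : R) (f : 'rV[R]_n -> C) : 'rV[C]_n -> C :=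
  fun x => (r ^- n)%:C * integralRn (conv_integrand K r f x).

(* Fréchet differentiability over the scalar field C, i.e. holomorphy on C^n. *)
Definition entire (F : 'rV[C]_n -> C) : Prop :=
  forall x : 'rV[C]_n, differentiable F x.

Definition real_valued (f : 'rV[R]_n -> C) : Prop :=
  forall x, complex.Im (f x) = 0.

Definition real_analytic (F : 'rV[C]_n -> C) : Prop :=
  entire F /\ real_valued (fun x => F (toC x)).

End convolution.

(* Main.v *)
(* The kernel is a superposition K(z) = sum_m a_m G(4^-m z) of dilated Gaussians
   G(z) = exp(-sum_i z_i^2). The coefficients are chosen such that convolution
   with K reproduces every polynomial P: expanding P(x + 4^m eta) in powers of 4^m,
   the term of degree l contributes a multiple of sum_m coef_m 4^(m l), which
   vanishes for l > 0 and is nonzero for l = 0. Since coef_m decays faster than any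
   exponential, K and all its derivatives decay rapidly on strips |Im z| <= V.

   Writing S_r f(x) = (K * f(r .))(x / r), differentiation under the integral gives
   d^alpha S_r f(x) = r^-|alpha| ((d^alpha K) * f(r .))(x / r). If P is the Taylor
   polynomial of f of degree k at u = Re x, then d^alpha S_r P = d^alpha P is exactly
   the Taylor polynomial in the claim, so that the error is
   r^-|alpha| ((d^alpha K) * (f - P)(r .))(x / r). As
   |g(x) - g(y)| <= (1 + |x - y| / r) [g] w(r), by subdividing the segment [x, y]
   into pieces of length at most r, Taylor's formula bounds |f - P|(u + h) by a
   multiple of |h|^k (1 + |h| / r) ||f|| w(r), and the decay of d^alpha K absorbs the
   polynomial growth in h / r. *)

Require Import Defs.
From HB Require Import structures.
From mathcomp Require Import all_boot all_order all_algebra.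
From mathcomp Require Import all_classical all_reals all_analysis.
From mathcomp Require Import measurable_realfun complex.
From mathcomp Require Import ring lra zify.

Set Implicit Arguments.
Unset Strict Implicit.
Unset Printing Implicit Defensive.
Import Order.TTheory GRing.Theory Num.Theory.
Import numFieldNormedType.Exports.
Local Open Scope classical_set_scope.
Local Open Scope complex_scope.
Local Open Scope ring_scope.

(** Complex differentiability always comes from one mean value principle: if the second partial
    derivatives are bounded on a unit polydisc, then moving along coordinate segments shows that the
    first-order remainder is quadratic. A dominating function for the second derivatives thus
    permits differentiation under the integral for an arbitrary measure. Lebesgue measure yields the
    convolutions, the counting measure yields the series of Gaussians.

    Two obstacles shape the reproduction of polynomials. At a complex x the substitution y = x + 4^m
    eta is not a change of real variables; instead of moving a contour, one uses that a convolution
    with 1 is invariant under real translations and so has vanishing complex derivatives. Sum and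
    integral are not interchanged: the kernel is split into M terms and a tail whose convolution is
    O(2^-M), and M tends to infinity.

    All decay is measured by the weight prod_i (1 + u_i^2): its reciprocal has an explicit integral,
    it is submultiplicative up to the factor 2^n, and a dilation by 4^-m costs a power of 4^m, which
    the coefficients absorb. *)

Local Notation normc := (@ComplexField.Normc.normc _).

(** * Complex modulus and differentiability criteria *)

Section normc_theory.
Variable R : realType.
Local Notation C := R[i].
Implicit Types z w : C.

Lemma normrcE z : `|z| = (normc z)%:C. Proof. by case: z => a b; rewrite normc_def. Qed.

Lemma normc_ge0 z : 0 <= normc z.
Proof. by rewrite -lecR -normrcE normr_ge0. Qed.

Lemma normcD z w : normc (z + w) <= normc z + normc w.
Proof. by rewrite -lecR rmorphD/= -!normrcE ler_normD. Qed.

Lemma normcM z w : normc (z * w) = normc z * normc w.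
Proof. exact: ComplexField.Normc.normcM. Qed.

Lemma normcN z : normc (- z) = normc z.
Proof. exact: normcN. Qed.

Lemma normc_real (x : R) : normc x%:C = `|x|.
Proof. by rewrite /= expr0n addr0 sqrtr_sqr. Qed.

Lemma normc0 : normc (0 : C) = 0. Proof. exact: ComplexField.Normc.normc0. Qed.

Lemma normc_sum (I : Type) (s : seq I) (P : pred I) (F : I -> C) :
  normc (\sum_(i <- s | P i) F i) <= \sum_(i <- s | P i) normc (F i).
Proof.
elim/big_rec2 : _ => [|i y x _ le_xy]; first by rewrite normc0.
by rewrite (le_trans (normcD _ _))// lerD2l.
Qed.

Lemma Re_le_normc z : `|complex.Re z| <= normc z.
Proof. by rewrite -lecR -normrcE normc_ge_Re. Qed.

Lemma Im_le_normc z : `|complex.Im z| <= normc z.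
Proof.
case: z => a b /=; rewrite -(@ler_pXn2r _ 2)// ?nnegrE ?sqrtr_ge0//.
by rewrite sqr_sqrtr ?addr_ge0 ?sqr_ge0// real_normK ?num_real// lerDr sqr_ge0.
Qed.

Lemma normc_le_ReIm z : normc z <= `|complex.Re z| + `|complex.Im z|.
Proof.
have -> : z = (complex.Re z)%:C + 'i%C * (complex.Im z)%:C by exact: complexE.
rewrite (le_trans (normcD _ _))// normcM !normc_real.
have -> : normc ('i%C : C) = 1 by rewrite /= expr0n add0r expr1n sqrtr1.
by rewrite mul1r; case: z => a b; simpc.
Qed.

Lemma ReD z w : complex.Re (z + w) = complex.Re z + complex.Re w.
Proof. by case: z w => [a b] [c d]. Qed.
Lemma ImD z w : complex.Im (z + w) = complex.Im z + complex.Im w.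
Proof. by case: z w => [a b] [c d]. Qed.
Lemma ReN z : complex.Re (- z) = - complex.Re z. Proof. by case: z. Qed.
Lemma ImN z : complex.Im (- z) = - complex.Im z. Proof. by case: z. Qed.
Lemma ReB z w : complex.Re (z - w) = complex.Re z - complex.Re w.
Proof. by rewrite ReD ReN. Qed.
Lemma ImB z w : complex.Im (z - w) = complex.Im z - complex.Im w.
Proof. by rewrite ImD ImN. Qed.
Lemma ReZ (x : R) z : complex.Re (x%:C * z) = x * complex.Re z.
Proof. by case: z => a b; simpc. Qed.
Lemma ImZ (x : R) z : complex.Im (x%:C * z) = x * complex.Im z.
Proof. by case: z => a b; simpc. Qed.

Lemma complex_eqP z w : complex.Re z = complex.Re w -> complex.Im z = complex.Im w ->
  z = w.
Proof. by case: z w => [a b] [c d] /= -> ->. Qed.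

End normc_theory.

Section dot_form.
Variables (K : numFieldType) (n : nat).

Definition dot_form (a : 'I_n -> K) (h : 'rV[K]_n) : K := \sum_j h ord0 j * a j.

Lemma dot_form_is_linear a : linear (dot_form a : 'rV[K]_n -> K^o).
Proof.
move=> c u v; rewrite /dot_form [in RHS]/GRing.scale/= mulr_sumr -big_split/=.
by apply: eq_bigr => j _; rewrite !mxE mulrDl mulrA.
Qed.

HB.instance Definition _ a :=
  GRing.isLinear.Build K 'rV[K]_n K^o _ (dot_form a) (dot_form_is_linear a).

Lemma dot_form_continuous a : continuous (dot_form a : 'rV[K]_n -> K^o).
Proof.
apply: (@continuous_big _ _ (+%R : K^o -> _) 0) => [|j _ u]; first exact: add_continuous.
apply: (@cvgM K _ (nbhs u) _ (fun x : 'rV[K]_n => x ord0 j) (fun=> a j)).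
  exact: coord_continuous.
exact: cvg_cst.
Qed.

Lemma dot_form_delta a j : dot_form a (delta_mx ord0 j) = a j.
Proof.
rewrite /dot_form (bigD1 j)//= mxE !eqxx mul1r big1 ?addr0// => i ij.
by rewrite mxE (negbTE ij) andbF mul0r.
Qed.

End dot_form.

Section differentiability_criterion.
Variables (R : realType) (n : nat).
Local Notation C := R[i].
Implicit Types (F : 'rV[C]_n -> C) (x h : 'rV[C]_n).

Lemma rV_coord_le (K : numFieldType) m (h : 'rV[K]_m) i : `|h ord0 i| <= `|h|.
Proof.
rewrite -[leRHS]/(mx_norm h) mx_normE -[leLHS]nngE num_le.
exact: (@le_bigmax _ _ _ _ (fun i : 'I_1 * 'I_m => `|h i.1 i.2|%:nng) (ord0, i)).
Qed.

Lemma rV_norm_le m (h : 'rV[R]_m) (e : R) : 0 <= e ->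
  (forall i, `|h ord0 i| <= e) -> `|h| <= e.
Proof.
move=> e0 he; rewrite -[leLHS]/(mx_norm h) mx_normrE; apply/bigmax_leP; split => //.
by move=> [i j] _ /=; rewrite ord1.
Qed.

(** The norm on ['rV[C]_n] takes its values in C. Since the maximum is attained at a coordinate, it
    is the image of a real number, and estimates can be carried out in R. *)
Lemma rVC_norm_neq0 m (h : 'rV[C]_m) : h != 0 ->
  exists2 i, `|h| = (normc (h ord0 i))%:C & 0 < normc (h ord0 i).
Proof.
rewrite -normr_gt0 => h0; have := h0; rewrite lt0r => /andP[+ _].
rewrite -[X in X != _]/(mx_norm h) => /mx_norm_neq0[[i j]]/=; rewrite ord1 => ij.
exists j; first by rewrite -[LHS]/(mx_norm h) ij normrcE.
by move: h0; rewrite -[ltRHS]/(mx_norm h) ij normrcE ltcR.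
Qed.

(** A quadratic remainder on a polydisc is o(h), and a continuous linear form with remainder o(h) is
    the differential by uniqueness. *)
Lemma differentiable_dot_form F x (a : 'I_n -> C) (M : R) :
  (forall h (e : R), e <= 1 -> (forall i, normc (h ord0 i) <= e) ->
     normc (F (x + h) - F x - dot_form a h) <= M * e ^+ 2) ->
  differentiable F x /\ forall j, is_derive x (delta_mx ord0 j) F (a j).
Proof.
move=> FM.
have cdf := @dot_form_continuous C n a.
have E : F \o shift x = cst (F x) + dot_form a +o_ (0 : 'rV[C]_n) id.
  apply/eqaddoP => _/posnumP[e].
  have [er e0 ere] : exists2 er : R, 0 < er & er%:C <= e%:num.
    exists (complex.Re e%:num); last by rewrite RRe_real ?ger0_real.
    by have : 0 < e%:num by []; rewrite ltcE => /andP[].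
  have M1 : 0 < `|M| + 1 by rewrite ltr_wpDl.
  (* For |h| <= d the remainder M |h|^2 is at most er |h|; the summand 1 keeps the divisor
     positive. *)
  pose d := Num.min 1 (er / (`|M| + 1)).
  have d0 : 0 < d by rewrite lt_min ltr01 divr_gt0.
  have nd : \forall h \near nbhs (0 : 'rV[C]_n), `|h| <= d%:C.
    have dC0 : 0 < d%:C by rewrite ltcR.
    exact: (@nbhs0_le C 'rV[C]_n d%:C dC0).
  near=> h => /=.
  rewrite (_ : _ h = F (x + h) - F x - dot_form a h); last first.
    by rewrite [x + h]addrC -addrA -opprD.
  have [->|hn0] := eqVneq h 0.
    by rewrite addr0 subrr sub0r raddf0 oppr0 !normr0 mulr0.
  have [i hi i0] := rVC_norm_neq0 hn0.
  have id : normc (h ord0 i) <= d.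
    rewrite -lecR -hi; near: h; exact: nd.
  rewrite [leLHS](normrcE (F (x + h) - F x - dot_form a h)) hi.
  have := FM h (normc (h ord0 i)).
  rewrite (le_trans id) ?ge_min ?lexx// => /(_ isT).
  have hh k : normc (h ord0 k) <= normc (h ord0 i).
    by rewrite -lecR -hi -normrcE rV_coord_le.
  move=> /(_ hh) FMh.
  rewrite (@le_trans _ _ (er%:C * (normc (h ord0 i))%:C))//; last first.
    by rewrite ler_wpM2r// lecR normc_ge0.
  rewrite -rmorphM/= lecR.
  rewrite (le_trans FMh)// expr2 mulrA ler_wpM2r ?normc_ge0//.
  rewrite (@le_trans _ _ ((`|M| + 1) * normc (h ord0 i)))//.
    by rewrite ler_wpM2r ?normc_ge0// (le_trans (ler_norm _))// lerDl.
  by rewrite mulrC -ler_pdivlMr// (le_trans id)// ge_min lexx orbT.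
have dE := diff_unique cdf E.
have dF : differentiable F x by apply/diff_locallyP; rewrite dE.
split => // j; apply: DeriveDef; first exact: diff_derivable.
by rewrite deriveE// dE; exact: dot_form_delta.
Unshelve. all: by end_near. Qed.

End differentiability_criterion.

Section derive_eps.
Variables (K : numFieldType) (V W : normedModType K).

(** Multiplied out instead of written as a quotient, the condition passes from increments in C to
    increments in R, and through affine maps, by rescaling k. *)
Lemma is_derive_near (f : V -> W) a v D : is_derive a v f D ->
  forall e : K, 0 < e ->
    \forall k \near (0 : K), `|f (a + k *: v) - f a - k *: D| <= e * `|k|.
Proof.
move=> [df <-] e e0; have := derivable_nbhs df => /eqaddoP /(_ e e0).
apply: filterS => k /=; rewrite /cst/=.
by move=> H; rewrite (addrC a) -addrA -opprD; exact: H.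
Qed.

Lemma near_is_derive (f : V -> W) a v D :
  (forall e : K, 0 < e ->
    \forall k \near (0 : K), `|f (a + k *: v) - f a - k *: D| <= e * `|k|) ->
  is_derive a v f D.
Proof.
move=> fD.
have cv : h^-1 *: ((f \o shift a) (h *: v) - f a) @[h --> 0^'] --> D.
  apply/cvgrPdist_le => e e0; near=> h.
  have h0 : h != 0 by near: h; exact: nbhs_dnbhs_neq.
  have -> : D - h^-1 *: ((f \o shift a) (h *: v) - f a) =
      - (h^-1 *: (f (a + h *: v) - f a - h *: D)).
    by rewrite /= [in RHS]scalerBr scalerA mulVf// scale1r opprB (addrC a).
  rewrite normrN normrZ normfV ler_pdivrMl ?normr_gt0// mulrC.
  by near: h; apply: nbhs_dnbhs; exact: fD.
by apply: DeriveDef; [apply/cvg_ex; exists D|exact/cvg_lim].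
Unshelve. all: by end_near. Qed.

End derive_eps.

(** * Mean value estimates along coordinate segments *)

Section staircase.
Variables (R : realType) (K : fieldType) (W : zmodType) (N : W -> R).
Hypothesis N0 : N 0 = 0.
Hypothesis ND : forall x y, N (x + y) <= N x + N y.

(** The path from 0 to h switches on one coordinate at a time. Its corners have only coordinates of
    h or 0, so it stays in every polydisc about 0 that contains h. *)
Lemma staircase n (F : 'rV[K]_n -> W) (h : 'rV[K]_n) (B : R) :
  (forall (h' : 'rV[K]_n) j, (forall i, h' ord0 i = h ord0 i \/ h' ord0 i = 0) ->
     h' ord0 j = 0 ->
     N (F (h' + h ord0 j *: delta_mx ord0 j) - F h') <= B) ->
  N (F h - F 0) <= n%:R * B.
Proof.
move=> FB; pose p m : 'rV[K]_n := \row_j (if (j < m)%N then h ord0 j else 0).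
have H m : (m <= n)%N -> N (F (p m) - F 0) <= m%:R * B.
  elim: m => [_|m IH mn].
    have -> : p 0 = 0 by apply/rowP => j; rewrite !mxE.
    by rewrite subrr N0 mul0r.
  have pE : p m.+1 = p m + h ord0 (Ordinal mn) *: delta_mx ord0 (Ordinal mn).
    apply/rowP => j; rewrite !mxE eqxx/=.
    have [->|jm] := eqVneq j (Ordinal mn).
      by rewrite /= ltnSn ltnn add0r mulr1.
    rewrite mulr0 addr0 ltnS leq_eqVlt.
    by have /negbTE -> : (j : nat) != m by apply: contra_neq jm => jm; apply/val_inj.
  rewrite (_ : _ - _ = (F (p m.+1) - F (p m)) + (F (p m) - F 0)); last first.
    by rewrite addrA subrK.
  rewrite (le_trans (ND _ _))// -natr1 mulrDl mul1r addrC lerD//; first exact/IH/ltnW.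
  rewrite pE; apply: FB => [i|]; rewrite mxE; first by case: ifP; [left|right].
  by rewrite /= ltnn.
have := H n (leqnn n); congr (N (F _ - _) <= _).
by apply/rowP => j; rewrite !mxE ltn_ord.
Qed.

End staircase.

Section mean_value.
Variables (R : realType) (n : nat).
Local Notation C := R[i].

Lemma is_derive_bound (f df : R -> R) (B : R) :
  (forall s : R, is_derive s (1 : R) f (df s)) ->
  (forall s, 0 <= s <= 1 -> `|df s| <= B) -> `|f 1 - f 0| <= B.
Proof.
move=> fE dfB.
have cf : {within `[0, 1], continuous f}.
  apply: derivable_within_continuous => s _; exact: ex_derive.
have [s s01 ->] := MVT ltr01 (fun s _ => fE s) cf.
rewrite subr0 mulr1; apply: dfB.
by move: s01; rewrite in_itv/= => /andP[/ltW -> /ltW ->].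
Qed.

(** A real parameter t moves the argument by t c v with c complex. The chain rule, read off in real
    and imaginary parts, reduces complex estimates to the real mean value theorem. *)
Lemma is_derive_slice (F : 'rV[C]_n -> C) (z v : 'rV[C]_n) (c : C) (s : R) :
  derivable F (z + (s%:C * c) *: v) v ->
  let D := 'D_v F (z + (s%:C * c) *: v) in
  is_derive s (1 : R) (fun t : R => complex.Re (F (z + (t%:C * c) *: v)))
    (complex.Re (c * D)) /\
  is_derive s (1 : R) (fun t : R => complex.Im (F (z + (t%:C * c) *: v)))
    (complex.Im (c * D)).
Proof.
move=> dF D.
have H (e : R) : 0 < e -> \forall t \near (0 : R),
    normc (F (z + ((s + t)%:C * c) *: v) - F (z + (s%:C * c) *: v) - t%:C * (c * D))
    <= e * `|t|.
  move=> e0; have c1 : 0 < normc c + 1 by rewrite ltr_wpDl ?normc_ge0.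
  have ec : 0 < (e / (normc c + 1))%:C by rewrite ltcR divr_gt0.
  have := is_derive_near (derivableP dF) ec.
  move=> /nbhs_ballP[d d0 dP].
  have dr0 : 0 < complex.Re d by move: d0; rewrite /= ltcE => /andP[].
  have dE : d = (complex.Re d)%:C by rewrite RRe_real// gtr0_real.
  apply/nbhs_ballP; exists (complex.Re d / (normc c + 1)); first exact: divr_gt0.
  move=> t; rewrite /ball/= sub0r normrN => td.
  have := dP (t%:C * c).
  have tc : normc (t%:C * c) < complex.Re d.
    rewrite normcM normc_real; rewrite (@le_lt_trans _ _ (`|t| * (normc c + 1)))//.
      by rewrite ler_wpM2l// lerDl.
    by rewrite -ltr_pdivlMr.
  have bt : ball (0 : C) d (t%:C * c).
    by rewrite -ball_normE /ball_/= sub0r normrN normrcE dE ltcR.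
  move=> /(_ bt).
  rewrite [X in X <= _]normrcE [X in _ <= _ * X]normrcE -rmorphM/= lecR.
  rewrite rmorphD/= mulrDl scalerDl addrA [t%:C * (c * D)]mulrA => /le_trans; apply.
  rewrite normcM normc_real -mulrA ler_pM2l// mulrCA ler_piMr//.
  by rewrite mulrC ler_pdivrMr// mul1r lerDl.
split; apply: near_is_derive => e e0; near=> t; rewrite [t *: (1 : R)]mulr1.
- apply: (@le_trans _ _ (normc (F (z + ((s + t)%:C * c) *: v) -
    F (z + (s%:C * c) *: v) - t%:C * (c * D)))); last by near: t; exact: H.
  by apply: le_trans (Re_le_normc _); rewrite !ReB ReZ.
- apply: (@le_trans _ _ (normc (F (z + ((s + t)%:C * c) *: v) -
    F (z + (s%:C * c) *: v) - t%:C * (c * D)))); last by near: t; exact: H.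
  by apply: le_trans (Im_le_normc _); rewrite !ImB ImZ.
Unshelve. all: by end_near. Qed.

(** The mean value theorem fails for complex values. Applied to the real and the imaginary part
    separately, it costs the factor 2. *)
Lemma derivable_slice_bound (F : 'rV[C]_n -> C) (z : 'rV[C]_n) j (c : C) (B : R) :
  (forall w, derivable F w (delta_mx ord0 j)) ->
  (forall s : R, 0 <= s <= 1 ->
     normc (partial j F (z + (s%:C * c) *: delta_mx ord0 j)) <= B) ->
  normc (F (z + c *: delta_mx ord0 j) - F z) <= 2 * normc c * B.
Proof.
move=> dF FB; pose v := delta_mx ord0 j : 'rV[C]_n.
have [dR dI] := all_and2 (fun s => is_derive_slice (dF (z + (s%:C * c) *: v))).
have NB s : 0 <= s <= 1 -> normc (c * 'D_v F (z + (s%:C * c) *: v)) <= normc c * B.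
  by move=> s01; rewrite normcM ler_wpM2l ?normc_ge0// FB.
have := is_derive_bound dR (fun s s01 => le_trans (Re_le_normc _) (NB s s01)).
have := is_derive_bound dI (fun s s01 => le_trans (Im_le_normc _) (NB s s01)).
rewrite !mul1r !mul0r scale0r addr0 -ReB -ImB => hI hR.
by rewrite (le_trans (normc_le_ReIm _))// -mulrA mulr2n mulrDl mul1r lerD.
Qed.

End mean_value.

(* An abstract normed field covers both [R] and [R[i]], and unification is much
   faster there than over [R[i]]. *)
Section partial_bounds.
Variables (R : realType) (K : numFieldType) (N : K -> R) (iota : R -> K) (n : nat).
Hypothesis N0 : N 0 = 0.
Hypothesis N_ge0 : forall x, 0 <= N x.
Hypothesis ND : forall x y, N (x + y) <= N x + N y.
Hypothesis NM : forall x y, N (x * y) = N x * N y.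
Hypothesis Niota : forall s, N (iota s) = `|s|.
Hypothesis slice_bound : forall (F : 'rV[K]_n -> K) (z : 'rV[K]_n) j (c : K) (B : R),
  (forall w, derivable F w (delta_mx ord0 j)) ->
  (forall s : R, 0 <= s <= 1 ->
     N (partial j F (z + (iota s * c) *: delta_mx ord0 j)) <= B) ->
  N (F (z + c *: delta_mx ord0 j) - F z) <= 2 * N c * B.

Lemma partial_bound_gen (F : 'rV[K]_n -> K) (z h : 'rV[K]_n) (e B : R) :
  (forall j w, derivable F w (delta_mx ord0 j)) ->
  (forall i, N (h ord0 i) <= e) ->
  (forall j (h' : 'rV[K]_n), (forall i, N (h' ord0 i) <= e) ->
     N (partial j F (z + h')) <= B) ->
  N (F (z + h) - F z) <= n%:R * (2 * e * B).
Proof.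
move=> dF he FB.
have := @staircase R K K N N0 ND n (fun h => F (z + h)) h (2 * e * B).
rewrite addr0; apply => h' j h'h h'j; rewrite addrA.
have B0 : 0 <= B by rewrite (le_trans (N_ge0 _) (FB j h he)).
rewrite (@le_trans _ _ (2 * N (h ord0 j) * B))//; last first.
  by rewrite ler_wpM2r// ler_wpM2l.
apply: slice_bound; first exact: dF.
move=> s /andP[s0 s1]; rewrite -addrA; apply: FB => i; rewrite !mxE eqxx/=.
have e0 : 0 <= e by rewrite (le_trans (N_ge0 _) (he j)).
have [->|ij] := eqVneq i j.
  rewrite h'j add0r mulr1 NM Niota ger0_norm//.
  by rewrite (le_trans _ (he j))// ler_piMl.
by rewrite mulr0 addr0; case: (h'h i) => ->//; rewrite N0.
Qed.

Lemma derivable_dot_form (a : 'I_n -> K) (z : 'rV[K]_n) j :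
  is_derive z (delta_mx ord0 j) (dot_form a) (a j).
Proof.
apply: near_is_derive => e e0; near=> k.
have -> : dot_form a (z + k *: delta_mx ord0 j) = dot_form a z + k * a j.
  by rewrite -[in RHS](dot_form_delta a j) addrC [in LHS]linearP addrC.
rewrite (_ : _ - _ = 0) ?normr0 ?mulr_ge0// ?ltW//.
by rewrite (addrC (dot_form a z)) addrK; exact: subrr.
Unshelve. all: by end_near. Qed.

(** The first-order bound is used twice. Subtracting the linear part leaves a function [E] whose
    partial derivatives are those of F minus their values at z; these are at most n (2 e B) by the
    bound for each [partial j F], and the bound for [E] contributes a second factor n (2 e). *)
Lemma partial_quadratic_bound_gen (F : 'rV[K]_n -> K) (z h : 'rV[K]_n) (e B : R) :
  (forall j w, derivable F w (delta_mx ord0 j)) ->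
  (forall i j w, derivable (partial i F) w (delta_mx ord0 j)) ->
  (forall i, N (h ord0 i) <= e) ->
  (forall i j (h' : 'rV[K]_n), (forall i, N (h' ord0 i) <= e) ->
     N (partial i (partial j F) (z + h')) <= B) ->
  N (F (z + h) - F z - dot_form (fun j => partial j F z) h) <=
    (2 * n%:R) ^+ 2 * B * e ^+ 2.
Proof.
move=> dF ddF he FB; pose a j := partial j F z.
pose E w := F w - dot_form a w.
have dE j w : is_derive w (delta_mx ord0 j) E (partial j F w - a j).
  by apply: is_deriveB; [exact/derivableP|exact: derivable_dot_form].
have -> : F (z + h) - F z - dot_form a h = E (z + h) - E z.
  by rewrite /E [dot_form a (z + h)]linearD/=; ring.
have -> : (2 * n%:R) ^+ 2 * B * e ^+ 2 = n%:R * (2 * e * (n%:R * (2 * e * B))) by ring.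
apply: (@partial_bound_gen E z h e (n%:R * (2 * e * B))).
- by move=> j w; exact: (@ex_derive _ _ _ _ _ _ _ (dE j w)).
- exact: he.
- move=> j h' h'e.
  rewrite [partial j E (z + h')](@derive_val _ _ _ _ _ _ _ (dE j (z + h'))).
  apply: (@partial_bound_gen (partial j F) z h' e B).
  + by move=> i w; exact: ddF.
  + exact: h'e.
  + by move=> i h'' h''e; exact: FB.
Qed.

End partial_bounds.

Section partial_bounds_complex.
Variables (R : realType) (n : nat).
Local Notation C := R[i].

Definition partial_bound :=
  @partial_bound_gen R C normc (real_complex R) n (normc0 R) (@normc_ge0 R)
    (@normcD R) (@normcM R) (@normc_real R) (@derivable_slice_bound R n).

Definition partial_quadratic_bound :=
  @partial_quadratic_bound_gen R C normc (real_complex R) n (normc0 R) (@normc_ge0 R)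
    (@normcD R) (@normcM R) (@normc_real R) (@derivable_slice_bound R n).

End partial_bounds_complex.

(** * Lebesgue integrals on R^n: affine substitutions and products *)

Section lebesgue_affine.
Variable R : realType.
Local Notation mu := (@lebesgue_measure R).
Local Notation mR := (measurableTypeR R).
Local Open Scope ereal_scope.
Variables (a l : R).
Hypothesis l0 : (0 < l)%R.

Definition affine (x : mR) : mR := (a + l * x)%R.

Lemma measurable_affine : measurable_fun [set: mR] affine.
Proof.
apply: (@measurable_funD _ mR); first exact: measurable_cst.
by apply: (@measurable_funM _ mR); [exact: measurable_cst|exact: measurable_id].
Qed.

Definition affine_image : {measure set mR -> \bar R} :=
  measure_function_pushforward__canonical__measure_function_Measure mu
    measurable_affine.

(** Under [affine], the preimage of a half-open interval is an interval rescaled by l^-1, so both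
    measures agree on such intervals; uniqueness of Lebesgue measure does the rest. *)
Lemma lebesgue_measure_affine (A : set mR) : measurable A ->
  mu A = mscale (NngNum (ltW l0)) affine_image A.
Proof.
move=> mA.
apply: lebesgue_measure_unique => // _ [[x y]] _ <-.
rewrite -[RHS]/(l%:E * mu (affine @^-1` `]x, y])).
have -> : affine @^-1` `]x, y] =
    `](l^-1 * (x - a))%R, (l^-1 * (y - a))%R]%classic.
  apply/seteqP; split => z /=; rewrite !in_itv/= /affine.
    by rewrite ltr_pdivrMl// ler_pdivlMl// ltrBlDl lerBrDl.
  by rewrite ltr_pdivrMl// ler_pdivlMl// ltrBlDl lerBrDl.
rewrite !lebesgue_measure_itv/= !lte_fin ltr_pM2l ?invr_gt0// ltrD2r.
case: ifPn => _; last by rewrite mule0.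
by rewrite -!EFinB -EFinM -mulrBr mulrA divff ?gt_eqF// mul1r opprB addrA subrK.
Qed.

Lemma ge0_integral_affine (f : mR -> \bar R) :
  measurable_fun [set: mR] f -> (forall x, 0 <= f x) ->
  \int[mu]_x f (affine x) = (l^-1)%:E * \int[mu]_x f x.
Proof.
move=> mf f0.
rewrite [in RHS](eq_measure_integral (mscale (NngNum (ltW l0)) affine_image)); last first.
  by move=> A mA _; exact: lebesgue_measure_affine.
rewrite ge0_integral_mscale//= muleA -EFinM mulVf ?gt_eqF// mul1e.
by rewrite [RHS](ge0_integral_pushforward measurable_affine)// preimage_setT.
Qed.

End lebesgue_affine.

Section lebesgue_tuple_integral.
Variable R : realType.
Local Notation mR := (measurableTypeR R).
Local Notation mu := (@lebesgue_measure R).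
Local Notation mun := (lebesgue_tuple R).
Local Open Scope ereal_scope.

Lemma integral_lebesgue_tuple0 (f : 0.-tuple mR -> \bar R) :
  measurable_fun [set: 0.-tuple mR] f -> \int[mun 0]_t f t = f [tuple].
Proof. by move=> mf; rewrite /= integral_dirac// diracT mul1e. Qed.

Lemma ge0_integral_lebesgue_tupleS n (f : n.+1.-tuple mR -> \bar R) :
  measurable_fun [set: n.+1.-tuple mR] f -> (forall t, 0 <= f t) ->
  \int[mun n.+1]_t f t = \int[mu]_x \int[mun n]_t f (pair_cons (x, t)).
Proof.
move=> mf f0.
rewrite [LHS](ge0_integral_pushforward (@measurable_pair_cons R n))//.
rewrite preimage_setT fubini_tonelli1//; last by move=> x; exact: f0.
by apply: measurableT_comp => //; exact: measurable_pair_cons.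
Qed.

Lemma measurable_pair_consr n (f : n.+1.-tuple mR -> \bar R) (x : mR) :
  measurable_fun [set: n.+1.-tuple mR] f ->
  measurable_fun [set: n.-tuple mR] (fun t => f (pair_cons (x, t))).
Proof.
move=> mf; apply: measurableT_comp => //.
by apply: measurableT_comp; [exact: measurable_pair_cons|exact: measurable_pair1].
Qed.

Lemma measurable_integral_pair_cons n (f : n.+1.-tuple mR -> \bar R) :
  measurable_fun [set: n.+1.-tuple mR] f -> (forall t, 0 <= f t) ->
  measurable_fun [set: mR] (fun x => \int[mun n]_t f (pair_cons (x, t))).
Proof.
move=> mf f0.
apply: (@measurable_fun_fubini_tonelli_F _ _ mR (n.-tuple mR) R (mun n)
  (fun p => f (pair_cons p))) => //.
by apply: measurableT_comp => //; exact: measurable_pair_cons.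
Qed.

Definition affine_tuple n (a : 'I_n -> R) (l : R) (t : n.-tuple mR) : n.-tuple mR :=
  [tuple affine (a i) l (tnth t i) | i < n].

Lemma measurable_affine_tuple n (a : 'I_n -> R) (l : R) :
  measurable_fun [set: n.-tuple mR] (affine_tuple a l).
Proof.
apply/measurable_fun_tnthP => i.
apply: (eq_measurable_fun (affine (a i) l \o (fun t : n.-tuple mR => tnth t i))).
  by move=> t _ /=; rewrite tnth_mktuple.
by apply: measurableT_comp; [exact: measurable_affine|exact: measurable_tnth].
Qed.

Lemma tnth_pair_cons0 n x (t : n.-tuple mR) : tnth (pair_cons (x, t)) ord0 = x.
Proof. by []. Qed.

Lemma tnth_pair_consS n x (t : n.-tuple mR) i :
  tnth (pair_cons (x, t)) (lift ord0 i) = tnth t i.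
Proof. by rewrite /pair_cons !(tnth_nth 0%R). Qed.

Lemma affine_pair_cons n (a : 'I_n.+1 -> R) (l : R) x (t : n.-tuple mR) :
  affine_tuple a l (pair_cons (x, t)) =
  pair_cons (affine (a ord0) l x, affine_tuple (fun i => a (lift ord0 i)) l t).
Proof.
apply: eq_from_tnth => i; rewrite tnth_mktuple.
case: (unliftP ord0 i) => [j|] ->; last by rewrite !tnth_pair_cons0.
by rewrite !tnth_pair_consS tnth_mktuple.
Qed.

(** Tonelli splits off the first coordinate, and each coordinate contributes one factor l^-1. *)
Lemma ge0_integral_affine_tuple n (a : 'I_n -> R) (l : R) (f : n.-tuple mR -> \bar R) :
  (0 < l)%R -> measurable_fun [set: n.-tuple mR] f -> (forall t, 0 <= f t) ->
  \int[mun n]_t f (affine_tuple a l t) = (l ^- n)%:E * \int[mun n]_t f t.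
Proof.
move=> l0; elim: n => [|n IH] in a f *; move=> mf f0.
  rewrite !integral_lebesgue_tuple0//; last first.
    by apply: measurableT_comp => //; exact: measurable_affine_tuple.
  by rewrite expr0 invr1 mul1e; congr f; apply: eq_from_tnth => -[].
rewrite !ge0_integral_lebesgue_tupleS//; last first.
  by apply: measurableT_comp => //; exact: measurable_affine_tuple.
under eq_integral do under eq_integral do rewrite affine_pair_cons.
under eq_integral => x _.
  rewrite (IH (fun i => a (lift ord0 i)) (fun t => f (pair_cons (affine (a ord0) l x, t))))//.
    over.
  exact: measurable_pair_consr.
have l0n : 0 <= (l ^- n)%:E by rewrite lee_fin invr_ge0 exprn_ge0// ltW.
have mF := measurable_integral_pair_cons mf f0.
have F0 x : 0 <= \int[mun n]_t f (pair_cons (x, t)) by apply: integral_ge0.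
have mFa := measurableT_comp mF (measurable_affine (a ord0) l).
rewrite (ge0_integralZl mu measurableT mFa _ l0n)/=; last by move=> x _; exact: F0.
rewrite (ge0_integral_affine _ l0 mF F0) muleA -EFinM; congr (_%:E * _).
by rewrite exprS invfM mulrC.
Qed.

Lemma integral_lebesgue_tuple_prod n (h : R -> R) (I : R) :
  measurable_fun [set: mR] (h : mR -> R) -> (forall x, (0 <= h x)%R) ->
  \int[mu]_x (h x)%:E = I%:E ->
  \int[mun n]_t (\prod_(i < n) h (tnth t i))%:E = (I ^+ n)%:E.
Proof.
move=> mh h0 hI.
have mp m : measurable_fun [set: m.-tuple mR]
    (fun t : m.-tuple mR => (\prod_(i < m) h (tnth t i))%:E).
  apply/measurable_EFinP; apply: measurable_prod => i _.
  by apply: (measurableT_comp mh); exact: measurable_tnth.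
have p0 m (t : m.-tuple mR) : 0 <= (\prod_(i < m) h (tnth t i))%:E.
  by rewrite lee_fin prodr_ge0.
elim: n => [|n IH].
  by rewrite integral_lebesgue_tuple0// big_ord0 expr0.
rewrite ge0_integral_lebesgue_tupleS//.
have E x (t : n.-tuple mR) : (\prod_(i < n.+1) h (tnth (pair_cons (x, t)) i))%:E =
    (h x)%:E * (\prod_(i < n) h (tnth t i))%:E.
  rewrite big_ord_recl EFinM tnth_pair_cons0; congr (_ * _%:E).
  by apply: eq_bigr => i _; rewrite tnth_pair_consS.
under eq_integral do under eq_integral do rewrite E.
under eq_integral => x _.
  rewrite (ge0_integralZl (mun n) measurableT (mp n) (fun t _ => p0 n t)) ?lee_fin//.
  rewrite IH muleC; over.
rewrite ge0_integralZl//; last 3 first.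
- exact/measurable_EFinP.
- by move=> x _; rewrite lee_fin.
- by rewrite -IH; exact: integral_ge0.
by rewrite hI -EFinM exprS mulrC.
Qed.

End lebesgue_tuple_integral.

(** * Complex-valued integrals *)

Section measurable_continuous.
Variables (R : realType) (n : nat).
Local Notation mR := (measurableTypeR R).

Definition row_of_tuple (t : n.-tuple mR) : 'rV[R]_n := \row_i tnth t i.

(* [U] is a countable union of rational boxes, each of which is measurable for the
   product sigma-algebra. *)
Lemma measurable_preimage_open (U : set 'rV[R]_n) : open U ->
  measurable (row_of_tuple @^-1` U).
Proof.
move=> oU; pose box (p : n.-tuple rat * nat) : set (n.-tuple mR) :=
  [set t | forall i, `|tnth t i - ratr (tnth p.1 i)| < p.2.+1%:R^-1].
have mbox p : measurable (box p).
  rewrite (_ : box p = \bigcap_(i in [set: 'I_n])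
    ((fun t : n.-tuple mR => tnth t i) @^-1`
      [set x | `|x - ratr (tnth p.1 i)| < p.2.+1%:R^-1])); last first.
    by apply/seteqP; split => t /= H i; [move=> _; exact: H|exact: (H i)].
  apply: fin_bigcap_measurable => // i _.
  rewrite -[X in measurable X]setTI; apply: measurable_tnth => //.
  apply: open_measurable.
  rewrite (_ : [set x | _] = ball (ratr (tnth p.1 i) : R) (p.2.+1%:R^-1)).
    by apply: ball_open; rewrite invr_gt0.
  by apply/seteqP; split => x; rewrite /= -ball_normE/= distrC.
(* Boxes that leave the preimage are replaced by the empty set, so that the union ranges over a
   fixed countable type. *)
rewrite (_ : row_of_tuple @^-1` U =
    \bigcup_(p in [set: n.-tuple rat * nat])
      (if `[< box p `<=` row_of_tuple @^-1` U >] then box p else set0)).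
  apply: countable_bigcupT_measurable; first exact: countableP.
  by move=> p; case: ifPn => _; [exact: mbox|exact: measurable0].
apply/seteqP; split => [t /= Ut|t [p _]]; last by case: asboolP => // + /= => /[apply].
have /nbhs_ballP[e /= e0 eU] : nbhs (row_of_tuple t) U by exact: open_nbhs_nbhs.
(* Two points of a box of radius below e / 2 around a rational point are at distance below e. *)
have [k ke] : exists k : nat, k.+1%:R^-1 < e / 2.
  have [k _ /(_ k (leqnn k))] := near_infty_natSinv_lt (PosNum (divr_gt0 e0 (@ltr0n R 2))).
  by move=> ?; exists k.
have k0 : (0 : R) < k.+1%:R^-1 by rewrite invr_gt0.
have qE i : {q : rat | `|tnth t i - ratr q| < k.+1%:R^-1}.
  apply: cid.
  have [|q] := @rat_in_itvoo R (tnth t i - k.+1%:R^-1) (tnth t i + k.+1%:R^-1).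
    by rewrite ltrBlDr -addrA ltrDl addr_gt0.
  by rewrite in_itv/= => qt; exists q; rewrite distrC ltr_distl.
pose p := ([tuple sval (qE i) | i < n], k).
exists p => //; have bp : box p t.
  by move=> i; rewrite tnth_mktuple; exact: (svalP (qE i)).
case: asboolP => // nbox; exfalso; apply: nbox => s bs /=; apply: eU.
split => // i j; rewrite !mxE -ball_normE/=.
rewrite (_ : _ - _ = (tnth t j - ratr (tnth p.1 j)) - (tnth s j - ratr (tnth p.1 j))).
  rewrite (le_lt_trans (ler_normB _ _))// (splitr e) ltrD//.
    by rewrite (lt_trans (bp j)).
  by rewrite (lt_trans (bs j)).
by rewrite opprB addrA subrK.
Qed.

Lemma measurable_continuous_rV (g : 'rV[R]_n -> R) : continuous g ->
  measurable_fun [set: n.-tuple mR] (g \o row_of_tuple).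
Proof.
move=> cg; apply: (measurability _ (RGenOpens.measurableE R)).
move=> _ [_ [a [b ->]] <-]; rewrite setTI comp_preimage.
apply: measurable_preimage_open; apply: open_comp; last exact: interval_open.
by move=> x _; exact: cg.
Qed.

End measurable_continuous.

Section complex_integral.
Variables (R : realType) (d : measure_display) (T : measurableType d).
Variable mu : {measure set T -> \bar R}.
Local Notation C := R[i].
Implicit Types f g : T -> C.

Definition cmeasurable f :=
  measurable_fun [set: T] (fun t => complex.Re (f t)) /\
  measurable_fun [set: T] (fun t => complex.Im (f t)).

Definition cintegrable f :=
  mu.-integrable setT (fun t => (complex.Re (f t))%:E) /\
  mu.-integrable setT (fun t => (complex.Im (f t))%:E).

(** For the measure [lebesgue_tuple R n] this is [integralRn] up to conversion. Keeping the measure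
    general also covers series, as integrals against the counting measure. *)
Definition cint f : C :=
  (\int[mu]_(t in setT) complex.Re (f t)) +i* (\int[mu]_(t in setT) complex.Im (f t)).

Lemma cmeasurableD f g : cmeasurable f -> cmeasurable g ->
  cmeasurable (fun t => f t + g t).
Proof.
move=> [f1 f2] [g1 g2]; split.
- by under eq_fun do rewrite ReD; exact: measurable_funD.
- by under eq_fun do rewrite ImD; exact: measurable_funD.
Qed.

Lemma ReMc (z w : C) :
  complex.Re (z * w) = complex.Re z * complex.Re w - complex.Im z * complex.Im w.
Proof. by case: z w => [a b] [a' b']. Qed.

Lemma ImMc (z w : C) :
  complex.Im (z * w) = complex.Re z * complex.Im w + complex.Im z * complex.Re w.
Proof. by case: z w => [a b] [a' b']. Qed.

Lemma cmeasurableM f g : cmeasurable f -> cmeasurable g ->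
  cmeasurable (fun t => f t * g t).
Proof.
move=> [f1 f2] [g1 g2]; split.
- under eq_fun do rewrite ReMc.
  by apply: measurable_funB; exact: measurable_funM.
- under eq_fun do rewrite ImMc.
  by apply: measurable_funD; exact: measurable_funM.
Qed.

Lemma cmeasurable_cst (c : C) : cmeasurable (fun=> c).
Proof. by split; exact: measurable_cst. Qed.

Lemma eq_cint f g : f =1 g -> cint f = cint g.
Proof. by move=> /funext ->. Qed.

Lemma cintegrableD f g : cintegrable f -> cintegrable g ->
  cintegrable (fun t => f t + g t).
Proof.
move=> [f1 f2] [g1 g2]; split.
- by under eq_fun do rewrite ReD EFinD; exact: integrableD.
- by under eq_fun do rewrite ImD EFinD; exact: integrableD.
Qed.

Lemma cintegrableZ (c : C) f : cintegrable f -> cintegrable (fun t => c * f t).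
Proof.
move=> [f1 f2]; split.
- under eq_fun do rewrite ReMc EFinB !EFinM.
  by apply: integrableB => //; exact: integrableZl.
- under eq_fun do rewrite ImMc EFinD !EFinM.
  by apply: integrableD => //; exact: integrableZl.
Qed.

Lemma cintD f g : cintegrable f -> cintegrable g ->
  cint (fun t => f t + g t) = cint f + cint g.
Proof.
move=> [f1 f2] [g1 g2]; rewrite /cint.
under eq_Rintegral do rewrite ReD.
under [X in _ +i* X]eq_Rintegral do rewrite ImD.
by rewrite !RintegralD.
Qed.

Lemma cintZ (c : C) f : cintegrable f -> cint (fun t => c * f t) = c * cint f.
Proof.
move=> [f1 f2]; rewrite /cint.
under eq_Rintegral do rewrite ReMc.
under [X in _ +i* X]eq_Rintegral do rewrite ImMc.
have Z (a : R) (h : T -> R) : mu.-integrable setT (EFin \o h) ->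
    mu.-integrable setT (EFin \o (fun t => a * h t)).
  by move=> ih; rewrite (_ : _ \o _ = (fun t => a%:E * (h t)%:E)%E)//; exact: integrableZl.
rewrite RintegralB ?RintegralD ?RintegralZl//; try exact: Z.
by apply: complex_eqP; rewrite ?ReMc ?ImMc.
Qed.

Lemma cintegrableN f : cintegrable f -> cintegrable (fun t => - f t).
Proof.
by move=> /(cintegrableZ (-1)); under eq_fun do rewrite mulN1r.
Qed.

Lemma cintegrableB f g : cintegrable f -> cintegrable g ->
  cintegrable (fun t => f t - g t).
Proof. by move=> fi /cintegrableN; exact: cintegrableD. Qed.

Lemma cintN f : cintegrable f -> cint (fun t => - f t) = - cint f.
Proof.
move=> fi; rewrite -[RHS]mulN1r -cintZ//.
by apply: eq_cint => t; rewrite mulN1r.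
Qed.

Lemma cintB f g : cintegrable f -> cintegrable g ->
  cint (fun t => f t - g t) = cint f - cint g.
Proof. by move=> fi gi; rewrite cintD ?cintN//; exact: cintegrableN. Qed.

Lemma cintegrable0 : cintegrable (fun=> 0).
Proof. by split; exact: integrable0. Qed.

Lemma cint0 : cint (fun=> 0) = 0.
Proof. by rewrite /cint /Rintegral !integral0. Qed.

Lemma cintegrable_sum (I : Type) (s : seq I) (P : pred I) (F : I -> T -> C) :
  (forall i, P i -> cintegrable (F i)) ->
  cintegrable (fun t => \sum_(i <- s | P i) F i t) /\
  cint (fun t => \sum_(i <- s | P i) F i t) = \sum_(i <- s | P i) cint (F i).
Proof.
move=> FI; elim: s => [|i s [IH1 IH2]].
  under eq_fun do rewrite big_nil.
  by rewrite big_nil; split; [exact: cintegrable0|exact: cint0].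
under eq_fun do rewrite big_cons.
rewrite big_cons; case: ifPn => // Pi.
by split; [exact: cintegrableD (FI _ Pi) IH1|rewrite cintD ?IH2//; exact: FI].
Qed.

Lemma cintegrable_le f (B : T -> R) : cmeasurable f ->
  (forall t, normc (f t) <= B t) -> mu.-integrable setT (EFin \o B) -> cintegrable f.
Proof.
move=> [f1 f2] fB iB; split; apply: le_integrable iB => //.
- exact/measurable_EFinP.
- move=> t _ /=; rewrite lee_fin (le_trans (Re_le_normc _))// (le_trans (fB t))//.
  exact: ler_norm.
- exact/measurable_EFinP.
- move=> t _ /=; rewrite lee_fin (le_trans (Im_le_normc _))// (le_trans (fB t))//.
  exact: ler_norm.
Qed.

(** Real and imaginary part are estimated separately, which costs the factor 2 but needs no rotation
    of the integral. *)
Lemma normc_cint_le f (B : T -> R) : cintegrable f ->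
  (forall t, normc (f t) <= B t) -> mu.-integrable setT (EFin \o B) ->
  normc (cint f) <= 2 * \int[mu]_(t in setT) B t.
Proof.
move=> [f1 f2] fB iB; rewrite (le_trans (normc_le_ReIm _))// mulr2n mulrDl mul1r.
have H (h : T -> R) : mu.-integrable setT (EFin \o h) ->
    (forall t, `|h t| <= B t) ->
    `|\int[mu]_(t in setT) h t| <= \int[mu]_(t in setT) B t.
  move=> ih hB; rewrite (le_trans (le_normr_Rintegral _ ih))//.
  by apply: le_Rintegral => //; exact: integrable_norm ih.
apply: lerD; apply: H => // t.
- by rewrite (le_trans (Re_le_normc _)).
- by rewrite (le_trans (Im_le_normc _)).
Qed.

End complex_integral.

Section differentiation_under_cint.
Variables (R : realType) (d : measure_display) (T : measurableType d).
Variable mu : {measure set T -> \bar R}.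
Variable n : nat.
Local Notation C := R[i].

(** The bound [B] on the second derivatives makes the first-order remainder of the integrand
    quadratic in the increment for each t. Integrating in t preserves this, so the integral
    satisfies the criterion [differentiable_dot_form]. *)
Lemma differentiable_cint (A : 'rV[C]_n -> T -> C) (z : 'rV[C]_n) (B : T -> R) :
  (forall t j w, derivable (A^~ t) w (delta_mx ord0 j)) ->
  (forall t i j w, derivable (partial i (A^~ t)) w (delta_mx ord0 j)) ->
  (forall i j (h : 'rV[C]_n) t, (forall i, normc (h ord0 i) <= 1) ->
     normc (partial i (partial j (A^~ t)) (z + h)) <= B t) ->
  mu.-integrable setT (EFin \o B) ->
  (forall w, cintegrable mu (A w)) ->
  (forall j, cintegrable mu (fun t => partial j (A^~ t) z)) ->
  differentiable (fun w => cint mu (A w)) z /\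
  forall j, is_derive z (delta_mx ord0 j) (fun w => cint mu (A w))
    (cint mu (fun t => partial j (A^~ t) z)).
Proof.
move=> dA ddA AB iB iA iA'.
apply: (@differentiable_dot_form R n _ z _
  (2 * ((2 * n%:R) ^+ 2 * \int[mu]_(t in setT) B t))) => h e e1 he.
have [S1 S2] := @cintegrable_sum _ _ _ mu _ (index_enum 'I_n) xpredT
  (fun j t => h ord0 j * partial j (A^~ t) z)
  (fun j _ => cintegrableZ (h ord0 j) (iA' j)).
have -> : cint mu (A (z + h)) - cint mu (A z) -
    dot_form (fun j => cint mu (fun t => partial j (A^~ t) z)) h =
    cint mu (fun t => A (z + h) t - A z t -
      dot_form (fun j => partial j (A^~ t) z) h).
  rewrite cintB//; last exact: cintegrableB.
  rewrite cintB//; congr (_ - _); rewrite /dot_form S2.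
  by apply: eq_bigr => j _; rewrite cintZ.
have iZ : mu.-integrable setT (EFin \o (fun t => (2 * n%:R) ^+ 2 * e ^+ 2 * B t)).
  by rewrite (_ : _ \o _ = (fun t => ((2 * n%:R) ^+ 2 * e ^+ 2)%:E * (B t)%:E)%E)//;
    exact: integrableZl.
rewrite [leRHS](_ : _ = 2 * \int[mu]_(t in setT) ((2 * n%:R) ^+ 2 * e ^+ 2 * B t)); last first.
  by rewrite RintegralZl//; ring.
apply: normc_cint_le => //.
- by apply: cintegrableB; [exact: cintegrableB|exact: S1].
- move=> t; rewrite mulrAC; apply: partial_quadratic_bound => //.
  by move=> i j h' h'e; apply: AB => k; rewrite (le_trans (h'e k)).
Qed.

End differentiation_under_cint.

(** * Calculus of partial derivatives; polynomials as functions *)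

Section partial_derivative_calculus.
Variables (K : numFieldType) (n : nat).
Implicit Types (F G D E : 'rV[K]_n -> K) (j : 'I_n).

(** Naming the derivative as a function on the whole space allows it to be differentiated again;
    [partialE] turns the relation into an equation. *)
Definition has_partial j F D := forall z, is_derive z (delta_mx ord0 j) F (D z).

Lemma partialE j F D : has_partial j F D -> partial j F = D.
Proof. by move=> FD; apply/funext => z; exact: (@derive_val _ _ _ _ _ _ _ (FD z)). Qed.

Lemma has_partial_derivable j F D z : has_partial j F D ->
  derivable F z (delta_mx ord0 j).
Proof. by move=> FD; exact: (@ex_derive _ _ _ _ _ _ _ (FD z)). Qed.

Lemma has_partialP j F : (forall z, derivable F z (delta_mx ord0 j)) ->
  has_partial j F (partial j F).
Proof. by move=> dF z; apply: DeriveDef => //. Qed.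

Lemma eq_has_partial j F D G E : has_partial j F D -> F =1 G -> D =1 E ->
  has_partial j G E.
Proof. by move=> + /funext <- /funext <-. Qed.

Lemma has_partial_cst j (c : K) : has_partial j (fun=> c) (fun=> 0).
Proof. by move=> z; exact: is_derive_cst. Qed.

Lemma has_partialD j F D G E : has_partial j F D -> has_partial j G E ->
  has_partial j (fun z => F z + G z) (fun z => D z + E z).
Proof. by move=> FD GE z; exact: (is_deriveD (FD z) (GE z)). Qed.

Lemma has_partialM j F D G E : has_partial j F D -> has_partial j G E ->
  has_partial j (fun z => F z * G z) (fun z => F z * E z + G z * D z).
Proof. by move=> FD GE z; exact: (is_deriveM (FD z) (GE z)). Qed.

Lemma has_partialZ j (c : K) F D : has_partial j F D ->
  has_partial j (fun z => c * F z) (fun z => c * D z).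
Proof. by move=> FD z; exact: (is_deriveZ c (FD z)). Qed.

Lemma has_partialN j F D : has_partial j F D ->
  has_partial j (fun z => - F z) (fun z => - D z).
Proof. by move=> FD z; exact: (is_deriveN (FD z)). Qed.

Lemma has_partialB j F D G E : has_partial j F D -> has_partial j G E ->
  has_partial j (fun z => F z - G z) (fun z => D z - E z).
Proof. by move=> FD /has_partialN; exact: has_partialD. Qed.

Lemma has_partial_sum j (I : Type) (s : seq I) (P : pred I)
    (F D : I -> 'rV[K]_n -> K) :
  (forall i, P i -> has_partial j (F i) (D i)) ->
  has_partial j (fun z => \sum_(i <- s | P i) F i z)
    (fun z => \sum_(i <- s | P i) D i z).
Proof.
move=> FD; elim: s => [|i s IH].
  by apply: (eq_has_partial (has_partial_cst j 0)) => z; rewrite big_nil.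
have [Pi|nPi] := boolP (P i).
  by apply: (eq_has_partial (has_partialD (FD _ Pi) IH)) => z; rewrite big_cons Pi.
by apply: (eq_has_partial IH) => z; rewrite big_cons (negbTE nPi).
Qed.

Lemma has_partial_coord j i : has_partial j (fun z => z ord0 i) (fun=> (i == j)%:R).
Proof.
move=> z; apply: near_is_derive => e e0; near=> k.
rewrite !mxE eqxx/= (_ : _ - _ = 0) ?normr0 ?mulr_ge0// ?ltW//.
by rewrite (addrC (z ord0 i)) addrK; exact: subrr.
Unshelve. all: by end_near. Qed.

Lemma has_partial_affine j F D (u : 'rV[K]_n) (c : K) : has_partial j F D ->
  has_partial j (fun z => F (u + c *: z)) (fun z => c * D (u + c *: z)).
Proof.
move=> FD z; apply: near_is_derive => e e0.
have c1 : 0 < `|c| + 1 by rewrite ltr_wpDl.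
have := is_derive_near (FD (u + c *: z)) (divr_gt0 e0 c1).
move=> /nbhs_ballP[d /= d0 dP]; apply/nbhs_ballP.
exists (d / (`|c| + 1)); first exact: divr_gt0.
move=> k; rewrite -ball_normE/= sub0r normrN => kd.
have ckd : ball 0 d (k * c).
  rewrite -ball_normE/= sub0r normrN normrM.
  rewrite (@le_lt_trans _ _ (`|k| * (`|c| + 1)))//; first by rewrite ler_wpM2l// lerDl.
  by rewrite -ltr_pdivlMr.
have := dP _ ckd; rewrite scalerDr addrA -scalerA [c *: (k *: _)]scalerA (mulrC c k).
rewrite scalerA.
rewrite -[(k * c) *: D _]/(k * c * D _) -[k *: (c * _)]/(k * (c * _)) mulrA.
move=> /le_trans; apply; rewrite normrM mulrCA (mulrC `|k|) ler_wpM2r//.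
by rewrite mulrAC ler_pdivrMr// ler_wpM2l ?lerDl// ltW.
Qed.

(** Reduces a directional derivative to one variable, where the chain rule for differentials
    applies. *)
Lemma is_derive_lineP (F : 'rV[K]_n -> K) z v (d : K) :
  is_derive z v F d <-> is_derive (0 : K) (1 : K) (fun h => F (z + h *: v)) d.
Proof.
split=> Fd; apply: near_is_derive => e /(is_derive_near Fd); apply: filterS => k;
  by rewrite scale0r addr0 add0r [k *: (1 : K)]mulr1.
Qed.

Lemma has_partial_comp j F D (f f' : K -> K) :
  (forall x, is_derive x (1 : K) f (f' x)) -> has_partial j F D ->
  has_partial j (fun z => f (F z)) (fun z => D z * f' (F z)).
Proof.
move=> ff' FD z; apply/is_derive_lineP.
have /is_derive_lineP gD := FD z.
set g := (fun h => F (z + h *: delta_mx ord0 j)) in gD *.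
have g0 : g 0 = F z by rewrite /g scale0r addr0.
have dg : differentiable g 0 by apply/derivable1_diffP; exact: ex_derive.
have df : differentiable f (g 0) by apply/derivable1_diffP; exact: ex_derive.
have dfg : differentiable (f \o g) 0 by exact: differentiable_comp.
apply: DeriveDef; first exact/derivable1_diffP.
rewrite -[X in derive X _ _]/(f \o g) (deriveE _ dfg) diff_comp//.
have g1 : 'd g 0 1 = D z by rewrite -deriveE//; exact: derive_val.
have f1 : 'd f (g 0) 1 = f' (F z) by rewrite -deriveE// g0; exact: derive_val.
apply: etrans (congr1 ('d f (g 0)) g1) _.
have lin := linearZ_LR ('d f (g 0)) (D z) (1 : K).
have DzE : D z *: (1 : K) = D z by exact: mulr1.
by rewrite DzE in lin; rewrite lin f1.
Qed.

(** Polynomial functions, given by their closure properties. Derivatives, growth and expansions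
    follow by induction on the construction, without any normal form. *)
Inductive cpoly : ('rV[K]_n -> K) -> Prop :=
| cpoly_cst c : cpoly (fun=> c)
| cpoly_coord i : cpoly (fun z => z ord0 i)
| cpolyD F G : cpoly F -> cpoly G -> cpoly (fun z => F z + G z)
| cpolyM F G : cpoly F -> cpoly G -> cpoly (fun z => F z * G z).

Lemma cpoly_has_partial F : cpoly F -> forall j, exists2 D, cpoly D & has_partial j F D.
Proof.
elim=> {F} [c|i|F G cF IF cG IG|F G cF IF cG IG] j.
- by exists (fun=> 0); [exact: cpoly_cst|exact: has_partial_cst].
- by exists (fun=> (i == j)%:R); [exact: cpoly_cst|exact: has_partial_coord].
- have [D cD FD] := IF j; have [E cE GE] := IG j.
  by exists (fun z => D z + E z); [exact: cpolyD|exact: has_partialD].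
- have [D cD FD] := IF j; have [E cE GE] := IG j.
  exists (fun z => F z * E z + G z * D z); last exact: has_partialM.
  by apply: cpolyD; exact: cpolyM.
Qed.

Lemma cpoly_sum (I : Type) (s : seq I) (P : pred I) (F : I -> 'rV[K]_n -> K) :
  (forall i, P i -> cpoly (F i)) -> cpoly (fun z => \sum_(i <- s | P i) F i z).
Proof.
move=> cF; elim: s => [|i s IH].
  by under eq_fun do rewrite big_nil; exact: cpoly_cst.
under eq_fun do rewrite big_cons.
by case: (boolP (P i)) => // Pi; apply: cpolyD => //; exact: cF.
Qed.

Lemma cpoly_prod (I : Type) (s : seq I) (P : pred I) (F : I -> 'rV[K]_n -> K) :
  (forall i, P i -> cpoly (F i)) -> cpoly (fun z => \prod_(i <- s | P i) F i z).
Proof.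
move=> cF; elim: s => [|i s IH].
  by under eq_fun do rewrite big_nil; exact: cpoly_cst.
under eq_fun do rewrite big_cons.
by case: (boolP (P i)) => // Pi; apply: cpolyM => //; exact: cF.
Qed.

Lemma cpolyX F k : cpoly F -> cpoly (fun z => F z ^+ k).
Proof.
move=> cF; elim: k => [|k IH]; first by under eq_fun do rewrite expr0; exact: cpoly_cst.
by under eq_fun do rewrite exprS; exact: cpolyM.
Qed.

Lemma cpoly_affine F (u : 'rV[K]_n) (c : K) : cpoly F -> cpoly (fun z => F (u + c *: z)).
Proof.
elim=> {F} [a|i|F G _ IF _ IG|F G _ IF _ IG]; [exact: cpoly_cst| |exact: cpolyD|exact: cpolyM].
under eq_fun do rewrite !mxE.
by apply: cpolyD; [exact: cpoly_cst|apply: cpolyM; [exact: cpoly_cst|exact: cpoly_coord]].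
Qed.

End partial_derivative_calculus.

(** * The complex exponential *)

Section complex_exponential.
Variable R : realType.
Local Notation C := R[i].

Definition cexp (z : C) : C :=
  (expR (complex.Re z) * cos (complex.Im z)) +i* (expR (complex.Re z) * sin (complex.Im z)).

Lemma cexpD z w : cexp (z + w) = cexp z * cexp w.
Proof.
rewrite /cexp ReD ImD expRD cosD sinD; apply: complex_eqP; rewrite ?ReMc ?ImMc/=; ring.
Qed.

Lemma normc_cexp z : normc (cexp z) = expR (complex.Re z).
Proof.
by rewrite /cexp /= !exprMn -mulrDr cos2Dsin2 mulr1 sqrtr_sqr ger0_norm// expR_ge0.
Qed.

Lemma cexp_near0 (e : R) : 0 < e -> exists2 d : R, 0 < d &
  forall k : C, normc k < d -> normc (cexp k - 1 - k) <= e * normc k.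
Proof.
(* The errors below add up to 9 e' |k|, which 12 e' <= e covers. *)
move=> e0; have [e' [e'0 e'1 e'e]] : exists e' : R, [/\ 0 < e', e' <= 1 & 12 * e' <= e].
  exists (Num.min 1 (e / 12)); split; first by rewrite lt_min ltr01 divr_gt0.
    by rewrite ge_min lexx.
  by rewrite mulrC -ler_pdivlMr// ge_min lexx orbT.
have nearR (f : R -> R) (D : R) : is_derive (0 : R) (1 : R) f D ->
    exists2 d : R, 0 < d & forall k, `|k| < d -> `|f k - f 0 - k * D| <= e' * `|k|.
  move=> /is_derive_near /(_ e' e'0) /nbhs_ballP[d d0 dP]; exists d => // k kd.
  have := dP k; rewrite -ball_normE/= sub0r normrN => /(_ kd).
  by rewrite add0r [k *: 1]mulr1.
have [d1 d10 H1] := nearR expR 1 (is_derive_eq (is_derive_expR 0) (@expR0 R)).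
have [d2 d20 H2] := nearR cos 0 (is_derive_eq (is_derive_cos 0)
  (etrans (congr1 -%R (@sin0 R)) (oppr0 R))).
have [d3 d30 H3] := nearR sin 1 (is_derive_eq (is_derive_sin 0) (@cos0 R)).
exists (Num.min (Num.min d1 e') (Num.min d2 d3)).
  by rewrite !lt_min d10 e'0 d20 d30.
move=> k; rewrite !lt_min => /andP[/andP[kd1 ke] /andP[kd2 kd3]].
case: k => a b in kd1 ke kd2 kd3 *; set N := normc (a +i* b).
have aN : `|a| <= N := Re_le_normc (a +i* b).
have bN : `|b| <= N := Im_le_normc (a +i* b).
have := H1 a (le_lt_trans aN kd1); rewrite expR0 mulr1 => {}H1.
have := H2 b (le_lt_trans bN kd2); rewrite cos0 mulr0 subr0 => {}H2.
have := H3 b (le_lt_trans bN kd3); rewrite sin0 mulr1 subr0 => {}H3.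
have N0 : 0 <= N := normc_ge0 _.
have N1 : N <= 1 by rewrite (le_trans (ltW ke)).
(* Since e' <= 1, the linearisation error of [expR] is at most |a|. *)
have E1 : `|expR a - 1| <= 2 * N.
  rewrite (_ : expR a - 1 = (expR a - 1 - a) + a); last by rewrite subrK.
  rewrite (le_trans (ler_normD _ _))// mulr2n mulrDl mul1r lerD//.
  rewrite (le_trans H1)// (le_trans _ aN)// ler_piMl//.
have E2 : expR a <= 3.
  have : expR a - 1 <= 2 by rewrite (le_trans (ler_norm _))// (le_trans E1)//; lra.
  by lra.
rewrite (le_trans (normc_le_ReIm _))//= !subr0.
have -> : expR a * cos b - 1 - a = (expR a - 1 - a) + expR a * (cos b - 1) by ring.
have -> : expR a * sin b - b = (expR a - 1) * sin b + (sin b - b) by ring.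
have S1 : `|(expR a - 1 - a) + expR a * (cos b - 1)| <= e' * N + 3 * (e' * N).
  rewrite (le_trans (ler_normD _ _))// lerD//; first by rewrite (le_trans H1)// ler_wpM2l// ltW.
  rewrite normrM (ger0_norm (expR_ge0 _)) ler_pM ?expR_ge0//.
  by rewrite (le_trans H2)// ler_wpM2l// ltW.
have S2 : `|(expR a - 1) * sin b + (sin b - b)| <= 2 * N * (2 * e') + e' * N.
  rewrite (le_trans (ler_normD _ _))// lerD//; last by rewrite (le_trans H3)// ler_wpM2l// ltW.
  rewrite normrM ler_pM//.
  rewrite (_ : sin b = (sin b - b) + b); last by rewrite subrK.
  rewrite (le_trans (ler_normD _ _))// mulr2n mulrDl mul1r lerD//.
    by rewrite (le_trans H3)// ler_piMr ?(ltW e'0)// (le_trans bN N1).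
  by rewrite (le_trans bN)// ltW.
apply: le_trans (lerD S1 S2) _.
have -> : e' * N + 3 * (e' * N) + (2 * N * (2 * e') + e' * N) = 9 * e' * N by ring.
by rewrite ler_wpM2r//; lra.
Qed.

(** The functional equation moves the question to 0; the error of [cexp_near0] is scaled by |cexp
    z|, hence the division of e by it. *)
Lemma is_derive_cexp (z : C) : is_derive z (1 : C) cexp (cexp z).
Proof.
apply: near_is_derive => e e0.
have [er er0 ere] : exists2 er : R, 0 < er & er%:C = e.
  exists (complex.Re e); last by rewrite RRe_real ?gtr0_real.
  by move: e0; rewrite ltcE => /andP[].
have c0 : 0 < normc (cexp z) by rewrite normc_cexp expR_gt0.
have [d d0 dP] := cexp_near0 (divr_gt0 er0 c0).
have dC0 : 0 < d%:C by rewrite ltcR.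
apply/nbhs_ballP; exists d%:C => // k; rewrite -ball_normE/= sub0r normrN.
rewrite normrcE ltcR => kd.
rewrite -[k *: (1 : C)]/(k * 1) mulr1 -[k *: cexp z]/(k * cexp z) cexpD.
rewrite -[X in X - _]/(cexp z * cexp k - cexp z).
rewrite (_ : _ - _ = cexp z * (cexp k - 1 - k)); last by rewrite !mulrBr mulr1 (mulrC k).
rewrite -ere -[X in X <= _]/`|cexp z * (cexp k - 1 - k) : C|.
rewrite -[X in _ <= _ * X]/`|k : C| !normrcE -rmorphM/= lecR normcM.
by rewrite mulrC -ler_pdivlMr// mulrAC dP.
Qed.

End complex_exponential.

(** * Decay on strips *)

Section weights.
Variables (R : realType) (n : nat).
Local Notation C := R[i].
Implicit Types (u v : 'rV[R]_n).

(** A weight of polynomial growth whose reciprocal is a product of Cauchy densities up to a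
    constant, so that its integral factorises into one-dimensional ones. *)
Definition rho u : R := \prod_i (1 + u ord0 i ^+ 2).

Lemma rho_ge1 u : 1 <= rho u.
Proof.
rewrite /rho; elim/big_ind : _ => // [x y x1 y1|i _]; last by rewrite lerDl sqr_ge0.
by rewrite -[1]mulr1 ler_pM.
Qed.

Lemma rho_gt0 u : 0 < rho u.
Proof. exact: lt_le_trans ltr01 (rho_ge1 u). Qed.

Lemma rho_ge0 u : 0 <= rho u.
Proof. exact/ltW/rho_gt0. Qed.

Lemma rho_coord u i : `|u ord0 i| <= rho u.
Proof.
rewrite /rho (bigD1 i)//=.
have P1 : 1 <= \prod_(j < n | j != i) (1 + u ord0 j ^+ 2).
  elim/big_ind : _ => // [x y x1 y1|j _]; last by rewrite lerDl sqr_ge0.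
  by rewrite -[1]mulr1 ler_pM.
have H : `|u ord0 i| <= 1 + u ord0 i ^+ 2.
  rewrite -[u ord0 i ^+ 2]real_normK ?num_real//.
  have := sqr_ge0 (`|u ord0 i| - 1); have := normr_ge0 (u ord0 i).
  by move: (`|u ord0 i|) => a a0; rewrite sqrrB1 => ?; nra.
by rewrite (le_trans H)// ler_peMr// addr_ge0// sqr_ge0.
Qed.

(** Peetre's inequality. In each coordinate, 2 (1 + a^2) (1 + b^2) exceeds 1 + (a + b)^2 by 1 + (a -
    b)^2 + 2 (a b)^2. *)
Lemma rho_peetre u v : rho (u + v) <= 2 ^+ n * rho u * rho v.
Proof.
rewrite /rho -[in 2 ^+ n](card_ord n) -prodr_const -!big_split/=.
apply: ler_prod => i _; rewrite mxE addr_ge0 ?sqr_ge0//=.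
move: (u ord0 i) (v ord0 i) => a b.
have := sqr_ge0 (a - b); have := sqr_ge0 (a * b).
by rewrite sqrrB sqrrD exprMn; nra.
Qed.

Lemma rhoN u : rho (- u) = rho u.
Proof. by apply: eq_bigr => i _; rewrite mxE sqrrN. Qed.

Lemma rho_scale (l : R) u : l != 0 -> rho u <= (1 + l ^- 2) ^+ n * rho (l *: u).
Proof.
move=> l0; rewrite /rho -[in X in _ ^+ X](card_ord n) -prodr_const -big_split/=.
apply: ler_prod => i _; rewrite mxE addr_ge0 ?sqr_ge0//= exprMn mulrDl mul1r mulrDr mulr1.
rewrite mulrA mulVf ?expf_neq0// mul1r.
have := sqr_ge0 (l * u ord0 i); rewrite exprMn => h.
have := sqr_ge0 l; rewrite -invr_ge0 => h2.
by rewrite -addrA lerD2l; lra.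
Qed.

Lemma rho_unit u (B : R) : (forall i, `|u ord0 i| <= B) -> rho u <= (1 + B ^+ 2) ^+ n.
Proof.
move=> uB; rewrite -[in X in _ ^+ X](card_ord n) -prodr_const.
apply: ler_prod => i _; rewrite addr_ge0 ?sqr_ge0//= lerD2l.
by rewrite -[leLHS]real_normK ?num_real// ler_pXn2r// nnegrE (le_trans _ (uB i)).
Qed.

Definition strip (V : R) (z : 'rV[C]_n) := forall i, `|complex.Im (z ord0 i)| <= V.

Definition crho (z : 'rV[C]_n) : R := rho (re_vec z).

(** Rapid decay in the real directions, uniformly on every strip about R^n. The weight sees only the
    real part, because on a strip the imaginary part is bounded. *)
Definition decays (A : 'rV[C]_n -> C) := forall (N : nat) (V : R),
  exists2 D : R, 0 <= D & forall z, strip V z -> normc (A z) * crho z ^+ N <= D.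

Lemma cpoly_growth (p : 'rV[C]_n -> C) : cpoly p -> forall V : R,
  exists D N, [/\ 0 <= D & forall z, strip V z -> normc (p z) <= D * crho z ^+ N].
Proof.
have X1 z N : 1 <= crho z ^+ N by rewrite exprn_ege1// rho_ge1.
move=> cp V; elim: cp => {p} [c|i|p q _ [D1 [N1 [D10 H1]]] _ [D2 [N2 [D20 H2]]]
  |p q _ [D1 [N1 [D10 H1]]] _ [D2 [N2 [D20 H2]]]].
- by exists (normc c), 0%N; split => [|z _]; rewrite ?normc_ge0// expr0 mulr1.
- exists (1 + `|V|), 1%N; split => [|z zV]; first by rewrite addr_ge0.
  rewrite expr1 (le_trans (normc_le_ReIm _))// mulrDl mul1r lerD//.
    by have := rho_coord (re_vec z) i; rewrite mxE.
  rewrite (le_trans (zV i))// (le_trans (ler_norm _))// ler_peMr//.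
  exact: rho_ge1.
- exists (D1 + D2), (N1 + N2)%N; split => [|z zV]; first exact: addr_ge0.
  rewrite (le_trans (normcD _ _))// mulrDl lerD//.
    rewrite (le_trans (H1 z zV))// exprD ler_wpM2l// ler_peMr//.
    by rewrite (le_trans ler01).
  rewrite (le_trans (H2 z zV))// exprD ler_wpM2l// ler_peMl//.
  by rewrite (le_trans ler01).
- exists (D1 * D2), (N1 + N2)%N; split => [|z zV]; first exact: mulr_ge0.
  by rewrite normcM exprD mulrACA ler_pM ?normc_ge0 ?H1 ?H2.
Qed.

(** Follows from exp(t) = exp(t / (M + 1))^(M + 1) and exp(s) >= 1 + s. Taking M + 1 instead of M
    keeps the divisor nonzero. *)
Lemma expR_ge_pow (M : nat) (t : R) : 0 <= t -> (1 + t) ^+ M <= M.+1%:R ^+ M.+1 * expR t.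
Proof.
move=> t0; apply: (@le_trans _ _ ((1 + t) ^+ M.+1)).
  by rewrite exprS ler_peMl ?exprn_ge0 ?lerDl// addr_ge0.
have -> : expR t = expR (t / M.+1%:R) ^+ M.+1.
  by rewrite -expRM_natl mulrC divfK.
rewrite -exprMn ler_pXn2r ?nnegrE ?addr_ge0 ?mulr_ge0 ?expR_ge0//.
apply: (@le_trans _ _ (M.+1%:R * (1 + t / M.+1%:R))).
  rewrite mulrDr mulr1 mulrC divfK// lerD2r -[1]/(1%:R) ler_nat//.
by rewrite ler_wpM2l// expR_ge1Dx.
Qed.

Definition gauss (z : 'rV[C]_n) : C := cexp (- \sum_i z ord0 i * z ord0 i).

Lemma normc_gauss z : normc (gauss z) =
  \prod_i (expR (complex.Im (z ord0 i) ^+ 2) * expR (- complex.Re (z ord0 i) ^+ 2)).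
Proof.
rewrite normc_cexp ReN.
have -> : complex.Re (\sum_i z ord0 i * z ord0 i) =
    \sum_i (complex.Re (z ord0 i) ^+ 2 - complex.Im (z ord0 i) ^+ 2).
  elim/big_ind2 : _ => // [x1 x2 y1 y2 <- <-|i _]; first exact: ReD.
  by rewrite ReMc !expr2.
rewrite -sumrN expR_sum; apply: eq_bigr => i _.
by rewrite -expRD opprB.
Qed.

Lemma gauss_decays : decays gauss.
Proof.
move=> N V; exists (\prod_(i < n) (expR (V ^+ 2) * N.+1%:R ^+ N.+1)).
  by apply: prodr_ge0 => i _; rewrite mulr_ge0 ?expR_ge0.
move=> z zV; rewrite normc_gauss /crho /rho -prodrXl -big_split/=.
apply: ler_prod => i _; rewrite !mulr_ge0 ?expR_ge0 ?exprn_ge0 ?addr_ge0 ?sqr_ge0//=.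
rewrite -mulrA ler_pM ?expR_ge0 ?mulr_ge0 ?expR_ge0 ?exprn_ge0 ?addr_ge0 ?sqr_ge0//.
  rewrite ler_expR -[leLHS]real_normK ?num_real// ler_pXn2r ?nnegrE//.
  by rewrite (le_trans _ (zV i)).
by rewrite mxE expRN mulrC ler_pdivrMr ?expR_gt0// expR_ge_pow// sqr_ge0.
Qed.

(** Rapid decay of all iterated partial derivatives up to order d. Derivatives are only asked to
    exist with [has_partial], so that niceness of a series or a dilation is shown by exhibiting
    them. *)
Fixpoint nice (d : nat) (A : 'rV[C]_n -> C) : Prop :=
  decays A /\
  match d with
  | 0 => True
  | d'.+1 => forall j, exists2 D, has_partial j A D & nice d' D
  end.

Lemma nice_decays d A : nice d A -> decays A.
Proof. by case: d => [|d] []. Qed.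

Lemma decays_poly_gauss p : cpoly p -> decays (fun z => p z * gauss z).
Proof.
move=> cp N V; have [D [M [D0 pD]]] := cpoly_growth cp V.
have [E E0 gE] := gauss_decays (M + N) V.
exists (D * E); first exact: mulr_ge0.
move=> z zV; rewrite normcM -mulrA.
apply: (@le_trans _ _ ((D * crho z ^+ M) * (normc (gauss z) * crho z ^+ N))).
  by rewrite ler_wpM2r ?pD// mulr_ge0 ?normc_ge0 ?exprn_ge0 ?rho_ge0.
rewrite -mulrA ler_wpM2l// (le_trans _ (gE z zV))// exprD.
by rewrite mulrCA.
Qed.

Lemma has_partial_gauss j : exists2 D, cpoly D &
  has_partial j gauss (fun z => D z * gauss z).
Proof.
have cq : cpoly (fun z : 'rV[C]_n => - \sum_i z ord0 i * z ord0 i).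
  under eq_fun do rewrite -mulN1r.
  apply: cpolyM; first exact: cpoly_cst.
  by apply: cpoly_sum => i _; apply: cpolyM; exact: cpoly_coord.
have [D cD qD] := cpoly_has_partial cq j.
by exists D => //; exact: (has_partial_comp (@is_derive_cexp R) qD).
Qed.

(** Products of a polynomial and the Gaussian are closed under partial derivatives; hence the
    induction on d with p general. *)
Lemma nice_poly_gauss d p : cpoly p -> nice d (fun z => p z * gauss z).
Proof.
elim: d => [|d IH] in p *; move=> cp; split=> //; try exact: decays_poly_gauss.
move=> j; have [D cD gD] := has_partial_gauss j; have [E cE pE] := cpoly_has_partial cp j.
exists (fun z => (p z * D z + E z) * gauss z); last first.
  by apply: IH; apply: cpolyD => //; exact: cpolyM.
apply: (eq_has_partial (has_partialM pE gD)) => // z.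
by rewrite mulrDl !mulrA (mulrC (gauss z)).
Qed.

Lemma re_vecZ (l : R) (z : 'rV[C]_n) : re_vec (l%:C *: z) = l *: re_vec z.
Proof. by apply/rowP => i; rewrite !mxE ReZ. Qed.

Lemma stripZ (l V : R) z : 0 <= l -> strip V z -> strip (l * V) (l%:C *: z).
Proof. by move=> l0 zV i; rewrite mxE ImZ normrM ger0_norm// ler_wpM2l. Qed.

Lemma crho_scale (l : R) (z : 'rV[C]_n) N : 0 < l ->
  crho z ^+ N <= (1 + l ^- 2) ^+ (n * N) * crho (l%:C *: z) ^+ N.
Proof.
move=> l0; have l1 : 0 <= 1 + l ^- 2 by rewrite addr_ge0// invr_ge0 sqr_ge0.
rewrite exprM -exprMn lerXn2r ?nnegrE ?rho_ge0//.
  by rewrite mulr_ge0 ?rho_ge0 ?exprn_ge0.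
by rewrite /crho re_vecZ rho_scale// gt_eqF.
Qed.

Lemma nice_scale d A (c : C) (l : R) : 0 < l -> nice d A ->
  nice d (fun z => c * A (l%:C *: z)).
Proof.
move=> l0; have dS B (b : C) : decays B -> decays (fun z => b * B (l%:C *: z)).
  move=> dB N V; have [D D0 H] := dB N (l * V).
  have E0 : 0 <= (1 + l ^- 2) ^+ (n * N) by rewrite exprn_ge0// addr_ge0// invr_ge0 sqr_ge0.
  exists (normc b * ((1 + l ^- 2) ^+ (n * N) * D)).
    by rewrite mulr_ge0 ?normc_ge0// mulr_ge0.
  move=> z zV; rewrite normcM -mulrA ler_wpM2l ?normc_ge0//.
  apply: (@le_trans _ _ (normc (B (l%:C *: z)) *
      ((1 + l ^- 2) ^+ (n * N) * crho (l%:C *: z) ^+ N))).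
    by rewrite ler_wpM2l ?normc_ge0// crho_scale.
  by rewrite mulrCA ler_wpM2l// H//; apply: stripZ => //; exact: ltW.
elim: d => [|d IH] in A c *; move=> nA; (split; first exact/dS/nice_decays/nA) => // j.
have [D AD nD] := nA.2 j.
exists (fun z => (c * l%:C) * D (l%:C *: z)); last exact: IH.
apply: (eq_has_partial (has_partialZ c (has_partial_affine 0 l%:C AD))) => z;
  by rewrite add0r// mulrA.
Qed.

Lemma nice_le d e A : (d <= e)%N -> nice e A -> nice d A.
Proof.
elim: e => [|e IH] in d A *; first by rewrite leqn0 => /eqP ->.
case: d => [_ /nice_decays //|d de [dA nA]]; split => // j.
by have [D AD nD] := nA j; exists D => //; exact: IH.
Qed.

(** Differentiability at z concerns a polydisc about z, whereas decay is uniform on strips: this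
    places the polydisc in a strip. *)
Lemma strip_shift z : exists2 V : R, 0 <= V &
  forall h : 'rV[C]_n, (forall i, normc (h ord0 i) <= 1) -> strip V (z + h).
Proof.
exists (1 + \sum_i `|complex.Im (z ord0 i)|); first by rewrite addr_ge0// sumr_ge0.
move=> h h1 i; rewrite mxE ImD (le_trans (ler_normD _ _))// addrC lerD//.
  by rewrite (le_trans (Im_le_normc _)).
by rewrite (bigD1 i)//= lerDl sumr_ge0.
Qed.

(** Order 2 is what the quadratic remainder asks for: second derivatives that are bounded on a
    polydisc about z. *)
Lemma nice_differentiable A : nice 2 A -> forall z, differentiable A z.
Proof.
move=> nA z; have [V V0 Vh] := strip_shift z.
pose D1 j := sval (cid2 (nA.2 j)).
have AD1 j : has_partial j A (D1 j) by have [] := svalP (cid2 (nA.2 j)).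
have nD1 j : nice 1 (D1 j) by rewrite /D1; case: cid2.
pose D2 j i := sval (cid2 ((nD1 j).2 i)).
have AD2 j i : has_partial i (D1 j) (D2 j i) by rewrite /D2; case: cid2.
have dD2 j i : decays (D2 j i) by rewrite /D2; case: cid2 => ? ? nD; exact: (@nice_decays 0 _ nD).
(* A sum over all pairs serves as one bound for all second derivatives. *)
pose B := \sum_i \sum_j sval (cid2 (dD2 j i 0 V)).
have B0 i j : 0 <= sval (cid2 (dD2 j i 0 V)) by case: cid2.
suff /differentiable_dot_form[] : forall (h : 'rV[C]_n) (e : R), e <= 1 ->
    (forall i, normc (h ord0 i) <= e) ->
    normc (A (z + h) - A z - dot_form (fun j => partial j A z) h) <=
      (2 * n%:R) ^+ 2 * B * e ^+ 2 by [].
move=> h e e1 he; apply: partial_quadratic_bound.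
- by move=> j w; exact: has_partial_derivable (AD1 j).
- by move=> i j w; rewrite (partialE (AD1 i)); exact: has_partial_derivable (AD2 i j).
- exact: he.
- move=> i j h' h'e; rewrite (partialE (AD1 j)) (partialE (AD2 j i)).
  have := svalP (cid2 (dD2 j i 0 V)) => -[_ /(_ (z + h'))].
  rewrite expr0 mulr1 => /(_ (Vh h' _)) /le_trans; apply.
    by move=> k; rewrite (le_trans (h'e k)).
  rewrite /B (bigD1 i)//= (bigD1 j)//= -addrA lerDl addr_ge0 ?sumr_ge0// => k _.
    exact: B0.
  by apply: sumr_ge0 => l _; exact: B0.
Qed.

Lemma continuous_sub_toC (F : 'rV[C]_n -> C) (x : 'rV[C]_n) :
  (forall z, differentiable F z) ->
  continuous (fun y : 'rV[R]_n => complex.Re (F (x - toC y))) /\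
  continuous (fun y : 'rV[R]_n => complex.Im (F (x - toC y))).
Proof.
move=> dF.
have H (y : 'rV[R]_n) (e : R) : 0 < e ->
    \forall y' \near y, normc (F (x - toC y) - F (x - toC y')) < e.
  move=> e0; have eC0 : 0 < e%:C by rewrite ltcR.
  have cF : {for x - toC y, continuous F} by exact/differentiable_continuous.
  have /cvgrPdist_lt /(_ _ eC0) /nbhs_ballP[d /= d0 dP] := cF.
  have dr0 : 0 < complex.Re d by move: d0; rewrite /= ltcE => /andP[].
  have dE : d = (complex.Re d)%:C by rewrite RRe_real// gtr0_real.
  apply/nbhs_ballP; exists (complex.Re d) => // y' [_ yy'].
  rewrite -ltcR -normrcE; apply: dP; split => // i j; rewrite ord1 -ball_normE/=.
  rewrite !mxE normrcE dE ltcR opprD addrACA subrr add0r opprK.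
  rewrite -normcN opprD opprK -rmorphB normc_real.
  by have := yy' ord0 j; rewrite -ball_normE.
split=> y; apply/(@cvgrPdist_lt R R _ (nbhs y)) => e e0; near=> y'.
- rewrite -ReB (le_lt_trans (Re_le_normc _))//; near: y'; exact: H.
- rewrite -ImB (le_lt_trans (Im_le_normc _))//; near: y'; exact: H.
Unshelve. all: by end_near. Qed.

Lemma cmeasurable_sub_toC (F : 'rV[C]_n -> C) (x : 'rV[C]_n) :
  (forall z, differentiable F z) ->
  cmeasurable (fun t : n.-tuple (measurableTypeR R) => F (x - toC (row_of_tuple t))).
Proof.
move=> dF; have [c1 c2] := continuous_sub_toC x dF.
by split; [exact: (measurable_continuous_rV c1)|exact: (measurable_continuous_rV c2)].
Qed.

End weights.

(** * Convolutions *)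

Section convolution_theory.
Variables (R : realType) (n : nat).
Local Notation C := R[i].
Local Notation mR := (measurableTypeR R).
Local Notation mu := (lebesgue_tuple R n).
Local Notation row := (@row_of_tuple R n).

Lemma integral_oneDsqrV :
  (\int[@lebesgue_measure R]_x ((1 + x ^+ 2)^-1)%:E)%E = (pi : R)%:E.
Proof.
rewrite (_ : (fun x : R => _) = (fun x : R => (oneDsqr x)^-1%:E)); last by apply/funext => x.
rewrite (@ge0_symfun_integralT R (fun x => (oneDsqr x)^-1)).
- rewrite (_ : [set x | _] = `[0, +oo[%classic); last first.
    by apply/seteqP; split => x/=; rewrite in_itv/= andbT.
  by rewrite integral0y_oneDsqr -EFinM mulrCA divff// mulr1.
- by move=> x; rewrite invr_ge0 (le_trans ler01)// oneDsqr_ge1.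
- exact: continuous_oneDsqrV.
- by move=> x /=; rewrite /oneDsqr sqrrN.
Qed.

Lemma continuous_oneDsqr_inv : continuous (fun x : R => (1 + x ^+ 2)^-1).
Proof. exact: continuous_oneDsqrV. Qed.

Lemma rhoV_row (t : n.-tuple mR) : (rho (row t))^-1 = \prod_i (1 + tnth t i ^+ 2)^-1.
Proof. by rewrite /rho prodfV; congr _^-1; apply: eq_bigr => i _; rewrite mxE. Qed.

Lemma integral_rhoV : (\int[mu]_t ((rho (row t))^-1)%:E)%E = ((pi : R) ^+ n)%:E.
Proof.
under eq_integral do rewrite rhoV_row.
apply: (@integral_lebesgue_tuple_prod R n (fun x => (1 + x ^+ 2)^-1)).
- exact: continuous_measurable_fun continuous_oneDsqr_inv.
- by move=> x; rewrite invr_ge0 addr_ge0// sqr_ge0.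
- exact: integral_oneDsqrV.
Qed.

Lemma measurable_rhoV : measurable_fun [set: n.-tuple mR] (fun t => (rho (row t))^-1).
Proof.
under eq_fun do rewrite rhoV_row.
apply: measurable_prod => i _.
apply: (measurableT_comp (continuous_measurable_fun continuous_oneDsqr_inv)).
exact: measurable_tnth.
Qed.

Lemma integrable_rhoV (D : R) :
  mu.-integrable setT (EFin \o (fun t => D * (rho (row t))^-1)).
Proof.
rewrite (_ : _ \o _ = (fun t => D%:E * ((rho (row t))^-1)%:E)%E)//.
apply: integrableZl => //; apply/integrableP; split.
  by apply/measurable_EFinP; exact: measurable_rhoV.
under eq_integral do rewrite gee0_abs ?lee_fin ?invr_ge0 ?rho_ge0//.
by rewrite integral_rhoV ltry.
Qed.

Lemma Rintegral_rhoV (D : R) :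
  \int[mu]_(t in setT) (D * (rho (row t))^-1) = D * pi ^+ n.
Proof.
rewrite RintegralZl//; first by rewrite /Rintegral integral_rhoV.
have := integrable_rhoV 1; congr (_.-integrable _ _).
by apply/funext => t /=; rewrite mul1r.
Qed.

Section affine_change.
Variables (a : 'I_n -> R) (l : R).
Hypothesis l0 : 0 < l.

Lemma row_affine t : row (affine_tuple a l t) = \row_i a i + l *: row t.
Proof. by apply/rowP => i; rewrite !mxE tnth_mktuple. Qed.

Let ln0 : (0 <= (l ^- n)%:E)%E.
Proof. by rewrite lee_fin invr_ge0 exprn_ge0// ltW. Qed.

(** The substitution rule for nonnegative functions is applied to the positive and the negative
    part, whose integrals are finite. *)
Lemma integral_affine_tuple (h : n.-tuple mR -> R) :
  mu.-integrable setT (EFin \o h) ->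
  mu.-integrable setT (EFin \o h \o affine_tuple a l) /\
  \int[mu]_(t in setT) h (affine_tuple a l t) = l ^- n * \int[mu]_(t in setT) h t.
Proof.
move=> ih; have /integrableP[mh hoo] := ih.
have mf := measurable_affine_tuple a l.
have ih' : mu.-integrable setT (EFin \o h \o affine_tuple a l).
  apply/integrableP; split; first exact: measurableT_comp mh mf.
  rewrite (ge0_integral_affine_tuple a l0 (f := fun t => `|(h t)%:E|%E))//; last first.
    exact: measurableT_comp mh.
  by rewrite lte_mul_pinfty.
split => //.
have P := ge0_integral_affine_tuple a l0 (measurable_funepos mh).
have N := ge0_integral_affine_tuple a l0 (measurable_funeneg mh).
have {}P := P (funepos_ge0 _); have {}N := N (funeneg_ge0 _).
have fp := integrable_pos_fin_num measurableT ih.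
have fn := integrable_neg_fin_num measurableT ih.
transitivity (fine (\int[mu]_t ((EFin \o h)^\+)%E (affine_tuple a l t) -
                    \int[mu]_t ((EFin \o h)^\-)%E (affine_tuple a l t))%E).
  rewrite /Rintegral integralE; congr (fine (_ - _)%E);
    by apply: eq_integral => t _; rewrite ?funeposE ?funenegE.
rewrite P N /Rintegral [in RHS]integralE -muleBr//.
  by rewrite fineM// fin_numB fp fn.
by rewrite fin_num_adde_defr// fin_numN.
Qed.

Lemma cint_affine_tuple (g : n.-tuple mR -> C) : cintegrable mu g ->
  cintegrable mu (fun t => g (affine_tuple a l t)) /\
  cint mu (fun t => g (affine_tuple a l t)) = (l ^- n)%:C * cint mu g.
Proof.
move=> [gR gI].
have [iR eR] := @integral_affine_tuple (fun t => complex.Re (g t)) gR.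
have [iI eI] := @integral_affine_tuple (fun t => complex.Im (g t)) gI.
split; first by split.
by apply: complex_eqP; rewrite ?ReZ ?ImZ.
Qed.

End affine_change.

Definition cconv (A : 'rV[C]_n -> C) (f : n.-tuple mR -> C) (x : 'rV[C]_n) : C :=
  cint mu (fun t => A (x - toC (row t)) * f t).

(** Covers both kinds of data that are convolved with the kernel: bounded functions and
    polynomials. *)
Definition poly_bounded (f : n.-tuple mR -> C) :=
  exists D M, 0 <= D /\ forall t, normc (f t) <= D * rho (row t) ^+ M.

Lemma re_vec_sub_toC (x : 'rV[C]_n) u : re_vec (x - toC u) = re_vec x - u.
Proof. by apply/rowP => i; rewrite !mxE ReB. Qed.

Lemma strip_sub_toC V (x : 'rV[C]_n) u : strip V x -> strip V (x - toC u).
Proof. by move=> xV i; rewrite !mxE ImB subr0. Qed.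

(** Peetre's inequality moves M + 1 powers of the weight from the integration point t to x - t,
    where A decays. M of them pay for the growth of f, and the last one leaves the integrable 1 /
    rho. *)
Lemma conv_bound (A : 'rV[C]_n -> C) f M (V B D E : R) : 0 <= B -> 0 <= E ->
  (forall z, strip V z -> normc (A z) * crho z ^+ M.+1 <= D) ->
  (forall t, normc (f t) <= E * rho (row t) ^+ M) ->
  forall x, strip V x -> crho x <= B ->
    forall t, normc (A (x - toC (row t)) * f t) <=
      ((2 ^+ n * B) ^+ M.+1 * D * E) * (rho (row t))^-1.
Proof.
move=> B0 E0 AD fE x xV xB t; rewrite normcM ler_pdivlMr ?rho_gt0//.
have H : rho (row t) <= 2 ^+ n * B * crho (x - toC (row t)).
  rewrite -rhoN (_ : - row t = (re_vec x - row t) + (- re_vec x)); last first.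
    by rewrite addrAC subrr add0r.
  rewrite (le_trans (rho_peetre _ _))// rhoN /crho re_vec_sub_toC mulrAC.
  by rewrite ler_wpM2r ?rho_ge0// ler_wpM2l// exprn_ge0.
apply: (@le_trans _ _ (normc (A (x - toC (row t))) * rho (row t) ^+ M.+1 * E)).
  rewrite exprSr mulrA [leRHS]mulrAC ler_wpM2r ?rho_ge0//.
  by rewrite -mulrA ler_wpM2l ?normc_ge0// mulrC.
rewrite ler_wpM2r//.
apply: (@le_trans _ _ (normc (A (x - toC (row t))) *
    ((2 ^+ n * B) ^+ M.+1 * crho (x - toC (row t)) ^+ M.+1))).
  rewrite ler_wpM2l ?normc_ge0// -exprMn lerXn2r ?nnegrE ?rho_ge0//.
  by rewrite !mulr_ge0 ?rho_ge0// exprn_ge0.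
rewrite mulrCA ler_wpM2l ?exprn_ge0 ?mulr_ge0 ?exprn_ge0//.
by apply: AD; exact: strip_sub_toC.
Qed.

Lemma decays_conv_bound A f : decays A -> poly_bounded f -> forall V B : R, 0 <= B ->
  exists2 D, 0 <= D & forall x, strip V x -> crho x <= B ->
    forall t, normc (A (x - toC (row t)) * f t) <= D * (rho (row t))^-1.
Proof.
move=> dA [E [M [E0 fE]]] V B B0; have [D D0 AD] := dA M.+1 V.
exists ((2 ^+ n * B) ^+ M.+1 * D * E); last exact: conv_bound.
by rewrite !mulr_ge0 ?exprn_ge0 ?mulr_ge0// exprn_ge0.
Qed.

Lemma conv_integrable A f : nice 2 A -> cmeasurable f -> poly_bounded f ->
  forall x, cintegrable mu (fun t => A (x - toC (row t)) * f t).
Proof.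
move=> nA mf pf x.
have [D D0 H] := decays_conv_bound (nice_decays nA) pf (\sum_i `|complex.Im (x ord0 i)|)
  (rho_ge0 (re_vec x)).
apply: (@cintegrable_le _ _ _ mu _ (fun t => D * (rho (row t))^-1)).
- by apply: cmeasurableM => //; exact/cmeasurable_sub_toC/nice_differentiable.
- by move=> t; apply: H => // i; rewrite (bigD1 i)//= lerDl sumr_ge0.
- exact: integrable_rhoV.
Qed.

Lemma has_partial_shift (F D : 'rV[C]_n -> C) j w : has_partial j F D ->
  has_partial j (fun z => F (z - w)) (fun z => D (z - w)).
Proof.
move=> FD; apply: (eq_has_partial (has_partial_affine (- w) 1 FD)) => z;
  by rewrite scale1r ?mul1r addrC.
Qed.

(** The decay of the second derivatives of A dominates the remainder under the integral, while the
    first derivatives must still be nice of order 2 for their convolutions to be integrable. *)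
Lemma conv_differentiable A f : nice 4 A -> cmeasurable f -> poly_bounded f ->
  (forall x, differentiable (cconv A f) x) /\
  forall j D, has_partial j A D -> has_partial j (cconv A f) (cconv D f).
Proof.
move=> nA mf pf.
pose D1 j := sval (cid2 (nA.2 j)).
have AD1 j : has_partial j A (D1 j) by rewrite /D1; case: cid2.
have nD1 j : nice 3 (D1 j) by rewrite /D1; case: cid2.
pose D2 j i := sval (cid2 ((nD1 j).2 i)).
have AD2 j i : has_partial i (D1 j) (D2 j i) by rewrite /D2; case: cid2.
have dD2 j i : decays (D2 j i).
  by rewrite /D2; case: cid2 => ? ? nD; exact: (@nice_decays _ _ 2 _ nD).
have P1 j t : has_partial j (fun z => A (z - toC (row t)) * f t)
    (fun z => D1 j (z - toC (row t)) * f t).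
  apply: (eq_has_partial (has_partialZ (f t) (has_partial_shift (toC (row t)) (AD1 j)))) => z;
    by rewrite mulrC.
have P2 j i t : has_partial i (fun z => D1 j (z - toC (row t)) * f t)
    (fun z => D2 j i (z - toC (row t)) * f t).
  apply: (eq_has_partial (has_partialZ (f t) (has_partial_shift (toC (row t)) (AD2 j i)))) => z;
    by rewrite mulrC.
have H x : differentiable (cconv A f) x /\
    forall j, is_derive x (delta_mx ord0 j) (cconv A f) (cconv (D1 j) f x).
  have [V V0 Vh] := strip_shift x.
  (* Peetre's inequality, with the weight of an increment from the unit polydisc at most 2^n, bounds
     the weight at every x + h. *)
  pose B := 2 ^+ n * crho x * (1 + 1 ^+ 2) ^+ n.
  have B0 : 0 <= B by rewrite !mulr_ge0 ?rho_ge0 ?exprn_ge0.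
  have Bh (h : 'rV[C]_n) : (forall i, normc (h ord0 i) <= 1) -> crho (x + h) <= B.
    move=> h1; rewrite /crho (_ : re_vec (x + h) = re_vec x + re_vec h); last first.
      by apply/rowP => i; rewrite !mxE ReD.
    rewrite (le_trans (rho_peetre _ _))// ler_wpM2l ?mulr_ge0 ?rho_ge0 ?exprn_ge0//.
    by apply: rho_unit => i; rewrite mxE (le_trans (Re_le_normc _)).
  pose E j i := sval (cid2 (decays_conv_bound (dD2 j i) pf V B0)).
  have E0 j i : 0 <= E j i by rewrite /E; case: cid2.
  have EP j i := (svalP (cid2 (decays_conv_bound (dD2 j i) pf V B0))).2.
  pose S := \sum_j \sum_i E j i.
  have [] := @differentiable_cint R _ _ mu n (fun z t => A (z - toC (row t)) * f t) x
    (fun t => S * (rho (row t))^-1).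
  - by move=> t j w; exact: has_partial_derivable (P1 j t).
  - by move=> t i j w; rewrite (partialE (P1 i t)); exact: has_partial_derivable (P2 i j t).
  - move=> i j h t h1; rewrite (partialE (P1 j t)) (partialE (P2 j i t)).
    apply: (le_trans (EP j i _ (Vh h h1) (Bh h h1) t)).
    rewrite ler_wpM2r ?invr_ge0 ?rho_ge0// /S (bigD1 j)//= (bigD1 i)//= -addrA lerDl.
    by rewrite addr_ge0// ?sumr_ge0// => k _; rewrite sumr_ge0.
  - exact: integrable_rhoV.
  - by move=> w; exact: (conv_integrable (@nice_le _ _ 2 4 _ isT nA) mf pf).
  - move=> j; rewrite (_ : (fun t => _) = (fun t => D1 j (x - toC (row t)) * f t)).
      exact: (conv_integrable (@nice_le _ _ 2 3 _ isT (nD1 j)) mf pf).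
    by apply/funext => t; rewrite (partialE (P1 j t)).
  move=> dF dF'; split=> // j; have := dF' j.
  rewrite (_ : (fun t => partial _ _ _) = (fun t => D1 j (x - toC (row t)) * f t))//.
  by apply/funext => t; rewrite (partialE (P1 j t)).
split=> [x|j D AD]; first exact: (H x).1.
(* Partial derivatives are unique, so the chosen [D1] may replace an arbitrary [D]. *)
have -> : D = D1 j by rewrite -(partialE AD) (partialE (AD1 j)).
by move=> x; exact: (H x).2.
Qed.

End convolution_theory.

(** * Convolution of polynomials with dilated Gaussians *)

Section polynomial_reproduction.
Variables (R : realType) (n : nat).
Local Notation C := R[i].
Local Notation mR := (measurableTypeR R).
Local Notation mu := (lebesgue_tuple R n).
Local Notation row := (@row_of_tuple R n).

Lemma cmeasurable_cpoly (P : 'rV[C]_n -> C) : cpoly P ->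
  cmeasurable (fun t : n.-tuple mR => P (toC (row t))).
Proof.
elim=> {P} [c|i|F G _ IF _ IG|F G _ IF _ IG].
- exact: cmeasurable_cst.
- under eq_fun do rewrite !mxE.
  by split; [exact: measurable_tnth|exact: measurable_cst].
- exact: cmeasurableD.
- exact: cmeasurableM.
Qed.

Lemma re_vec_toC (u : 'rV[R]_n) : re_vec (toC u) = u.
Proof. by apply/rowP => i; rewrite !mxE. Qed.

Lemma strip_toC (V : R) (u : 'rV[R]_n) : 0 <= V -> strip V (toC u).
Proof. by move=> V0 i; rewrite mxE normr0. Qed.

Lemma poly_bounded_cpoly (P : 'rV[C]_n -> C) : cpoly P ->
  poly_bounded (fun t => P (toC (row t))).
Proof.
move=> /cpoly_growth /(_ 0) [D [N [D0 PD]]]; exists D, N; split => // t.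
by have := PD _ (strip_toC (row t) (lexx 0)); rewrite /crho re_vec_toC.
Qed.

Lemma poly_bounded1 : poly_bounded (fun _ : n.-tuple mR => 1 : C).
Proof.
exists 1, 0%N; split => // t.
by rewrite expr0 mulr1 ComplexField.Normc.normc1.
Qed.

(** A complex derivative is already determined by real increments: with error tolerance |D| / 2,
    constancy along one small real step contradicts D != 0. *)
Lemma is_derive_real_cst (F : 'rV[C]_n -> C) x v (D : C) :
  is_derive x v F D -> (forall s : R, F (x + s%:C *: v) = F x) -> D = 0.
Proof.
move=> FD Fc; apply/eqP; apply: contraT => D0.
have nD0 : 0 < normc D.
  by rewrite lt0r normc_ge0 andbT; apply: contra_neq D0 => /ComplexField.Normc.eq0_normc.
have D20 : 0 < (normc D / 2)%:C by rewrite ltcR divr_gt0.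
have /nbhs_ballP[d /= d0 dP] := is_derive_near FD D20.
have dr0 : 0 < complex.Re d by move: d0; rewrite ltcE => /andP[].
have dE : d = (complex.Re d)%:C by rewrite RRe_real// gtr0_real.
pose s := complex.Re d / 2.
have s0 : 0 < s by rewrite divr_gt0.
have bs : ball (0 : C) d s%:C.
  rewrite -ball_normE/= sub0r normrN normrcE normc_real dE ltcR gtr0_norm//.
  by rewrite ltr_pdivrMr// mulr_natr mulr2n ltrDl.
have := dP s%:C bs; rewrite Fc subrr sub0r normrN.
rewrite [X in X <= _](normrcE (s%:C * D)) [X in _ <= _ * X](normrcE s%:C).
rewrite -rmorphM lecR normcM normc_real gtr0_norm// [leRHS]mulrC ler_pM2l//.
by rewrite ler_pdivlMr// mulr_natr mulr2n gerDl leNgt nD0.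
Qed.

(** The integration variable absorbs a real shift: replacing t by t - s e_j leaves the integral of
    A(x - t) unchanged. *)
Lemma conv1_translation (A : 'rV[C]_n -> C) x j (s : R) : nice 4 A ->
  cconv A (fun=> 1) (x + s%:C *: delta_mx ord0 j) = cconv A (fun=> 1) x.
Proof.
move=> nA.
have iA := conv_integrable (@nice_le _ _ 2 4 _ isT nA) (cmeasurable_cst _ 1) poly_bounded1.
pose a i : R := if i == j then - s else 0.
have [_] := cint_affine_tuple a ltr01 (iA x).
rewrite expr1n invr1 mul1r -[RHS]/(cconv A (fun=> 1) x) => <-.
apply: eq_cint => t; congr (A _ * _); rewrite row_affine scale1r.
apply/rowP => i; rewrite !mxE eqxx/= /a.
case: eqVneq => [->|ij]; rewrite ?mulr1 ?mulr0 ?addr0 ?add0r//.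
by rewrite rmorphD/= rmorphN/= opprD opprK addrA.
Qed.

(* The convolution is invariant under real translations, hence its complex
   derivatives, which can be computed along real directions, vanish. *)
Lemma conv1_cst (A : 'rV[C]_n -> C) : nice 4 A ->
  forall x, cconv A (fun=> 1) x = cconv A (fun=> 1) 0.
Proof.
move=> nA x; pose F := cconv A (fun=> 1).
have [_ dF] := conv_differentiable nA (cmeasurable_cst _ 1) poly_bounded1.
have F0 j : has_partial j F (fun=> 0).
  have [D AD _] := nA.2 j; have FD := dF j D AD.
  apply: (eq_has_partial FD) => // z.
  by apply: (is_derive_real_cst (FD z)) => s; exact: conv1_translation.
have xe i : normc (x ord0 i) <= \sum_i normc (x ord0 i).
  by rewrite (bigD1 i)//= lerDl sumr_ge0// => j _; exact: normc_ge0.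
suff : normc (F (0 + x) - F 0) <= n%:R * (2 * (\sum_i normc (x ord0 i)) * 0).
  rewrite !mulr0 add0r => H; apply/eqP; rewrite -subr_eq0; apply/eqP.
  by apply: ComplexField.Normc.eq0_normc; apply/eqP; rewrite eq_le H normc_ge0.
apply: partial_bound.
- by move=> j w; exact: has_partial_derivable (F0 j).
- exact: xe.
- by move=> j h' _; rewrite (partialE (F0 j)) normc0.
Qed.

(* The substitution is a translation by a complex vector followed by a dilation;
   the translation is justified by [conv1_cst]. *)
Lemma conv_gauss_cpoly (P : 'rV[C]_n -> C) (c : C) (l : R) x : cpoly P -> 0 < l ->
  cconv (fun z => c * gauss ((l^-1)%:C *: z)) (fun t => P (toC (row t))) x =
  c * (l ^+ n)%:C * cint mu (fun t => gauss (- toC (row t)) * P (x + l%:C *: toC (row t))).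
Proof.
move=> cP l0; have lC : l%:C * (l^-1)%:C = 1 by rewrite -rmorphM/= divff ?gt_eqF.
have li0 : 0 < l^-1 by rewrite invr_gt0.
(* [A z] below equals gauss(z / l) P(x - z). Its convolution with 1 is, at the point x, the one
   sought up to the factor c, and at 0 the integral of gauss(- t / l) P(x + t). *)
pose Q (w : 'rV[C]_n) := P (x + (- l%:C) *: w) * gauss w.
pose A (z : 'rV[C]_n) := 1 * Q ((l^-1)%:C *: z).
have nA : nice 4 A.
  apply: (@nice_scale R n 4 Q 1 _ li0).
  exact: (@nice_poly_gauss R n 4 (fun w => P (x + (- l%:C) *: w)) (cpoly_affine x _ cP)).
have AE z : A z = gauss ((l^-1)%:C *: z) * P (x - z).
  by rewrite /A /Q mul1r mulrC scalerA mulNr lC scaleN1r.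
pose B (z : 'rV[C]_n) := gauss ((l^-1)%:C *: z).
have nB : nice 2 B.
  have := @nice_scale R n 2 _ 1 _ li0 (@nice_poly_gauss R n 2 _ (cpoly_cst n 1)).
  by congr (nice 2 _); apply/funext => z; rewrite !mul1r.
have iB := conv_integrable nB (cmeasurable_cpoly cP) (poly_bounded_cpoly cP) x.
rewrite /cconv.
under eq_cint do rewrite -mulrA.
rewrite cintZ// -mulrA; congr (c * _).
have -> : cint mu (fun t => B (x - toC (row t)) * P (toC (row t))) = cconv A (fun=> 1) x.
  by apply: eq_cint => t; rewrite mulr1 AE (addrC x) opprD opprK addrCA subrr addr0.
rewrite conv1_cst//.
have iA := conv_integrable (@nice_le _ _ 2 4 _ isT nA) (cmeasurable_cst _ 1) poly_bounded1 0.
have [_ eA] := cint_affine_tuple (fun=> 0) l0 iA.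
rewrite /cconv -[LHS]mul1r -[X in X * _](_ : (l ^+ n)%:C * (l ^- n)%:C = 1); last first.
  by rewrite -rmorphM/= divff// expf_neq0// gt_eqF.
rewrite -mulrA -eA; congr (_ * _); apply: eq_cint => t.
rewrite mulr1 AE row_affine.
have -> : (0 : 'rV[C]_n) - toC (\row_(i < n) 0 + l *: row t) = - (l%:C *: toC (row t)).
  by apply/rowP => i; rewrite !mxE !add0r rmorphM.
by rewrite opprK scalerN scalerA [(l^-1)%:C * _]mulrC lC scale1r.
Qed.

(** Exponents may repeat and the index type is arbitrary: sums of polynomials then correspond to
    disjoint unions of index types and products to cartesian products, without collecting terms. *)
Lemma cpoly_line_expansion (P : 'rV[C]_n -> C) x : cpoly P ->
  exists (I : finType) (e : I -> nat) (q : I -> 'rV[C]_n -> C),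
    (forall i, cpoly (q i)) /\ forall c v, P (x + c *: v) = \sum_i c ^+ e i * q i v.
Proof.
elim=> {P} [a|k|F G _ [I [e [q [cq Fq]]]] _ [J [e' [q' [cq' Gq]]]]
  |F G _ [I [e [q [cq Fq]]]] _ [J [e' [q' [cq' Gq]]]]].
- exists unit, (fun=> 0%N), (fun _ _ => a); split=> [_|c v]; first exact: cpoly_cst.
  by rewrite (big_pred1 tt) ?expr0 ?mul1r// => -[].
- exists bool, (fun b => if b then 1%N else 0%N),
    (fun b v => if b then v ord0 k else x ord0 k).
  split=> [[]|c v]; [exact: cpoly_coord|exact: cpoly_cst|].
  by rewrite big_bool/= !mxE expr1 expr0 mul1r addrC.
- exists (I + J)%type, (fun i => match i with inl i => e i | inr j => e' j end),
    (fun i => match i with inl i => q i | inr j => q' j end).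
  by split=> [[i|j]//|c v]; rewrite big_sumType Fq Gq.
- exists (I * J)%type, (fun p => (e p.1 + e' p.2)%N), (fun p v => q p.1 v * q' p.2 v).
  split=> [p|c v]; first exact: cpolyM.
  rewrite Fq Gq big_distrlr/= pair_big/=.
  by apply: eq_bigr => p _; rewrite exprD mulrACA.
Qed.

End polynomial_reproduction.

(** * The kernel *)

Section coefficients.
Variable R : realType.

(* The coefficients of the entire function [prod_(j > 0) (1 - x / 4^j)], which
   vanishes at [x = 4^l] for all [l > 0] but not at [x = 1]. *)
Fixpoint coef (m : nat) : R :=
  if m is m'.+1 then - coef m' / (4 ^+ m'.+1 - 1) else 1.

(** The partial sums, at x = 4^l, of the power series with coefficients [coef]. *)
Definition psum (l M : nat) : R := \sum_(m < M) coef m * 4 ^+ (m * l).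

Lemma coef_den_gt0 m : 0 < (4 ^+ m.+1 - 1 : R).
Proof. by rewrite subr_gt0 exprn_egt1// ltr1n. Qed.

Lemma coefS m : coef m.+1 = - coef m / (4 ^+ m.+1 - 1).
Proof. by []. Qed.

Lemma normr_coefS m : `|coef m.+1| = `|coef m| / (4 ^+ m.+1 - 1).
Proof. by rewrite coefS normrM normrN normfV (gtr0_norm (coef_den_gt0 m)). Qed.

Lemma exp4_ge1 m : 1 <= (4 : R) ^+ m.
Proof. by rewrite exprn_ege1// ler1n. Qed.

Lemma coef_le m : `|coef m| <= 3^-1 ^+ m.
Proof.
elim: m => [|m IH]; first by rewrite expr0 /= normr1.
rewrite normr_coefS [leRHS]exprSr.
have H : (4 ^+ m.+1 - 1)^-1 <= 3^-1 :> R.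
  rewrite lef_pV2 ?posrE ?coef_den_gt0//.
  by have := exp4_ge1 m; rewrite exprS; lra.
by rewrite ler_pM// invr_ge0 ltW// coef_den_gt0.
Qed.

(** The quotient of consecutive terms b(m + 1) / b(m) is 2 * 4^L / (4^(m + 1) - 1), which is at most
    1 for m > L. So b is bounded by its values up to index L + 1, hence by their sum. *)
Lemma coef_superdecay (L : nat) : exists2 D : R, 0 <= D &
  forall m, `|coef m| * 4 ^+ (m * L) <= D * 2^-1 ^+ m.
Proof.
pose b m := `|coef m| * 4 ^+ (m * L) * 2 ^+ m.
have b0 m : 0 <= b m by rewrite !mulr_ge0 ?exprn_ge0.
have bS m : (L < m)%N -> b m.+1 <= b m.
  move=> Lm; have -> : b m.+1 = b m * (4 ^+ L * 2 / (4 ^+ m.+1 - 1)).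
    rewrite /b normr_coefS mulSn exprD (exprS 2).
    by have := coef_den_gt0 m; rewrite lt0r => /andP[? _]; field.
  rewrite ler_piMr// ler_pdivrMr ?coef_den_gt0// mul1r.
  have : (4 : R) ^+ L <= 4 ^+ m by rewrite ler_eXn2l ?ltr1n// ltnW.
  by have := exp4_ge1 m; rewrite exprS; lra.
pose D := \sum_(m < L.+2) b m.
have D0 : 0 <= D by rewrite sumr_ge0.
have bD m : b m <= D.
  have small k : (k < L.+2)%N -> b k <= D.
    by move=> kL; rewrite /D (bigD1 (Ordinal kL))//= lerDl sumr_ge0.
  elim: m => [|m IH]; first exact: small.
  have [/small //|Lm] := ltnP m.+1 L.+2.
  by rewrite (le_trans (bS m _)).
exists D => // m; rewrite -[leLHS](mulfK (_ : 2 ^+ m != 0 :> R)) ?expf_neq0 ?pnatr_eq0//.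
by rewrite exprVn ler_pM2r ?bD// invr_gt0 exprn_gt0.
Qed.

(** Truncated form of the functional equation f(4 x) = (1 - x) f(x) of the product f(x) = prod_(j >
    0) (1 - x / 4^j), taken at x = 4^l. Multiplication by x shifts the index, hence M + 1 against
    M. *)
Lemma psumS l M : psum l.+1 M.+1 = psum l M.+1 - 4 ^+ l * psum l M.
Proof.
rewrite /psum !big_ord_recl !mul0n !expr0 -addrA; congr (_ + _).
rewrite mulr_sumr -sumrB; apply: eq_bigr => m _.
rewrite lift0.
have := coef_den_gt0 m; rewrite lt0r => /andP[d0 _].
have -> : coef m = - (coef m.+1 * (4 ^+ m.+1 - 1)) by rewrite coefS divfK// opprK.
rewrite mulnS exprD (_ : (m.+1 * l = l + m * l)%N)// exprD.
by move: (4 ^+ m.+1) (4 ^+ l) (4 ^+ (m * l)) => x y z; ring.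
Qed.

(** The term of index 0 is 1, and by [coef_le] the others sum to at most 1/3 + 1/9 + ... = 1/2, so
    the limit is at least 1/2. *)
Lemma cvg_psum : exists2 S : R, 0 < S & psum 0 M @[M --> \oo] --> S.
Proof.
have sE : psum 0 = series coef.
  apply/funext => M; rewrite /psum /series/= big_mkord.
  by apply: eq_bigr => m _; rewrite muln0 expr0 mulr1.
have gh : series (geometric 1 (3^-1 : R)) M @[M --> \oo] --> (1 / (1 - 3^-1) : R).
  by apply: cvg_geometric_series; rewrite ger0_norm ?invr_ge0// invf_lt1// ltr1n.
have cs : cvgn (series coef).
  apply: normed_cvg; apply: (@series_le_cvg _ _ (geometric 1 (3^-1 : R))) => [m|m|m|].
  - exact: normr_ge0.
  - by rewrite /geometric/= mul1r exprn_ge0// invr_ge0.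
  - by rewrite /geometric/= mul1r coef_le.
  - by apply/cvg_ex; exists (1 / (1 - 3^-1)).
have psum_ge M : 1/2 <= psum 0 M.+1.
  rewrite /psum big_ord_recl mul0n expr0 mulr1.
  have : `|\sum_(i < M) coef (lift ord0 i) * 4 ^+ (lift ord0 i * 0)| <= 1 / 2 :> R.
    rewrite (le_trans (ler_norm_sum _ _ _))//.
    apply: (@le_trans _ _ (\sum_(i < M) 3^-1 ^+ i.+1)).
      by apply: ler_sum => i _; rewrite muln0 expr0 mulr1 lift0 coef_le.
    have -> : \sum_(i < M) 3^-1 ^+ i.+1 = (1 - 3^-1 ^+ M) / 2 :> R.
      elim: M => [|M IH]; first by rewrite big_ord0 expr0 subrr mul0r.
      by rewrite big_ord_recr/= IH exprS; field.
    by rewrite ler_wpM2r ?invr_ge0// gerBl exprn_ge0// invr_ge0.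
  have -> : coef ord0 = 1 by [].
  by rewrite ler_norml => /andP[+ _]; lra.
exists (limn (psum 0)); last by rewrite sE.
apply: (@lt_le_trans _ _ (1/2)); first by rewrite divr_gt0.
apply: limr_ge; first by rewrite sE.
by exists 1%N => // -[|M] // _; exact: psum_ge.
Qed.

(** In the functional equation the factor 1 - 4^l vanishes for l = 0, which gives the zero at 4; it
    then propagates from 4^(l + 1) to 4^(l + 2). *)
Lemma cvg_psumS l : psum l.+1 M @[M --> \oo] --> 0.
Proof.
have shift u : u M.+1 @[M --> \oo] --> (0 : R) -> u M @[M --> \oo] --> (0 : R).
  by move=> h; rewrite -(cvg_shiftS u).
elim: l => [|l IH]; apply: shift.
  have [S _ cS] := cvg_psum.
  under eq_fun do rewrite psumS expr0 mul1r.
  by rewrite -(subrr S); apply: cvgB => //; rewrite (cvg_shiftS (psum 0)).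
have -> : (fun M => psum l.+2 M.+1) =
    (fun M => psum l.+1 M.+1 - 4 ^+ l.+1 * psum l.+1 M).
  by apply/funext => M; rewrite psumS.
have -> : 0 = 0 - 4 ^+ l.+1 * 0 :> R by rewrite mulr0 subr0.
apply: cvgB; first by rewrite (cvg_shiftS (psum l.+1)).
by apply: cvgM => //; exact: cvg_cst.
Qed.

End coefficients.

(** * Series of dilated functions as integrals against the counting measure *)

Section kernel_series.
Variables (R : realType) (n : nat).
Local Notation C := R[i].
Local Notation count := (@counting nat R).

Lemma integral_half_powers : (\int[count]_m ((2^-1 : R) ^+ m)%:E)%E = 2%:E.
Proof.
rewrite ge0_integral_count; last by move=> k; rewrite lee_fin exprn_ge0// invr_ge0.
apply/cvg_lim => //.
have := @cvg_geometric_eseries_half R 2 0; rewrite expr0 divr1.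
rewrite (_ : eseries _ = (fun M => \sum_(0 <= k < M) ((2^-1 : R) ^+ k)%:E)%E)//.
apply/funext => M; apply: eq_bigr => k _.
by rewrite addn1 expnS natrM natrX invfM mulrA divff// mul1r exprVn.
Qed.

Lemma integrable_half_powers (D : R) :
  count.-integrable setT (EFin \o (fun m => D * 2^-1 ^+ m)).
Proof.
rewrite (_ : _ \o _ = (fun m => D%:E * ((2^-1) ^+ m)%:E)%E)//.
apply: integrableZl => //; apply/integrableP; split => //.
under eq_integral do rewrite gee0_abs ?lee_fin ?exprn_ge0 ?invr_ge0//.
by rewrite integral_half_powers ltry.
Qed.

Lemma Rintegral_half_powers (D : R) :
  \int[count]_(m in setT) (D * 2^-1 ^+ m) = D * 2.
Proof.
rewrite RintegralZl//; first by rewrite /Rintegral integral_half_powers.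
have := integrable_half_powers 1; congr (_.-integrable _ _).
by apply/funext => m /=; rewrite mul1r.
Qed.

Lemma cmeasurable_nat (f : nat -> C) : cmeasurable f.
Proof. by split. Qed.

Lemma cintegrable_count (f : nat -> C) (D : R) :
  (forall m, normc (f m) <= D * 2^-1 ^+ m) -> cintegrable count f.
Proof.
move=> fD; apply: (cintegrable_le (cmeasurable_nat f) fD).
exact: integrable_half_powers.
Qed.

(** The 4 is the factor 2 of [normc_cint_le] times the sum 2 of the powers of 1/2. *)
Lemma normc_cint_count (f : nat -> C) (D : R) :
  (forall m, normc (f m) <= D * 2^-1 ^+ m) -> normc (cint count f) <= 4 * D.
Proof.
move=> fD; have := normc_cint_le (cintegrable_count fD) fD (integrable_half_powers D).
by rewrite Rintegral_half_powers; congr (_ <= _); ring.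
Qed.

Lemma Rintegral_count_pick (i : nat) (x : R) :
  count.-integrable setT (EFin \o (fun m => x * (m == i)%:R)) /\
  \int[count]_(m in setT) (x * (m == i)%:R) = x.
Proof.
have I1 : (\int[count]_m ((m == i)%:R : R)%:E)%E = 1%:E.
  have -> : (fun m => ((m == i)%:R : R)%:E) = (EFin \o \1_[set i]).
    apply/funext => m /=; rewrite indicE; congr ((_ : bool)%:R%:E)%E.
    by apply/eqP/idP => [->|/set_mem//]; rewrite inE.
  rewrite integral_indic// setIT -[LHS]/(@counting nat R [set i]).
  by rewrite /counting asboolT// fset_set1 finmap.cardfs1.
have ii : count.-integrable setT (EFin \o (fun m => (m == i)%:R : R)).
  apply/integrableP; split => //.
  under eq_integral do rewrite gee0_abs ?lee_fin//.
  by rewrite [X in (X < _)%E]I1 ltry.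
split; last by rewrite RintegralZl// /Rintegral I1 mulr1.
by rewrite (_ : _ \o _ = (fun m => x%:E * ((m == i)%:R)%:E)%E)//; exact: integrableZl.
Qed.

Lemma cint_count_finite (f : nat -> C) M :
  cint count (fun m => if (m < M)%N then f m else 0) = \sum_(m < M) f m.
Proof.
have P i : cintegrable count (fun m => f i * ((m == i)%:R)%:C) /\
    cint count (fun m => f i * ((m == i)%:R)%:C) = f i.
  have [iR eR] := Rintegral_count_pick i (complex.Re (f i)).
  have [iI eI] := Rintegral_count_pick i (complex.Im (f i)).
  have EZ m : f i * ((m == i)%:R)%:C =
      (complex.Re (f i) * (m == i)%:R) +i* (complex.Im (f i) * (m == i)%:R).
    by apply: complex_eqP; rewrite ?ReMc ?ImMc/= !mulr0 ?subr0 ?add0r.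
  split; first by split; under eq_fun do rewrite EZ.
  rewrite (eq_cint _ EZ) /cint/= eR eI.
  exact: complex_eqP.
have [_] := @cintegrable_sum _ _ _ count _ (index_enum 'I_M) xpredT
  (fun (i : 'I_M) m => f i * ((m == i)%:R)%:C) (fun i _ => (P i).1).
under [X in _ = X]eq_bigr do rewrite (P _).2.
move=> <-; apply: eq_cint => m; case: ifPn => mM.
  rewrite (bigD1 (Ordinal mM))//= eqxx mulr1 big1 ?addr0// => i im.
  rewrite (_ : (m == i) = false) ?mulr0//.
  by apply: contraNF im => /eqP mi; apply/eqP/val_inj.
rewrite big1// => i _; rewrite (_ : (m == i) = false) ?mulr0//.
by apply: contraNF mM => /eqP ->.
Qed.

(** The powers 4^(m L) make up for the loss of weight under the dilation by 4^-m, and 2^-m leaves a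
    summable series. *)
Definition superdecay (a : nat -> R) := forall L : nat,
  exists2 D : R, 0 <= D & forall m, `|a m| * 4 ^+ (m * L) <= D * 2^-1 ^+ m.

Definition ksum (a : nat -> R) (B : 'rV[C]_n -> C) (z : 'rV[C]_n) : C :=
  cint count (fun m => (a m)%:C * B (((4 : R) ^- m)%:C *: z)).

Let l_gt0 m : 0 < (4 : R) ^- m. Proof. by rewrite invr_gt0 exprn_gt0. Qed.
Let l_le1 m : (4 : R) ^- m <= 1.
Proof. by rewrite invf_le1 ?exprn_gt0// exp4_ge1. Qed.

Lemma strip_l V (z : 'rV[C]_n) m : strip V z -> strip V (((4 : R) ^- m)%:C *: z).
Proof.
move=> zV i; rewrite mxE ImZ normrM gtr0_norm//.
by rewrite (le_trans _ (zV i))// ler_piMl.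
Qed.

(** Dilation by 4^-m keeps the strip but shrinks real parts. Recovering the weight at z costs (1 +
    16^m)^(n N), at most 2^(n N) 4^(2 m n N), whence the exponent required of the coefficients. *)
Lemma ksum_term_bound (a : nat -> R) (B : 'rV[C]_n -> C) (N : nat) (V E D : R) :
  0 <= E -> (forall z, strip V z -> normc (B z) * crho z ^+ N <= E) ->
  (forall m, `|a m| * 4 ^+ (m * (2 * (n * N))) <= D * 2^-1 ^+ m) ->
  forall z m, strip V z ->
    normc ((a m)%:C * B (((4 : R) ^- m)%:C *: z)) * crho z ^+ N <=
    (2 ^+ (n * N) * E * D) * 2^-1 ^+ m.
Proof.
move=> E0 BE aD z m zV; rewrite normcM normc_real.
have H := crho_scale z N (l_gt0 m).
set w := _ *: z in H *.
have Bw := BE _ (strip_l m zV : strip V w).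
have H2 : (1 + (4 ^- m) ^- 2) ^+ (n * N) <= 2 ^+ (n * N) * 4 ^+ (m * (2 * (n * N))) :> R.
  have -> : ((4 : R) ^- m) ^- 2 = 4 ^+ (m * 2) by rewrite -exprVn invrK exprM.
  have -> : (4 : R) ^+ (m * (2 * (n * N))) = (4 ^+ (m * 2)) ^+ (n * N).
    by rewrite -exprM mulnA.
  rewrite -exprMn.
  rewrite lerXn2r ?nnegrE ?addr_ge0 ?mulr_ge0 ?exprn_ge0//.
  by have := exp4_ge1 R (m * 2); lra.
apply: (@le_trans _ _ (`|a m| * normc (B w) *
    ((2 ^+ (n * N) * 4 ^+ (m * (2 * (n * N)))) * crho w ^+ N))).
  rewrite ler_wpM2l ?mulr_ge0 ?normc_ge0// (le_trans H)//.
  by rewrite ler_wpM2r ?exprn_ge0 ?rho_ge0.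
have -> : `|a m| * normc (B w) *
    ((2 ^+ (n * N) * 4 ^+ (m * (2 * (n * N)))) * crho w ^+ N) =
    2 ^+ (n * N) * (normc (B w) * crho w ^+ N) * (`|a m| * 4 ^+ (m * (2 * (n * N)))).
  by ring.
rewrite -[leRHS]mulrA ler_pM ?mulr_ge0 ?normc_ge0 ?exprn_ge0 ?rho_ge0//.
by rewrite ler_wpM2l ?exprn_ge0.
Qed.

Lemma ksum_bound (a : nat -> R) (B : 'rV[C]_n -> C) (N : nat) (V E D : R) :
  0 <= E -> (forall z, strip V z -> normc (B z) * crho z ^+ N <= E) ->
  (forall m, `|a m| * 4 ^+ (m * (2 * (n * N))) <= D * 2^-1 ^+ m) ->
  forall z, strip V z -> normc (ksum a B z) * crho z ^+ N <= 4 * (2 ^+ (n * N) * E * D).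
Proof.
move=> E0 BE aD z zV; rewrite -ler_pdivlMr ?exprn_gt0 ?rho_gt0// -(mulrA 4).
apply: normc_cint_count => m; rewrite mulrAC ler_pdivlMr ?exprn_gt0 ?rho_gt0//.
exact: ksum_term_bound zV.
Qed.

Lemma decays_cintegrable (a : nat -> R) (B : 'rV[C]_n -> C) z : superdecay a -> decays B ->
  cintegrable count (fun m => (a m)%:C * B (((4 : R) ^- m)%:C *: z)).
Proof.
move=> sa dB; have [V V0 zV] := strip_shift z.
have {}zV : strip V z by have := zV 0; rewrite addr0; apply => i; rewrite mxE normc0.
have [E E0 BE] := dB 0 V; have [D D0 aD] := sa (2 * (n * 0))%N.
apply: (@cintegrable_count _ (2 ^+ (n * 0) * E * D)) => m.
by have := ksum_term_bound E0 BE aD m zV; rewrite expr0 mulr1.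
Qed.

Lemma decays_ksum a B : superdecay a -> decays B -> decays (ksum a B).
Proof.
move=> sa dB N V; have [E E0 BE] := dB N V; have [D D0 aD] := sa (2 * (n * N))%N.
exists (4 * (2 ^+ (n * N) * E * D)); last by move=> z; exact: ksum_bound.
by rewrite !mulr_ge0 ?exprn_ge0.
Qed.

Lemma superdecay_scale a : superdecay a -> superdecay (fun m => a m * 4 ^- m).
Proof.
move=> sa L; have [D D0 aD] := sa L; exists D => // m.
rewrite (le_trans _ (aD m))// ler_wpM2r ?exprn_ge0// normrM ler_piMr//.
by rewrite gtr0_norm.
Qed.

Lemma nice_partials d (A : 'rV[C]_n -> C) : nice d.+2 A ->
  exists (D1 : 'I_n -> 'rV[C]_n -> C) (D2 : 'I_n -> 'I_n -> 'rV[C]_n -> C),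
    [/\ forall j, has_partial j A (D1 j), forall j, nice d.+1 (D1 j),
        forall j i, has_partial i (D1 j) (D2 j i) & forall j i, nice d (D2 j i)].
Proof.
move=> nA; have /choice[D1 H1] j : exists D, has_partial j A D /\ nice d.+1 D.
  by have [D ? ?] := nA.2 j; exists D.
have /choice[D2 H2] (p : 'I_n * 'I_n) :
    exists D, has_partial p.2 (D1 p.1) D /\ nice d D.
  by have [D ? ?] := (H1 p.1).2.2 p.2; exists D.
exists D1, (fun j i => D2 (j, i)); split => [j|j|j i|j i].
- exact: (H1 j).1.
- exact: (H1 j).2.
- exact: (H2 (j, i)).1.
- exact: (H2 (j, i)).2.
Qed.

Lemma has_partial_term (c : R) m (F D : 'rV[C]_n -> C) j : has_partial j F D ->
  has_partial j (fun z => c%:C * F (((4 : R) ^- m)%:C *: z))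
    (fun z => (c * 4 ^- m)%:C * D (((4 : R) ^- m)%:C *: z)).
Proof.
move=> FD.
apply: (eq_has_partial (has_partialZ c%:C (has_partial_affine 0 ((4 : R) ^- m)%:C FD))) => z;
  by rewrite add0r// rmorphM mulrA.
Qed.

(** Differentiation under the integral for the counting measure. Each derivative multiplies the m-th
    coefficient by 4^-m, which preserves superdecay. *)
Lemma has_partial_ksum a B j D : superdecay a -> nice 2 B -> has_partial j B D ->
  has_partial j (ksum a B) (ksum (fun m => a m * 4 ^- m) D).
Proof.
move=> sa nB BD z; have [D1 [D2 [BD1 nD1 BD2 nD2]]] := nice_partials nB.
have sa1 := superdecay_scale sa; have sa2 := superdecay_scale sa1.
have [V V0 Vh] := strip_shift z.
have /choice[E EP] (p : 'I_n * 'I_n) : exists E : R, 0 <= E /\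
    forall w, strip V w -> forall m,
      normc ((a m * 4 ^- m * 4 ^- m)%:C * D2 p.1 p.2 (((4 : R) ^- m)%:C *: w)) <=
      E * 2^-1 ^+ m.
  have [E E0 DE] := nice_decays (nD2 p.1 p.2) 0 V.
  have [F F0 aF] := sa2 (2 * (n * 0))%N.
  exists (2 ^+ (n * 0) * E * F); split; first by rewrite !mulr_ge0 ?exprn_ge0.
  move=> w wV m; have := @ksum_term_bound (fun m => a m * 4 ^- m * 4 ^- m) _ _ _ _ _ E0 DE aF w m wV.
  by rewrite expr0 mulr1.
pose S := \sum_i \sum_j E (i, j).
have [||||||_ H] := @differentiable_cint R _ _ count n
  (fun z m => (a m)%:C * B (((4 : R) ^- m)%:C *: z)) z (fun m => S * 2^-1 ^+ m).
- by move=> m i w; exact: has_partial_derivable (has_partial_term (a m) m (BD1 i)).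
- move=> m i k w; rewrite (partialE (has_partial_term (a m) m (BD1 i))).
  exact: has_partial_derivable (has_partial_term _ m (BD2 i k)).
- move=> i k h m h1; rewrite (partialE (has_partial_term (a m) m (BD1 k))).
  rewrite (partialE (has_partial_term _ m (BD2 k i))).
  rewrite (le_trans ((EP (k, i)).2 _ (Vh h h1) m))// ler_wpM2r ?exprn_ge0 ?invr_ge0//.
  rewrite /S (bigD1 k)//= (bigD1 i)//= -addrA lerDl addr_ge0// ?sumr_ge0// => p _.
    exact: (EP (k, p)).1.
  by apply: sumr_ge0 => q _; exact: (EP (p, q)).1.
- exact: integrable_half_powers.
- by move=> w; exact: decays_cintegrable (nice_decays nB).
- move=> i; rewrite (_ : (fun m => partial _ _ _) =
    (fun m => (a m * 4 ^- m)%:C * D1 i (((4 : R) ^- m)%:C *: z))).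
    exact: (@decays_cintegrable (fun m => a m * 4 ^- m) _ z sa1 (nice_decays (nD1 i))).
  by apply/funext => m; rewrite (partialE (has_partial_term (a m) m (BD1 i))).
have := H j; rewrite (_ : (fun m => partial _ _ _) =
    (fun m => (a m * 4 ^- m)%:C * D (((4 : R) ^- m)%:C *: z)))//.
by apply/funext => m; rewrite (partialE (has_partial_term (a m) m BD)).
Qed.

(** Two orders are lost, because termwise differentiation is justified by the second derivatives of
    the terms. *)
Lemma nice_ksum d a B : superdecay a -> nice d.+2 B -> nice d (ksum a B).
Proof.
elim: d => [|d IH] in a B *; move=> sa nB.
  by split => //; exact: decays_ksum (nice_decays nB).
split; first exact: decays_ksum (nice_decays nB).
move=> j; have [D BD nD] := nB.2 j.
exists (ksum (fun m => a m * 4 ^- m) D); last exact/IH/nD/superdecay_scale.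
by apply: has_partial_ksum => //; exact: (@nice_le _ _ 2 d.+3).
Qed.

Lemma superdecay_truncate a M : superdecay a ->
  superdecay (fun m => if (m < M)%N then 0 else a m).
Proof.
move=> sa L; have [D D0 aD] := sa L; exists D => // m; case: ifPn => // _.
by rewrite normr0 mul0r mulr_ge0// exprn_ge0// invr_ge0.
Qed.

(** The finite part commutes with a convolution by mere linearity; the tail is again a [ksum], so
    the bounds for series apply to it. *)
Lemma ksum_tail a B M z : superdecay a -> decays B ->
  ksum a B z = \sum_(m < M) (a m)%:C * B (((4 : R) ^- m)%:C *: z) +
    ksum (fun m => if (m < M)%N then 0 else a m) B z.
Proof.
move=> sa dB; have ia := decays_cintegrable z sa dB.
have ia' := decays_cintegrable z (superdecay_truncate M sa) dB.
rewrite -(cint_count_finite (fun m => (a m)%:C * B (((4 : R) ^- m)%:C *: z))).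
have -> : (fun m => if (m < M)%N then (a m)%:C * B (((4 : R) ^- m)%:C *: z) else 0) =
    (fun m => (a m)%:C * B (((4 : R) ^- m)%:C *: z) -
      (if (m < M)%N then 0 else a m)%:C * B (((4 : R) ^- m)%:C *: z)).
  by apply/funext => m; case: ifPn => _; rewrite ?mul0r ?subr0 ?subrr.
by rewrite cintB// subrK.
Qed.

End kernel_series.

(** * The kernel reproduces polynomials *)

Section reproduction.
Variables (R : realType) (n : nat).
Local Notation C := R[i].
Local Notation mR := (measurableTypeR R).
Local Notation mu := (lebesgue_tuple R n).
Local Notation row := (@row_of_tuple R n).

Lemma gauss_real (u : 'rV[R]_n) : gauss (toC u) = (expR (- \sum_i u ord0 i ^+ 2))%:C.
Proof.
rewrite /gauss (_ : - _ = (- \sum_i u ord0 i ^+ 2)%:C).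
  by apply: complex_eqP; rewrite /= ?cos0 ?sin0 ?mulr1 ?mulr0.
rewrite rmorphN rmorph_sum/=; congr (- _); apply: eq_bigr => i _.
by rewrite mxE expr2 rmorphM.
Qed.

Lemma gaussN (z : 'rV[C]_n) : gauss (- z) = gauss z.
Proof. by rewrite /gauss; congr (cexp (- _)); apply: eq_bigr => i _; rewrite mxE mulrNN. Qed.

Lemma cint_gauss : cint mu (fun t => gauss (- toC (row t))) = ((Num.sqrt pi : R) ^+ n)%:C.
Proof.
have E t : gauss (- toC (row t)) = (\prod_i gauss_fun (tnth t i))%:C.
  rewrite gaussN gauss_real; congr (_%:C); rewrite -sumrN expR_sum.
  by apply: eq_bigr => i _; rewrite mxE.
rewrite (eq_cint _ E) /cint/=; apply: complex_eqP => /=.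
  rewrite /Rintegral (@integral_lebesgue_tuple_prod R n gauss_fun (Num.sqrt pi))//.
  - exact: measurable_gauss_fun.
  - exact: gauss_fun_ge0.
  - exact: integralT_gauss.
by rewrite /Rintegral integral0.
Qed.

(** The factor 4^-(m n) compensates the Jacobian of the dilation by 4^m, so that all dilated
    Gaussians have the same integral and only [coef] governs the moments. *)
Lemma superdecay_coef (s : R) : superdecay (fun m => coef R m * 4 ^- (m * n) * s).
Proof.
move=> L; have [D D0 H] := coef_superdecay R L.
exists (D * `|s|); first exact: mulr_ge0.
move=> m; rewrite !normrM mulrAC [leRHS]mulrAC ler_wpM2r// mulrAC -[leRHS]mulr1.
rewrite ler_pM// ?mulr_ge0 ?exprn_ge0//.
by rewrite gtr0_norm ?invr_gt0 ?exprn_gt0// invf_le1 ?exprn_gt0// exp4_ge1.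
Qed.

(* The scaling [s] normalises the integral of the kernel to 1. *)
Definition approx_kernel (s : R) : 'rV[C]_n -> C :=
  ksum (fun m => coef R m * 4 ^- (m * n) * s) (@gauss R n).

Lemma nice_gauss d : nice d (@gauss R n).
Proof.
by have := nice_poly_gauss d (cpoly_cst n (1 : C)); congr (nice d _);
  apply/funext => z; rewrite mul1r.
Qed.

Lemma nice_kernel s d : nice d (approx_kernel s).
Proof. exact/nice_ksum/nice_gauss/superdecay_coef. Qed.

Lemma kernel_real s u : complex.Im (approx_kernel s (toC u)) = 0.
Proof.
apply: (@etrans _ _ (\int[@counting nat R]_(m in setT) (0 : R))); last first.
  by rewrite /Rintegral integral0.
apply: eq_Rintegral => m _; rewrite ImZ (_ : _ *: toC u = toC ((4 : R) ^- m *: u)).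
  by rewrite gauss_real mulr0.
by apply/rowP => i; rewrite !mxE rmorphM.
Qed.

(** The decay with L + 1 in place of L leaves a spare factor 4^-m, which for m >= M is at most 2^-m
    <= 2^-M. *)
Lemma superdecay_tail (a : nat -> R) L : superdecay a -> exists2 D : R, 0 <= D &
  forall M m, `|if (m < M)%N then 0 else a m| * 4 ^+ (m * L) <= D * 2^-1 ^+ M * 2^-1 ^+ m.
Proof.
move=> sa; have [D D0 H] := sa L.+1; exists D => // M m; case: ltnP => mM.
  by rewrite normr0 mul0r !mulr_ge0// exprn_ge0// invr_ge0.
have := H m; rewrite mulnS exprD mulrCA mulrC => {}H.
rewrite (le_trans (_ : _ <= D * 2^-1 ^+ m / 4 ^+ m))//.
  by rewrite ler_pdivlMr// exprn_gt0.
rewrite mulrAC ler_wpM2r ?exprn_ge0 ?invr_ge0// ler_wpM2l//.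
apply: (@le_trans _ _ (2^-1 ^+ m)).
  by rewrite exprVn lef_pV2 ?posrE ?exprn_gt0// lerXn2r ?nnegrE// ler_nat.
by rewrite ler_wiXn2l ?invr_ge0// invf_le1// ler1n.
Qed.

Lemma conv_tail (a : nat -> R) (A : 'rV[C]_n -> C) f x : superdecay a ->
  (forall d, nice d A) -> cmeasurable f -> poly_bounded f ->
  exists2 D : R, 0 <= D & forall M,
    normc (cconv (ksum (fun m => if (m < M)%N then 0 else a m) A) f x) <= D * 2^-1 ^+ M.
Proof.
move=> sa nA mf pf; have [E [N [E0 fE]]] := pf.
have [V V0 Vx] := strip_shift x.
have {}Vx : strip V x by have := Vx 0; rewrite addr0; apply => i; rewrite mxE normc0.
have [F F0 AF] := nice_decays (nA 0%N) N.+1 V.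
have [D D0 aD] := superdecay_tail (2 * (n * N.+1)) sa.
pose G := (2 ^+ n * crho x) ^+ N.+1 * (4 * (2 ^+ (n * N.+1) * F * D)) * E.
exists (2 * (G * pi ^+ n)).
  by rewrite !mulr_ge0 ?exprn_ge0 ?mulr_ge0 ?rho_ge0 ?exprn_ge0// pi_ge0.
move=> M; have saM := superdecay_truncate M sa.
have H := conv_bound (rho_ge0 (re_vec x)) E0 (ksum_bound F0 AF (aD M)) fE Vx (lexx _).
have := normc_cint_le (conv_integrable (nice_ksum saM (nA 4%N)) mf pf x) H (integrable_rhoV n _).
by rewrite Rintegral_rhoV; congr (_ <= _); rewrite /G; ring.
Qed.

(** The difference of the two sides does not depend on M, yet it is bounded by quantities that
    vanish as M grows: the distance of [psum] from its limits, and the tail. *)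
Lemma cconv_kernel_cpoly (S : R) (P : 'rV[C]_n -> C) x : 0 < S ->
  psum R 0 M @[M --> \oo] --> S -> cpoly P ->
  cconv (approx_kernel (S * Num.sqrt pi ^+ n)^-1) (fun t => P (toC (row t))) x = P x.
Proof.
move=> S0 cS cP; set s := (_ * _)^-1.
have Z0 : (Num.sqrt pi : R) ^+ n != 0 by rewrite expf_neq0// gt_eqF// sqrtr_gt0 pi_gt0.
have Ss : S * s * Num.sqrt pi ^+ n = 1 by rewrite mulrAC divff// mulf_neq0// gt_eqF.
have [I [e [q [cq Pq]]]] := cpoly_line_expansion x cP.
pose J i := cint mu (fun t => gauss (- toC (row t)) * q i (toC (row t))).
have mP := cmeasurable_cpoly cP; have pP := poly_bounded_cpoly cP.
have iJ i : cintegrable mu (fun t => gauss (- toC (row t)) * q i (toC (row t))).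
  have := conv_integrable (nice_gauss 2) (cmeasurable_cpoly (cq i)) (poly_bounded_cpoly (cq i)) 0.
  by under eq_fun do rewrite sub0r.
(* The Gaussian moments [J i] do not depend on the dilation c, which enters only through powers. *)
have JE c : cint mu (fun t => gauss (- toC (row t)) * P (x + c *: toC (row t))) =
    \sum_i c ^+ e i * J i.
  have [_] := @cintegrable_sum _ _ _ mu _ (index_enum I) xpredT _
    (fun i _ => cintegrableZ (c ^+ e i) (iJ i)).
  under [X in _ = X -> _]eq_bigr do rewrite cintZ//.
  move=> <-; apply: eq_cint => t; rewrite Pq mulr_sumr.
  by apply: eq_bigr => i _; rewrite mulrCA.
pose a m : R := coef R m * 4 ^- (m * n) * s.
have sa : superdecay a by exact: superdecay_coef.
have term m : cconv (fun z => (a m)%:C * gauss (((4 : R) ^- m)%:C *: z))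
    (fun t => P (toC (row t))) x = \sum_i (coef R m * 4 ^+ (m * e i) * s)%:C * J i.
  rewrite conv_gauss_cpoly ?exprn_gt0// JE mulr_sumr; apply: eq_bigr => i _.
  rewrite mulrA -!rmorphXn -!rmorphM/= /a -!exprM ?natrX; congr (_%:C * _).
  have : (4 : R) ^+ (m * n) != 0 by rewrite expf_neq0.
  by move: (4 ^+ (m * n)) (4 ^+ (m * e i)) => p p' p0; field.
(* The limit of [psum (e i)]: S at exponent 0, and 0 at the zeros 4^l with l > 0. *)
pose del i : R := if e i == 0 then S else 0.
(* For c = 0, [JE] expresses P x times the integral of the Gaussian; only indices with e i = 0
   survive, and s cancels S and the integral. *)
have PxE : P x = \sum_i (del i * s)%:C * J i.
  have := JE 0; under eq_cint do rewrite scale0r addr0 mulrC.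
  rewrite cintZ ?cint_gauss; last first.
    have := conv_integrable (nice_gauss 2) (cmeasurable_cst _ 1) (@poly_bounded1 R n) 0.
    by under eq_fun do rewrite sub0r mulr1.
  move=> PJ; rewrite -[LHS]mulr1.
  have -> : 1 = (S * s)%:C * (Num.sqrt pi ^+ n)%:C :> C by rewrite -rmorphM Ss.
  rewrite mulrCA PJ mulr_sumr; apply: eq_bigr => i _.
  rewrite mulrA /del; congr (_ * _); case: eqP => [->|/eqP ei].
    by rewrite expr0 mulr1.
  by rewrite expr0n (negbTE ei) mulr0 mul0r.
have [D D0 tD] := conv_tail x sa nice_gauss mP pP.
have split M : cconv (approx_kernel s) (fun t => P (toC (row t))) x =
    \sum_i (psum R (e i) M * s)%:C * J i +
    cconv (ksum (fun m => if (m < M)%N then 0 else a m) (@gauss R n)) (fun t => P (toC (row t))) x.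
  have -> : \sum_i (psum R (e i) M * s)%:C * J i = \sum_(m < M) cconv
      (fun z => (a m)%:C * gauss (((4 : R) ^- m)%:C *: z)) (fun t => P (toC (row t))) x.
    under [RHS]eq_bigr do rewrite term.
    rewrite exchange_big/=; apply: eq_bigr => i _.
    by rewrite -mulr_suml -rmorph_sum/= /psum mulr_suml.
  have saM := superdecay_truncate M sa.
  have iT := conv_integrable (nice_ksum saM (nice_gauss 4)) mP pP x.
  have iM m : cintegrable mu (fun t => (a m)%:C * gauss (((4 : R) ^- m)%:C *: (x - toC (row t))) *
      P (toC (row t))).
    apply: (@conv_integrable R n (fun z => (a m)%:C * gauss (((4 : R) ^- m)%:C *: z)) _ _ mP pP).
    by apply: nice_scale; [rewrite invr_gt0 exprn_gt0|exact: nice_gauss].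
  have [iS eS] := @cintegrable_sum _ _ _ mu _ (index_enum 'I_M) xpredT
    (fun (m : 'I_M) t => (a m)%:C * gauss (((4 : R) ^- m)%:C *: (x - toC (row t))) * P (toC (row t)))
    (fun m _ => iM m).
  rewrite /cconv -eS -cintD//; apply: eq_cint => t.
  by rewrite /approx_kernel (ksum_tail M _ sa (nice_decays (nice_gauss 0))) mulrDl mulr_suml.
have key M : normc (cconv (approx_kernel s) (fun t => P (toC (row t))) x - P x) <=
    \sum_i `|psum R (e i) M * s - del i * s| * normc (J i) + D * 2^-1 ^+ M.
  rewrite (split M) PxE addrAC -sumrB (le_trans (normcD _ _))// lerD//.
  rewrite (le_trans (normc_sum _ _ _))//; apply: ler_sum => i _.
  by rewrite -mulrBl -rmorphB normcM normc_real.
apply/eqP; rewrite -subr_eq0; apply/eqP/ComplexField.Normc.eq0_normc/eqP.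
rewrite eq_le normc_ge0 andbT.
have lim0 : \sum_i `|psum R (e i) M * s - del i * s| * normc (J i) + D * 2^-1 ^+ M
    @[M --> \oo] --> (0 : R).
  rewrite [X in _ --> X](_ : _ =
      \sum_(i : I) `|del i * s - del i * s| * normc (J i) + D * 0); last first.
    by rewrite mulr0 addr0 big1// => i _; rewrite subrr normr0 mul0r.
  apply: cvgD; last first.
    apply: cvgM; first exact: cvg_cst.
    by apply: cvg_expr; rewrite ger0_norm ?invr_ge0// invf_lt1// ltr1n.
  apply: (@cvg_big _ _ (+%R : R -> R -> R) 0) => [|i _]; first exact: add_continuous.
  apply: cvgM; last exact: cvg_cst.
  apply: cvg_norm; apply: cvgB; last exact: cvg_cst.
  apply: cvgM; last exact: cvg_cst.
  by rewrite /del; case: (e i) => [|l] /=; [exact: cS|exact: cvg_psumS].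
apply: (ler_cvg_to (cvg_cst _) lim0).
by near=> M; exact: key.
Unshelve. all: by end_near. Qed.

End reproduction.

(** * Taylor polynomials *)

Section words.
Variables (K : numFieldType) (n : nat).
Implicit Types (F : 'rV[K]_n -> K) (w : seq 'I_n) (alpha beta : 'I_n -> nat).

(** Derivatives along a word of directions. [mi_partial] is the case of a sorted word; inductions on
    the order produce arbitrary words, which are then sorted by symmetry of mixed derivatives. *)
Definition pword w F : 'rV[K]_n -> K := foldr (@partial n K) F w.

Lemma pword_cat w w' F : pword (w ++ w') F = pword w (pword w' F).
Proof. exact: foldr_cat. Qed.

Definition mi_word alpha : seq 'I_n := flatten [seq nseq (alpha j) j | j <- enum 'I_n].

Lemma mi_partialE alpha F : mi_partial alpha F = pword (mi_word alpha) F.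
Proof.
rewrite /mi_partial /mi_word; elim: (enum 'I_n) => //= j s ->.
by rewrite pword_cat; elim: (alpha j) => //= m ->.
Qed.

Lemma size_mi_word alpha : size (mi_word alpha) = mi_abs alpha.
Proof.
rewrite /mi_word size_flatten /shape -map_comp sumnE big_map /mi_abs big_enum/=.
by apply: eq_bigr => i _; rewrite size_nseq.
Qed.

Lemma count_mi_word alpha j : count_mem j (mi_word alpha) = alpha j.
Proof.
rewrite /mi_word count_flatten -map_comp sumnE big_map big_enum/= (bigD1 j)//=.
rewrite count_nseq/= eqxx mul1n big1 ?addn0// => i ij.
by rewrite count_nseq/= (negbTE ij) mul0n.
Qed.

End words.

(** * Symmetry of mixed partial derivatives *)

Section schwarz.
Variables (R : realType) (n : nat).
Implicit Types (g : 'rV[R]_n -> R) (x v : 'rV[R]_n).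

Lemma is_derive_line g x v (t d : R) : is_derive (x + t *: v) v g d ->
  is_derive t (1 : R) (fun h => g (x + h *: v)) d.
Proof.
move=> gd; apply: near_is_derive => e /(is_derive_near gd); apply: filterS => k.
by rewrite [k *: (1 : R)]mulr1 scalerDl addrA.
Qed.

Lemma line_MVT g x v (s : R) : 0 < s -> (forall y, derivable g y v) ->
  exists2 t, 0 <= t <= s & g (x + s *: v) - g x = s * 'D_v g (x + t *: v).
Proof.
move=> s0 dg.
have D t : is_derive t (1 : R) (fun h => g (x + h *: v)) ('D_v g (x + t *: v)).
  by apply: is_derive_line; exact: derivableP.
have cg : {within `[0, s], continuous (fun h : R => g (x + h *: v))}.
  by apply: derivable_within_continuous => t _; exact: ex_derive.
have [t] := MVT s0 (fun t _ => D t) cg.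
rewrite in_itv/= scale0r addr0 subr0 => /andP[t0 ts] E.
by exists t; rewrite ?(ltW t0) ?(ltW ts)// mulrC.
Qed.

(** The mean value theorem in direction i, applied to the difference of g in direction j, and then
    in direction j, applied to [partial i g]. *)
Lemma second_difference g i j x (s : R) : 0 < s ->
  (forall y, derivable g y (delta_mx ord0 i)) ->
  (forall y, derivable (partial i g) y (delta_mx ord0 j)) ->
  exists2 h : 'rV[R]_n, `|h| <= 2 * s &
    g (x + s *: delta_mx ord0 i + s *: delta_mx ord0 j) - g (x + s *: delta_mx ord0 i) -
    (g (x + s *: delta_mx ord0 j) - g x) = s * (s * partial j (partial i g) (x + h)).
Proof.
move=> s0 dg ddg; set ei := delta_mx ord0 i; set ej := delta_mx ord0 j.
pose G (y : 'rV[R]_n) := g (y + s *: ej) - g y.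
have GD y : is_derive y ei G (partial i g (y + s *: ej) - partial i g y).
  apply: is_deriveB; last exact/derivableP.
  apply/is_derive_lineP.
  have /is_derive_lineP := @derivableP _ _ _ g (y + s *: ej) ei (dg _).
  by under eq_fun do rewrite addrAC.
have [t /andP[t0 ts]] := line_MVT x s0 (fun y => @ex_derive _ _ _ _ _ _ _ (GD y)).
rewrite (@derive_val _ _ _ _ _ _ _ (GD _)).
have [t' /andP[t'0 t's] ->] := line_MVT (x + t *: ei) s0 ddg.
move=> GE; exists (t *: ei + t' *: ej); last first.
  by rewrite addrA -GE /G; congr (g _ - _ - _); rewrite addrAC.
have n1 k : `|delta_mx ord0 k : 'rV[R]_n| <= 1.
  apply: rV_norm_le => // l; rewrite mxE eqxx/=.
  by case: eqP => _; rewrite ?normr1 ?normr0.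
rewrite (le_trans (ler_normD _ _))// !normrZ !ger0_norm// mulr2n mulrDl mul1r.
by rewrite lerD// (le_trans (ler_wpM2l _ (n1 _)))// mulr1.
Qed.

(* Both mixed derivatives are limits of the same second difference quotient. *)
Lemma partialC g i j : real_Ck 2 g -> partial i (partial j g) = partial j (partial i g).
Proof.
move=> /= [_ Cg]; apply/funext => x; apply/eqP; rewrite -subr_eq0 -normr_eq0.
have [di [_ /(_ j)[dji [cji _]]]] := Cg i; have [dj [_ /(_ i)[dij [cij _]]]] := Cg j.
apply/eqP/le_anti; rewrite normr_ge0 andbT; apply/ler_addgt0Pl => e e0; rewrite addr0.
have e20 : 0 < e / 2 by rewrite divr_gt0.
have /cvgrPdist_lt /(_ _ e20) /nbhs_ballP[d1 /= d10 d1P] := cji x.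
have /cvgrPdist_lt /(_ _ e20) /nbhs_ballP[d2 /= d20 d2P] := cij x.
(* The intermediate points lie within 2 s of x, which must stay below both radii of continuity. *)
pose s := Num.min d1 d2 / 4.
have m0 : 0 < Num.min d1 d2 by rewrite lt_min d10 d20.
have s0 : 0 < s by rewrite divr_gt0.
have s21 : 2 * s < d1.
  apply: (@lt_le_trans _ _ (Num.min d1 d2)); last by rewrite ge_min lexx.
  by rewrite /s; lra.
have s22 : 2 * s < d2.
  apply: (@lt_le_trans _ _ (Num.min d1 d2)); last by rewrite ge_min lexx orbT.
  by rewrite /s; lra.
have [h1 h1s E1] := second_difference x s0 di dji.
have [h2 h2s E2] := second_difference x s0 dj dij.
have sn0 : s != 0 by rewrite gt_eqF.
have E : partial j (partial i g) (x + h1) = partial i (partial j g) (x + h2).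
  move: E1 E2; rewrite [x + s *: delta_mx ord0 j + _]addrAC.
  move: (partial j _ _) (partial i _ _) (g _) (g _) (g _) (g x) => p q a b c d E1 E2.
  by apply/(mulfI sn0)/(mulfI sn0); rewrite -E1 -E2; ring.
have B1 : `|partial j (partial i g) x - partial j (partial i g) (x + h1)| < e / 2.
  by apply: d1P; rewrite -ball_normE/= opprD addNKr normrN (le_lt_trans h1s).
have B2 : `|partial i (partial j g) x - partial i (partial j g) (x + h2)| < e / 2.
  by apply: d2P; rewrite -ball_normE/= opprD addNKr normrN (le_lt_trans h2s).
move: E B1 B2; move: (partial j _ x) (partial j _ (_ + _)) (partial i _ x) (partial i _ (_ + _)).
move=> a b c d -> B1 B2; rewrite (_ : c - a = (c - d) - (a - d)); last by ring.
by rewrite (splitr e) (le_trans (ler_normB _ _))// lerD// ltW.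
Qed.

Lemma real_CkS k g : real_Ck k.+1 g -> real_Ck k g.
Proof.
elim: k g => [|k IH] g [cg Cg]; split => // j.
have [dg /IH Cj] := Cg j; by split.
Qed.

Lemma real_Ck_le k m g : (k <= m)%N -> real_Ck m g -> real_Ck k g.
Proof.
elim: m => [|m IH]; first by rewrite leqn0 => /eqP ->.
by rewrite leq_eqVlt ltnS => /predU1P[->//|km /real_CkS]; exact: IH.
Qed.

Lemma real_Ck_pword k w g : real_Ck (size w + k) g -> real_Ck k (pword w g).
Proof.
by elim: w k => // j w IH k; rewrite [size _]/= addSnnS => /IH [_] /(_ j)[].
Qed.

Lemma pword_swap w j g : real_Ck (size w).+1 g ->
  pword w (partial j g) = partial j (pword w g).
Proof.
elim: w => // i w IH Cg; rewrite /= IH; last exact: real_CkS.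
by apply: partialC; apply: real_Ck_pword; rewrite addn2.
Qed.

(** By induction: the first letter of w is moved to the front of w' past the letters before it,
    which [pword_swap] permits, and the rest is a permutation of shorter words. *)
Lemma pword_perm w w' g : perm_eq w w' -> real_Ck (size w) g -> pword w g = pword w' g.
Proof.
elim: w w' => [|j w IH] w'; first by rewrite perm_sym => /perm_nilP ->.
move=> ww'; have jw' : j \in w' by rewrite -(perm_mem ww') mem_head.
case/splitPr: jw' ww' => w1 w2.
rewrite -[w1 ++ j :: w2]/(w1 ++ [:: j] ++ w2) perm_sym perm_catCA/= perm_cons => ww'.
have sw : size (w1 ++ w2) = size w by rewrite (perm_size ww').
move=> /= Cg; rewrite (IH (w1 ++ w2)) 1?perm_sym//; last exact: real_CkS.
rewrite !pword_cat -[pword (j :: w2) g]/(partial j (pword w2 g)) pword_swap//.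
apply: real_Ck_pword.
by move: Cg; rewrite -sw size_cat addnS addnC.
Qed.

End schwarz.

Section taylor_polynomials.
Variables (K : numFieldType) (n : nat).
Implicit Types (h : 'rV[K]_n) (alpha beta : 'I_n -> nat) (a : ('I_n -> nat) -> K).

(* Abstract coefficients allow for the same formula over [R] and [C]. *)
Definition gtaylor k a h : K :=
  \sum_(beta : {ffun 'I_n -> 'I_k.+1} | (mi_abs (mi_of beta) <= k)%N)
    ((mi_fact (mi_of beta))%:R)^-1 * a (mi_of beta) * mi_pow h (mi_of beta).

Definition mi_incr j alpha : 'I_n -> nat := fun i => (alpha i + (i == j))%N.

Lemma mi_abs_incr j alpha : mi_abs (mi_incr j alpha) = (mi_abs alpha).+1.
Proof.
rewrite /mi_abs big_split/= -addn1; congr (_ + _)%N.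
by rewrite (bigD1 j)//= eqxx big1 ?addn0// => i /negbTE ->.
Qed.

Lemma mi_fact_incr j alpha : mi_fact (mi_incr j alpha) = ((alpha j).+1 * mi_fact alpha)%N.
Proof.
rewrite /mi_fact (bigD1 j)//= [in RHS](bigD1 j)//= /mi_incr eqxx addn1 factS mulnA.
by congr (_ * _)%N; apply: eq_bigr => i /negbTE ->; rewrite addn0.
Qed.

Lemma mi_abs_coord alpha i : (alpha i <= mi_abs alpha)%N.
Proof. by rewrite /mi_abs (bigD1 i)//= leq_addr. Qed.

Lemma mi_ofK k alpha : (mi_abs alpha <= k)%N ->
  exists beta : {ffun 'I_n -> 'I_k.+1}, mi_of beta = alpha.
Proof.
move=> ak; exists [ffun i => inord (alpha i)]; apply/funext => i.
by rewrite /mi_of ffunE inordK// ltnS (leq_trans (mi_abs_coord _ _)).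
Qed.

Lemma has_partialX j F D m : has_partial j F D ->
  @has_partial K n j (fun h => F h ^+ m) (fun h => m%:R * F h ^+ m.-1 * D h).
Proof.
move=> FD; elim: m => [|m IH].
  apply: (eq_has_partial (has_partial_cst j (1 : K))) => h; first by rewrite expr0.
  by rewrite !mul0r.
apply: (eq_has_partial (has_partialM FD IH)) => h; rewrite ?exprS//.
case: m {IH} => [|m]; first by rewrite !mul0r mulr0 add0r !expr0 mulr1 mul1r.
by rewrite -[in RHS]natr1 exprS/=; ring.
Qed.

Lemma has_partial_mi_pow j beta :
  has_partial j (fun h => mi_pow h beta)
    (fun h => (beta j)%:R * mi_pow h (fun i => (beta i - (i == j))%N)).
Proof.
have H1 : has_partial j (fun h => h ord0 j ^+ beta j)
    (fun h => (beta j)%:R * h ord0 j ^+ (beta j).-1).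
  apply: (eq_has_partial (has_partialX (beta j) (has_partial_coord j j))) => // h.
  by rewrite eqxx mulr1.
have H2 : has_partial j (fun h => \prod_(i < n | i != j) h ord0 i ^+ beta i) (fun=> 0).
  elim: (index_enum 'I_n) => [|i s IH].
    by apply: (eq_has_partial (has_partial_cst j (1 : K))) => // h; rewrite big_nil.
  have [ij|ij] := boolP (i != j); last first.
    by apply: (eq_has_partial IH) => // h; rewrite big_cons (negbTE ij).
  apply: (eq_has_partial (has_partialM
    (has_partialX (beta i) (has_partial_coord j i)) IH)) => h.
    by rewrite big_cons ij.
  by rewrite (negbTE ij) !mulr0 addr0.
apply: (eq_has_partial (has_partialM H1 H2)) => h.
  by rewrite /mi_pow [RHS](bigD1 j).
rewrite mulr0 add0r /mi_pow [in RHS](bigD1 j)//= eqxx subn1 mulrC mulrA; congr (_ * _).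
by apply: eq_bigr => i /negbTE ->; rewrite subn0.
Qed.

Lemma has_partial_gtaylor j k a :
  has_partial j (gtaylor k.+1 a) (gtaylor k (fun beta => a (mi_incr j beta))).
Proof.
have H := @has_partial_sum K n j _ (index_enum {ffun 'I_n -> 'I_k.+2})
  (fun b => (mi_abs (mi_of b) <= k.+1)%N) _ _
  (fun b _ => has_partialZ (((mi_fact (mi_of b))%:R)^-1 * a (mi_of b))
     (has_partial_mi_pow j (mi_of b))).
apply: (eq_has_partial H) => // h; clear H.
(* Terms without the j-th variable drop out. On the others, beta_j / beta! = 1 / (beta - e_j)!, and
   subtracting e_j reindexes them by multi-indices of order at most k. *)
rewrite (bigID (fun beta : {ffun 'I_n -> 'I_k.+2} => 0 < mi_of beta j)%N)/= addrC.
rewrite big1 ?add0r => [|beta /andP[_]]; last first.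
  by rewrite -eqn0Ngt => /eqP ->; rewrite mul0r mulr0.
pose up (g : {ffun 'I_n -> 'I_k.+1}) : {ffun 'I_n -> 'I_k.+2} :=
  [ffun i => inord (g i + (i == j))].
pose down (b : {ffun 'I_n -> 'I_k.+2}) : {ffun 'I_n -> 'I_k.+1} :=
  [ffun i => inord (b i - (i == j))].
have upE g : mi_of (up g) = mi_incr j (mi_of g).
  apply/funext => i; rewrite /mi_of ffunE inordK// /mi_incr.
  by have := ltn_ord (g i); case: eqP; lia.
rewrite (reindex_onto up down)/=; last first.
  move=> b /andP[bk bj]; apply/ffunP => i; apply/ord_inj.
  rewrite !ffunE.
  (* For i different from j, b j > 0 and |b| <= k + 1 force b i <= k, so [inord] does not take its
     default value. *)
  have H : (b i - (i == j) < k.+1)%N.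
    case: eqVneq => [->|ij] /=; first by have := ltn_ord (b j); rewrite ltnS; lia.
    rewrite subn0 ltnS -ltnS; move: bk; rewrite /mi_abs (bigD1 j)//= (bigD1 i)//= /mi_of.
    by move: bj; rewrite /mi_of; lia.
  rewrite (inordK H) inordK; first by case: eqVneq bj => [->|]/=; rewrite /mi_of; lia.
  by move: H; case: eqP; lia.
apply: eq_big => [g|g _].
  rewrite upE mi_abs_incr ltnS /mi_incr eqxx addn1/= andbT.
  rewrite (_ : down (up g) == g) ?andbT//; apply/eqP/ffunP => i; apply/ord_inj.
  rewrite ffunE -[nat_of_ord (up g i)]/(mi_of (up g) i) upE /mi_incr addnK.
  by rewrite inordK// ltn_ord.
rewrite upE mi_fact_incr natrM.
have -> : (fun i => mi_incr j (mi_of g) i - (i == j))%N = mi_of g.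
  by apply/funext => i; rewrite /mi_incr addnK.
rewrite /mi_incr eqxx addn1 invfM.
have : ((mi_of g j).+1%:R : K) != 0 by rewrite pnatr_eq0.
move: (mi_fact _)%:R^-1 (_.+1%:R) (a _) (mi_pow _ _) => q p r s p0.
by rewrite mulrCA mulrA -!(mulrA p^-1) mulVKf//.
Qed.

Lemma gtaylor0 a h : gtaylor 0 a h = a (fun=> 0%N).
Proof.
rewrite /gtaylor (big_pred1 [ffun=> ord0]) => [|b]; last first.
  rewrite /mi_abs big1 => [|i _]; last by rewrite /mi_of ord1.
  by apply/esym/eqP/ffunP => i; rewrite ffunE ord1.
have -> : mi_of [ffun=> (ord0 : 'I_1)] = (fun=> 0%N) :> ('I_n -> nat).
  by apply/funext => i; rewrite /mi_of ffunE.
rewrite /mi_fact /mi_pow !big1 => [|i _|i _]; rewrite ?expr0//.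
by rewrite invr1 mul1r mulr1.
Qed.

Lemma gtaylor_at0 k a : gtaylor k a 0 = a (fun=> 0%N).
Proof.
have E0 : mi_of [ffun=> (ord0 : 'I_k.+1)] = (fun=> 0%N) :> ('I_n -> nat).
  by apply/funext => i; rewrite /mi_of ffunE.
rewrite /gtaylor (bigD1 [ffun=> ord0])/=; last by rewrite E0 /mi_abs big1.
rewrite E0 big1 => [|b /andP[_ b0]].
  rewrite /mi_fact /mi_pow !big1 => [|i _|i _]; rewrite ?expr0//.
  by rewrite invr1 mul1r mulr1 addr0.
have [i bi] : exists i, b i != ord0.
  apply/existsP; rewrite -negb_forall; apply: contra b0 => /forallP H.
  by apply/eqP/ffunP => i; rewrite ffunE; apply/eqP.
rewrite /mi_pow (bigD1 i)//= mxE expr0n /mi_of.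
by rewrite (_ : (nat_of_ord (b i) == 0%N) = false) ?mul0r ?mulr0//; apply/negbTE.
Qed.

Lemma eq_gtaylor k a a' : (forall beta, (mi_abs beta <= k)%N -> a beta = a' beta) ->
  gtaylor k a = gtaylor k a'.
Proof.
by move=> aa'; apply/funext => h; apply: eq_bigr => b bk; rewrite aa'.
Qed.

Lemma cpoly_gtaylor k a : cpoly (gtaylor k a).
Proof.
apply: cpoly_sum => b _; apply: cpolyM; first exact: cpoly_cst.
by apply: cpoly_prod => i _; apply: cpolyX; exact: cpoly_coord.
Qed.

Lemma pword_gtaylor w k a :
  pword w (gtaylor (size w + k) a) =
  gtaylor k (fun beta => a (fun i => (beta i + count_mem i w)%N)).
Proof.
elim: w k a => [|j w IH] k a.
  by rewrite /= add0n; apply: eq_gtaylor => b _; congr a; apply/funext => i; rewrite addn0.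
rewrite [size _]/= addSnnS [LHS]/= IH (partialE (@has_partial_gtaylor j k _)).
apply: eq_gtaylor => b _; congr a; apply/funext => i.
by rewrite /mi_incr/= -addnA eq_sym.
Qed.

End taylor_polynomials.

(** * Remainders of real Taylor polynomials *)

Section real_taylor_remainder.
Variables (R : realType) (n : nat).
Implicit Types (g : 'rV[R]_n -> R) (x u h : 'rV[R]_n).

(** The factor 2 matches the interface of [partial_bound_gen], which is shared with the complex
    case. *)
Lemma real_slice_bound g x j (c B : R) :
  (forall w, derivable g w (delta_mx ord0 j)) ->
  (forall s : R, 0 <= s <= 1 -> `|partial j g (x + (s * c) *: delta_mx ord0 j)| <= B) ->
  `|g (x + c *: delta_mx ord0 j) - g x| <= 2 * `|c| * B.
Proof.
move=> dg gB; set v := delta_mx ord0 j.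
have B0 : 0 <= B by apply: le_trans (gB 0 _); rewrite ?lexx ?ler01.
apply: (@le_trans _ _ (`|c| * B)); last first.
  by rewrite -mulrA ler_peMl ?ler1n// mulr_ge0.
(* For c < 0 the segment is run through from its other end, and the parameter of the intermediate
   point is 1 + t / c. *)
have [c0|c0|->] := ltgtP c 0; last by rewrite scale0r addr0 subrr normr0 mul0r.
  have nc0 : 0 < - c by rewrite oppr_gt0.
  have [t /andP[t0 tc]] := line_MVT (x + c *: v) nc0 dg.
  rewrite -addrA -scalerDl subrr scale0r addr0 => E.
  rewrite distrC E normrM normrN ler_wpM2l// -addrA -scalerDl.
  have -> : c + t = (1 + t / c) * c by rewrite mulrDl mul1r divfK// lt_eqF.
  have tc1 : - 1 <= t / c by rewrite ler_ndivlMr// mulN1r.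
  have tc0 : t / c <= 0 by rewrite mulr_ge0_le0// invr_le0 ltW.
  by apply: gB; apply/andP; split; lra.
have [t /andP[t0 tc] ->] := line_MVT x c0 dg.
rewrite normrM ler_wpM2l// -[t](divfK (_ : c != 0)) ?gt_eqF//.
by apply: gB; apply/andP; split; [exact/divr_ge0/ltW|rewrite ler_pdivrMr// mul1r].
Qed.

Lemma mi_partial_incr k g j beta : real_Ck k g -> ((mi_abs beta).+1 <= k)%N ->
  mi_partial (mi_incr j beta) g = mi_partial beta (partial j g).
Proof.
move=> Cg bk; rewrite !mi_partialE.
rewrite (_ : pword _ (partial j g) = pword (mi_word beta ++ [:: j]) g); last first.
  by rewrite pword_cat.
apply: pword_perm; last by rewrite size_mi_word mi_abs_incr; exact: real_Ck_le Cg.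
apply/allP => i _ /=; rewrite count_cat !count_mi_word /= addn0.
by rewrite /mi_incr (eq_sym j).
Qed.

Lemma mi_partial0 (K : numFieldType) (F : 'rV[K]_n -> K) : mi_partial (fun=> 0%N) F = F.
Proof.
rewrite mi_partialE; have := @size_mi_word n (fun=> 0%N).
by rewrite /mi_abs big1// => /size0nil ->.
Qed.

(** By induction on k: the partial derivatives of the remainder are the remainders of order k - 1 of
    those of g, and the remainder vanishes at h = 0. Each order contributes a factor 2 n |h|; at
    order 0 only the oscillation of the top derivatives is left. *)
Lemma taylor_remainder k g (r W : R) u : 0 < r -> 0 <= W -> real_Ck k g ->
  (forall w, size w = k -> forall x y,
     `|pword w g x - pword w g y| <= (1 + `|x - y| / r) * W) ->
  forall h, `|g (u + h) - gtaylor k (fun beta => mi_partial beta g u) h| <=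
    (2 * n%:R) ^+ k * `|h| ^+ k * ((1 + `|h| / r) * W).
Proof.
move=> r0 W0; elim: k g => [|k IH] g Cg gW h.
  rewrite gtaylor0 mi_partial0 !expr0 !mul1r.
  by have := gW [::] erefl (u + h) u; rewrite addrAC subrr add0r.
pose E (y : 'rV[R]_n) := g (u + y) - gtaylor k.+1 (fun beta => mi_partial beta g u) y.
pose E' j (y : 'rV[R]_n) :=
  partial j g (u + y) - gtaylor k (fun beta => mi_partial beta (partial j g) u) y.
have EE' j : has_partial j E (E' j).
  apply: has_partialB.
    apply: (eq_has_partial (has_partial_affine u 1 (has_partialP (Cg.2 j).1))) => y;
      by rewrite scale1r// mul1r.
  rewrite (_ : gtaylor k _ = gtaylor k
    (fun beta => mi_partial (mi_incr j beta) g u)); first exact: has_partial_gtaylor.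
  by apply: eq_gtaylor => b bk; rewrite (mi_partial_incr j Cg).
have := @partial_bound_gen R R Num.norm id n (normr0 _) (@normr_ge0 _ _) (@ler_normD _ _)
  (@normrM _) (fun=> erefl) real_slice_bound E 0 h `|h|
  ((2 * n%:R) ^+ k * `|h| ^+ k * ((1 + `|h| / r) * W)).
rewrite add0r (_ : E 0 = 0) ?subr0; last first.
  by rewrite /E addr0 gtaylor_at0 mi_partial0 subrr.
move=> H; apply: (le_trans (H _ _ _)) => {H}.
- by move=> j w; exact: has_partial_derivable (EE' j).
- by move=> i; exact: rV_coord_le.
- move=> j h' h'h; rewrite add0r (partialE (EE' j)).
  have {}h'h : `|h'| <= `|h| by exact: rV_norm_le.
  apply: le_trans (IH (partial j g) (Cg.2 j).2 _ h') _.
    by move=> w wk; have := gW (rcons w j); rewrite size_rcons wk -cats1 pword_cat; exact.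
  have r0' : 0 <= r^-1 by rewrite invr_ge0 ltW.
  rewrite ler_pM ?(mulr_ge0 (addr_ge0 _ (mulr_ge0 _ _)))// ?mulr_ge0 ?exprn_ge0//.
    by rewrite ler_wpM2l ?exprn_ge0 ?mulr_ge0// lerXn2r ?nnegrE.
  by rewrite ler_wpM2r// lerD2l ler_wpM2r.
by rewrite le_eqVlt; apply/orP; left; apply/eqP; rewrite !exprS; ring.
Qed.

Lemma oscillation_subdivide g (r W : R) : 0 < r ->
  (forall x y, `|x - y| <= r -> `|g x - g y| <= W) ->
  forall x y, `|g x - g y| <= (1 + `|x - y| / r) * W.
Proof.
move=> r0 gW x y.
have W0 : 0 <= W by apply: le_trans (gW 0 0 _); rewrite ?subrr ?normr0// ltW.
(* With m = floor(d / r) + 1 pieces, where d is the distance of x and y, each piece has length at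
   most r, and m <= 1 + d / r. *)
pose m := (Num.truncn (`|x - y| / r)).+1.
have d0 : 0 <= `|x - y| / r by rewrite divr_ge0// ltW.
have /andP[m1 m2] := Num.Theory.truncn_itv d0.
have m0 : 0 < m%:R :> R by rewrite ltr0n.
have H i : `|g (y + (i%:R / m%:R) *: (x - y)) - g y| <= i%:R * W.
  elim: i => [|i IH]; first by rewrite !mul0r scale0r addr0 subrr normr0.
  rewrite -natr1 [leRHS]mulrDl mul1r.
  rewrite (_ : g _ - g y = (g (y + (i%:R / m%:R) *: (x - y)) - g y) +
    (g (y + ((i%:R + 1) / m%:R) *: (x - y)) - g (y + (i%:R / m%:R) *: (x - y)))); last by ring.
  rewrite (le_trans (ler_normD _ _))// lerD//; apply: gW.
  rewrite opprD addrACA subrr add0r -scalerBl -mulrBl addrAC subrr add0r mul1r normrZ.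
  rewrite gtr0_norm ?invr_gt0// ler_pdivrMl// -ler_pdivrMr//.
  exact: ltW.
have := H m; rewrite divff ?gt_eqF// scale1r (addrC y) subrK => /le_trans; apply.
by rewrite ler_wpM2r// /m -natr1 addrC lerD2l.
Qed.

End real_taylor_remainder.

Section complex_taylor.
Variables (R : realType) (n : nat).
Local Notation C := R[i].
Implicit Types (f : 'rV[R]_n -> C) (alpha beta : 'I_n -> nat) (u h : 'rV[R]_n).

Lemma toC_natr (m : nat) : (m%:R : C) = (m%:R : R)%:C.
Proof. by rewrite rmorph_nat. Qed.

Lemma mi_pow_toC h beta : mi_pow (toC h) beta = (mi_pow h beta)%:C.
Proof. by rewrite /mi_pow rmorph_prod; apply: eq_bigr => i _; rewrite mxE rmorphXn. Qed.

Lemma Re_taylor f k u h : complex.Re (taylor f k u (toC h)) =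
  gtaylor k (fun beta => mi_partial beta (re_fun f) u) h.
Proof.
rewrite /taylor (big_morph _ (@ReD R) (erefl _)); apply: eq_bigr => b _.
by rewrite toC_natr -fmorphV mi_pow_toC ReMc ReZ ImZ /= !mulr0 subr0.
Qed.

Lemma Im_taylor f k u h : complex.Im (taylor f k u (toC h)) =
  gtaylor k (fun beta => mi_partial beta (im_fun f) u) h.
Proof.
rewrite /taylor (big_morph _ (@ImD R) (erefl _)); apply: eq_bigr => b _.
by rewrite toC_natr -fmorphV mi_pow_toC ImMc ReZ ImZ /= !mulr0 add0r.
Qed.

Lemma mi_partialD k (g : 'rV[R]_n -> R) alpha beta : real_Ck k g ->
  (mi_abs alpha + mi_abs beta <= k)%N ->
  mi_partial beta (mi_partial alpha g) = mi_partial (fun i => (beta i + alpha i)%N) g.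
Proof.
move=> Cg abk; have size_word : size (mi_word beta ++ mi_word alpha) = (mi_abs alpha + mi_abs beta)%N.
  by rewrite size_cat !size_mi_word addnC.
rewrite !mi_partialE -pword_cat; apply: pword_perm.
  by apply/allP => i _ /=; rewrite count_cat !count_mi_word.
by rewrite size_word; exact: real_Ck_le Cg.
Qed.

Lemma cpartialD k f alpha beta : Ck k f -> (mi_abs alpha + mi_abs beta <= k)%N ->
  cpartial beta (cpartial alpha f) = cpartial (fun i => (beta i + alpha i)%N) f.
Proof.
move=> [Cr Ci] abk; apply/funext => x; rewrite /cpartial.
by rewrite -(mi_partialD Cr abk) -(mi_partialD Ci abk).
Qed.

Lemma pword_shift (K : numFieldType) w (F : 'rV[K]_n -> K) (c : 'rV[K]_n) : cpoly F ->
  cpoly (pword w F) /\ pword w (fun z => F (z - c)) = fun z => pword w F (z - c).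
Proof.
move=> cF; elim: w => //= j w [cw ->].
have [D cD FD] := cpoly_has_partial cw j; rewrite (partialE FD); split => //.
apply: partialE; apply: (eq_has_partial (has_partial_affine (- c) 1 FD)) => z;
  by rewrite scale1r ?mul1r addrC.
Qed.

(** Differentiation shifts the coefficients of a Taylor polynomial. That the shifted ones belong to
    [cpartial alpha f] rests on symmetry of mixed derivatives, as [mi_partial] fixes the order of
    differentiation. *)
Lemma mi_partial_taylor k f u alpha : Ck k f -> (mi_abs alpha <= k)%N ->
  mi_partial alpha (fun z => taylor f k u (z - toC u)) =
  fun z => taylor (cpartial alpha f) (k - mi_abs alpha) u (z - toC u).
Proof.
move=> Cf ak; pose a beta := cpartial beta f u.
rewrite mi_partialE -[X in pword _ X]/(fun z => gtaylor k a (z - toC u)).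
rewrite (pword_shift _ _ (cpoly_gtaylor k a)).2; apply/funext => z.
rewrite -[in LHS](subnKC ak) -size_mi_word pword_gtaylor size_mi_word.
apply: (congr1 (fun F : 'rV[C]_n -> C => F (z - toC u))).
apply: (@eq_gtaylor _ _ _ _ (fun beta => cpartial beta (cpartial alpha f) u)) => b bk.
rewrite (cpartialD Cf); last by rewrite -leq_subRL.
by congr (cpartial _ f u); apply/funext => i; rewrite count_mi_word.
Qed.

End complex_taylor.

(** * Taylor remainders in terms of the modulus of continuity *)

Section modulus_estimates.
Variables (R : realType) (n : nat).
Local Notation C := R[i].
Hypothesis n_gt0 : (0 < n)%N.
Variables (k : nat) (delta : R) (w : R -> R) (f : 'rV[R]_n -> C).
Hypotheses (mw : modulus_of_continuity delta w) (fk : in_Ck_modulus k delta w f).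

Let W : R := fine (modulus_norm k delta w f).

Lemma C0_norm_ge0 (g : 'rV[R]_n -> C) : (0 <= C0_norm g)%E.
Proof.
apply: (@le_trans _ _ (normc (g 0))%:E); first by rewrite lee_fin normc_ge0.
by apply: ereal_sup_ubound; exists 0.
Qed.

(** The supremum over an empty set would be [-oo]; since n > 0, the constant vector delta and 0 form
    an admissible pair. *)
Lemma modulus_seminorm_ge0 (g : 'rV[R]_n -> C) : (0 <= modulus_seminorm delta w g)%E.
Proof.
have d0 := modulus_delta_gt0 mw.
pose x : 'rV[R]_n := const_mx delta.
have xd : `|x - 0| <= delta.
  by rewrite subr0; apply: rV_norm_le => [|i]; rewrite ?mxE ?gtr0_norm// ltW.
have x0 : 0 < `|x - 0|.
  apply: (lt_le_trans d0); rewrite subr0.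
  rewrite -[leLHS](gtr0_norm d0); apply: le_trans (rV_coord_le x (Ordinal n_gt0)).
  by rewrite mxE.
apply: (@le_trans _ _ (normc (g x - g 0) / w `|x - 0|)%:E); last first.
  by apply: ereal_sup_ubound; exists (x, 0) => //=; rewrite x0 xd.
by rewrite lee_fin divr_ge0 ?normc_ge0// ltW// (modulus_gt0 mw)// x0 xd.
Qed.

Let term_ge0 beta : (0 <= C0_norm (cpartial beta f) + modulus_seminorm delta w (cpartial beta f))%E.
Proof. exact: adde_ge0 (C0_norm_ge0 _) (modulus_seminorm_ge0 _). Qed.

Lemma modulus_norm_fine : modulus_norm k delta w f = W%:E.
Proof.
rewrite fineK// ge0_fin_numE; first exact: fk.2.
by apply: sume_ge0 => b _; exact: term_ge0.
Qed.

Lemma modulus_term_le beta : (mi_abs beta <= k)%N ->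
  (C0_norm (cpartial beta f) + modulus_seminorm delta w (cpartial beta f) <= W%:E)%E.
Proof.
move=> bk; have [b bE] := mi_ofK bk; rewrite -modulus_norm_fine /modulus_norm.
rewrite (bigD1 b)/= bE//; apply: leeDl.
by apply: sume_ge0 => b' _; exact: term_ge0.
Qed.

Lemma modulus_norm_ge0 : 0 <= W.
Proof.
rewrite -lee_fin; apply: le_trans (term_ge0 (fun=> 0%N)) (modulus_term_le _).
by rewrite /mi_abs big1.
Qed.

Lemma cpartial_bound beta x : (mi_abs beta <= k)%N -> normc (cpartial beta f x) <= W.
Proof.
move=> /modulus_term_le; rewrite -lee_fin; apply: le_trans.
apply: (@le_trans _ _ (C0_norm (cpartial beta f))); last exact: leeDl (modulus_seminorm_ge0 _).
by apply: ereal_sup_ubound; exists x.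
Qed.

Lemma cpartial_modulus beta x y : (mi_abs beta <= k)%N -> 0 < `|x - y| <= delta ->
  normc (cpartial beta f x - cpartial beta f y) <= W * w `|x - y|.
Proof.
move=> /modulus_term_le bk xy; rewrite -ler_pdivrMr ?(modulus_gt0 mw)//.
rewrite -lee_fin; apply: le_trans bk.
apply: (@le_trans _ _ (modulus_seminorm delta w (cpartial beta f))); last exact: leeDr (C0_norm_ge0 _).
by apply: ereal_sup_ubound; exists (x, y).
Qed.

Lemma taylor_remainder_modulus (r : R) u h : 0 < r <= delta ->
  normc (f (u + h) - taylor f k u (toC h)) <=
    2 * ((2 * n%:R) ^+ k * `|h| ^+ k * ((1 + `|h| / r) * (W * w r))).
Proof.
move=> /andP[r0 rd]; have wr0 : 0 < w r by rewrite (modulus_gt0 mw)// r0 rd.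
have Ww0 : 0 <= W * w r by rewrite mulr_ge0 ?modulus_norm_ge0// ltW.
have osc beta x y : (mi_abs beta <= k)%N -> `|x - y| <= r ->
    normc (cpartial beta f x - cpartial beta f y) <= W * w r.
  move=> bk xyr; have [->|xy] := eqVneq x y; first by rewrite subrr normc0.
  have xy0 : 0 < `|x - y| by rewrite normr_gt0 subr_eq0.
  rewrite (le_trans (cpartial_modulus bk _))//; first by rewrite xy0 (le_trans xyr).
  by rewrite ler_wpM2l ?modulus_norm_ge0// (modulus_nondecreasing mw).
(* [taylor_remainder] speaks of words of length k, the norm of multi-indices; sorting the word
   connects them. *)
have wordE (g : 'rV[R]_n -> R) v : real_Ck k g -> size v = k ->
    exists2 beta, mi_abs beta = k & pword v g = mi_partial beta g.
  move=> Cg vk; pose beta i := count_mem i v.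
  have vb : perm_eq v (mi_word beta) by apply/allP => i _ /=; rewrite count_mi_word.
  exists beta; first by rewrite -size_mi_word -(perm_size vb).
  by rewrite mi_partialE; apply: pword_perm => //; rewrite vk.
have [[Cr Ci] _] := fk.
rewrite (le_trans (normc_le_ReIm _))// mulr2n mulrDl mul1r.
rewrite ReB ImB Re_taylor Im_taylor; apply: lerD.
- apply: (@taylor_remainder R n k (re_fun f) r (W * w r) u r0 Ww0 Cr) => v vk.
  have [b bk ->] := wordE _ v Cr vk.
  apply: oscillation_subdivide => // x y xyr.
  have := osc b x y; rewrite bk leqnn => /(_ isT xyr); apply: le_trans.
  by have := Re_le_normc (cpartial b f x - cpartial b f y); rewrite ReB.
- apply: (@taylor_remainder R n k (im_fun f) r (W * w r) u r0 Ww0 Ci) => v vk.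
  have [b bk ->] := wordE _ v Ci vk.
  apply: oscillation_subdivide => // x y xyr.
  have := osc b x y; rewrite bk leqnn => /(_ isT xyr); apply: le_trans.
  by have := Im_le_normc (cpartial b f x - cpartial b f y); rewrite ImB.
Qed.

End modulus_estimates.

(** * The approximation estimate *)

Section convolution_operator.
Variables (R : realType) (n : nat).
Local Notation C := R[i].
Local Notation mR := (measurableTypeR R).
Local Notation mu := (lebesgue_tuple R n).
Local Notation row := (@row_of_tuple R n).
Implicit Types (A K : 'rV[C]_n -> C) (f : 'rV[R]_n -> C) (r : R).

Lemma in_C0_cmeasurable f : in_C0 f -> cmeasurable (fun t => f (row t)).
Proof.
by move=> [[[cr _] [ci _]] _]; split;
  [exact: (measurable_continuous_rV cr)|exact: (measurable_continuous_rV ci)].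
Qed.

Lemma in_C0_bounded f : in_C0 f -> exists2 B : R, 0 <= B & forall x, normc (f x) <= B.
Proof.
move=> [_ foo]; have f0 : (0 <= C0_norm f)%E := C0_norm_ge0 f.
exists (fine (C0_norm f)); first by rewrite fine_ge0.
move=> x; rewrite -lee_fin fineK ?ge0_fin_numE//.
by apply: ereal_sup_ubound; exists x.
Qed.

Lemma in_C0_poly_bounded f : in_C0 f -> poly_bounded (fun t => f (row t)).
Proof.
move=> /in_C0_bounded[B B0 fB]; exists B, 0%N; split => // t.
by rewrite expr0 mulr1.
Qed.

Definition dilate r f (t : n.-tuple mR) : C := f (r *: row t).

Lemma dilateE r f t : dilate r f t = f (row (affine_tuple (fun=> 0) r t)).
Proof.
by rewrite row_affine (_ : \row__ 0 = 0) ?add0r//; apply/rowP => i; rewrite !mxE.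
Qed.

Lemma cmeasurable_dilate r f : in_C0 f -> cmeasurable (dilate r f).
Proof.
move=> /in_C0_cmeasurable[mr mi].
have ma := measurable_affine_tuple (fun _ : 'I_n => 0) r.
by split; under eq_fun do rewrite dilateE; [exact: (measurableT_comp mr ma)|exact: (measurableT_comp mi ma)].
Qed.

Lemma poly_bounded_dilate r f : in_C0 f -> poly_bounded (dilate r f).
Proof.
move=> /in_C0_bounded[B B0 fB]; exists B, 0%N; split => // t.
by rewrite expr0 mulr1; exact: fB.
Qed.

Lemma conv_operE K r f x : nice 2 K -> 0 < r ->
  cmeasurable (fun t => f (row t)) -> poly_bounded (fun t => f (row t)) ->
  cintegrable mu (fun t => conv_integrand K r f x (row t)) /\
  conv_op K r f x = cconv K (dilate r f) ((r^-1)%:C *: x).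
Proof.
move=> nK r0 mf pf; have ri0 : 0 < r^-1 by rewrite invr_gt0.
have iK : cintegrable mu (fun t => conv_integrand K r f x (row t)).
  have := conv_integrable (nice_scale 1 ri0 nK) mf pf x.
  by under eq_fun do rewrite mul1r.
split => //; have [_] := cint_affine_tuple (fun=> 0) r0 iK.
rewrite -[conv_op K r f x]/((r ^- n)%:C * cint mu (fun t => conv_integrand K r f x (row t))).
move=> <-; apply: eq_cint => t; rewrite dilateE /conv_integrand; congr (K _ * _).
rewrite row_affine scalerBr; congr (_ - _); apply/rowP => i; rewrite !mxE add0r -rmorphM.
by rewrite mulrA mulVf ?mul1r// gt_eqF.
Qed.

Lemma differentiable_conv_op K r f : nice 4 K -> 0 < r ->
  cmeasurable (fun t => f (row t)) -> poly_bounded (fun t => f (row t)) ->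
  entire (conv_op K r f).
Proof.
move=> nK r0 mf pf; have ri0 : 0 < r^-1 by rewrite invr_gt0.
have [dA _] := conv_differentiable (nice_scale (r ^- n)%:C ri0 nK) mf pf.
move=> x; have := dA x; congr (differentiable _ _); apply/funext => y.
have [iK _] := conv_operE y (@nice_le _ _ 2 4 _ isT nK) r0 mf pf.
rewrite -[RHS]/((r ^- n)%:C * cint mu (fun t => conv_integrand K r f y (row t))) -cintZ//.
by apply: eq_cint => t; rewrite /conv_integrand mulrA.
Qed.

Lemma real_conv_op K r f u : (forall v, complex.Im (K (toC v)) = 0) -> real_valued f ->
  complex.Im (conv_op K r f (toC u)) = 0.
Proof.
move=> K0 f0; rewrite /conv_op ImZ (_ : complex.Im _ = 0) ?mulr0//.
apply: (@etrans _ _ (\int[mu]_(t in setT) (0 : R))); last by rewrite /Rintegral integral0.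
apply: eq_Rintegral => t _; rewrite /integrand_of /conv_integrand ImMc f0 mulr0 add0r.
rewrite (_ : _ *: _ = toC (r^-1 *: (u - \row_i tnth t i))) ?K0 ?mul0r//.
by apply/rowP => i; rewrite !mxE rmorphM rmorphB.
Qed.

Lemma pword_cconv (s : seq 'I_n) A (F : n.-tuple mR -> C) (l : R) :
  (forall d, nice d A) -> cmeasurable F -> poly_bounded F ->
  (forall d, nice d (pword s A)) /\
  pword s (fun x => cconv A F (l%:C *: x)) =
    fun x => (l ^+ size s)%:C * cconv (pword s A) F (l%:C *: x).
Proof.
move=> nA mF pF; elim: s => [|j s [IHn IHe]].
  by split => //; apply/funext => x; rewrite expr0 mul1r.
have dA := has_partialP (fun z => _ : derivable (pword s A) z (delta_mx ord0 j)).
have {}dA : has_partial j (pword s A) (partial j (pword s A)).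
  by apply: dA => z; have [D AD _] := (IHn 1%N).2 j; exact: has_partial_derivable AD.
split => [d|].
  by have [D AD nD] := (IHn d.+1).2 j; rewrite /= (partialE AD).
have [_ /(_ j _ dA) dC] := conv_differentiable (IHn 4%N) mF pF.
rewrite [LHS]/= -/(pword s _) IHe; apply: partialE.
apply: (eq_has_partial (has_partialZ _ (has_partial_affine 0 l%:C dC))) => x.
  by rewrite add0r.
by rewrite add0r mulrA -rmorphM exprSr.
Qed.

End convolution_operator.

Section approximation.
Variables (R : realType) (n : nat).
Local Notation C := R[i].
Local Notation mR := (measurableTypeR R).
Local Notation mu := (lebesgue_tuple R n).
Local Notation row := (@row_of_tuple R n).

Lemma in_Ck_modulus_C0 k delta w (f : 'rV[R]_n -> C) : (0 < n)%N ->
  modulus_of_continuity delta w -> in_Ck_modulus k delta w f -> in_C0 f.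
Proof.
move=> n0 mw fk; have [[Cr Ci] _] := fk; split.
  by split; [exact: real_Ck_le Cr|exact: real_Ck_le Ci].
have fE x : cpartial (fun=> 0%N) f x = f x.
  by rewrite /cpartial !mi_partial0; exact: complex_eqP.
apply: (@le_lt_trans _ _ (fine (modulus_norm k delta w f))%:E); last exact: ltry.
apply: ge_ereal_sup => _ [x _ <-]; rewrite lee_fin -fE.
by apply: (cpartial_bound n0 mw fk); rewrite /mi_abs big1.
Qed.

(** Recentring the weight leaves its integral unchanged; this makes the final estimate uniform in
    x. *)
Lemma Rintegral_rhoV_shift (D : R) (e : 'rV[R]_n) :
  mu.-integrable setT (EFin \o (fun t => D * (rho (row t - e))^-1)) /\
  \int[mu]_(t in setT) (D * (rho (row t - e))^-1) = D * pi ^+ n.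
Proof.
have [] := integral_affine_tuple (fun i => - e ord0 i) ltr01 (integrable_rhoV n D).
have rowE t : row (affine_tuple (fun i => - e ord0 i) 1 t) = row t - e.
  by rewrite row_affine scale1r addrC; congr (_ + _); apply/rowP => i; rewrite !mxE.
rewrite expr1n invr1 mul1r Rintegral_rhoV => i1 i2.
split; last by rewrite -i2; apply: eq_Rintegral => t _; rewrite rowE.
by move: i1; congr (_.-integrable _ _); apply/funext => t /=; rewrite rowE.
Qed.

(** After division by r, the condition on the imaginary part of x puts the argument in the strip of
    half-width 1. Of the k + 2 powers of decay, k + 1 absorb the growth of G about Re x / r, and one
    makes the integral converge. *)
Lemma approximation_bound A k (E D r : R) (x : 'rV[C]_n) (G : n.-tuple mR -> C) :
  0 < r -> `|im_vec x| <= r -> 0 <= E ->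
  cintegrable mu (fun t => A ((r^-1)%:C *: x - toC (row t)) * G t) ->
  (forall z, strip 1 z -> normc (A z) * crho z ^+ k.+2 <= D) ->
  (forall t, normc (G t) <= E * rho (row t - r^-1 *: re_vec x) ^+ k.+1) ->
  normc (cconv A G ((r^-1)%:C *: x)) <= 2 * (D * E * pi ^+ n).
Proof.
move=> r0 xr E0 iA AD GE; set e := r^-1 *: re_vec x.
have [iB <-] := Rintegral_rhoV_shift (D * E) e.
apply: normc_cint_le => // t; set z := (_ - _ : 'rV[C]_n).
have zE : crho z = rho (row t - e).
  by rewrite /crho re_vec_sub_toC re_vecZ -rhoN opprB.
have sz : strip 1 z.
  apply: strip_sub_toC => i; rewrite mxE ImZ normrM gtr0_norm ?invr_gt0//.
  rewrite ler_pdivrMl// mulr1 (le_trans _ xr)//.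
  by have := rV_coord_le (im_vec x) i; rewrite mxE.
rewrite ler_pdivlMr ?rho_gt0// normcM.
apply: (@le_trans _ _ (normc (A z) * (E * rho (row t - e) ^+ k.+1) * rho (row t - e))).
  by rewrite ler_wpM2r ?rho_ge0// ler_wpM2l ?normc_ge0.
rewrite (_ : _ * _ * _ = normc (A z) * crho z ^+ k.+2 * E).
  by rewrite ler_wpM2r// AD.
by rewrite zE [in RHS]exprS; ring.
Qed.

Lemma approximation_error (K : 'rV[C]_n -> C) k delta w (f : 'rV[R]_n -> C) alpha (D r : R) x :
  (0 < n)%N -> (forall d, nice d K) ->
  (forall (P : 'rV[C]_n -> C) y, cpoly P -> cconv K (fun t => P (toC (row t))) y = P y) ->
  (forall z, strip 1 z -> normc (mi_partial alpha K z) * crho z ^+ k.+2 <= D) ->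
  modulus_of_continuity delta w -> in_Ck_modulus k delta w f ->
  (mi_abs alpha <= k)%N -> 0 < r -> r <= delta -> `|im_vec x| <= r ->
  normc (mi_partial alpha (conv_op K r f) x -
         taylor (cpartial alpha f) (k - mi_abs alpha) (re_vec x) ('i%C *: toC (im_vec x))) <=
  8 * (2 * n%:R) ^+ k * pi ^+ n * D * fine (modulus_norm k delta w f) *
    (r ^+ (k - mi_abs alpha) * w r).
Proof.
move=> n0 nK KP KD mw fk ak r0 rd xr; set u := re_vec x; set m := mi_abs alpha.
have [Cf _] := fk; have f0 := in_Ck_modulus_C0 n0 mw fk.
have rr : 0 < r <= delta by rewrite r0 rd.
pose P (z : 'rV[C]_n) := taylor f k u (z - toC u).
have cP : cpoly (fun z => P (r%:C *: z)).
  pose T := gtaylor k (fun beta => cpartial beta f u).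
  rewrite (_ : (fun z => _) = (fun z => T (- toC u + r%:C *: z))).
    exact: cpoly_affine (cpoly_gtaylor _ _).
  by apply/funext => z; rewrite addrC.
pose Pr (t : n.-tuple mR) := P (r%:C *: toC (row t)).
have mPr : cmeasurable Pr by exact: (cmeasurable_cpoly cP).
have pPr : poly_bounded Pr by exact: (poly_bounded_cpoly cP).
have mf := in_C0_cmeasurable f0; have pf := in_C0_poly_bounded f0.
have mfr := cmeasurable_dilate r f0; have pfr := poly_bounded_dilate r f0.
have SE : conv_op K r f = fun y => cconv K (dilate r f) ((r^-1)%:C *: y).
  by apply/funext => y; rewrite (conv_operE y (nK 2%N) r0 mf pf).2.
have PE : P = fun y => cconv K Pr ((r^-1)%:C *: y).
  apply/funext => y; rewrite (KP _ _ cP) scalerA -rmorphM divff ?gt_eqF//.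
  by rewrite scale1r.
(* The purely imaginary increment of the claim is the argument x - Re x of P. *)
have xE : 'i%C *: toC (im_vec x) = x - toC u.
  apply/rowP => i; rewrite !mxE; case: (x ord0 i) => a b.
  by apply: complex_eqP; rewrite /=; simpc.
rewrite xE -[taylor _ _ _ _]/((fun z => taylor (cpartial alpha f) (k - m) u (z - toC u)) x).
rewrite -(mi_partial_taylor u Cf ak) -/P SE PE !mi_partialE.
have [nA ->] := pword_cconv (mi_word alpha) r^-1 nK mfr pfr.
have [_ ->] := pword_cconv (mi_word alpha) r^-1 nK mPr pPr.
rewrite -mi_partialE in nA *; rewrite size_mi_word -/m -mulrBr normcM normc_real.
set A := mi_partial alpha K in nA KD *.
have i1 := conv_integrable (nA 2%N) mfr pfr ((r^-1)%:C *: x).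
have i2 := conv_integrable (nA 2%N) mPr pPr ((r^-1)%:C *: x).
pose G t := dilate r f t - Pr t.
have -> : cconv A (dilate r f) ((r^-1)%:C *: x) - cconv A Pr ((r^-1)%:C *: x) =
    cconv A G ((r^-1)%:C *: x).
  by rewrite /cconv -cintB//; apply: eq_cint => t; rewrite mulrBr.
have iG : cintegrable mu (fun t => A ((r^-1)%:C *: x - toC (row t)) * G t).
  by under eq_fun do rewrite mulrBr; exact: cintegrableB.
set W := fine _; have W0 : 0 <= W := modulus_norm_ge0 n0 mw fk.
have w0 : 0 < w r by rewrite (modulus_gt0 mw)// r0 rd.
(* 4 = 2 * 2: real and imaginary part of the remainder, and 1 + |e| <= 2 rho e. The factor 2 of
   [approximation_bound] then yields the 8 of the conclusion. *)
pose E := 4 * (2 * n%:R) ^+ k * r ^+ k * (W * w r).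
have E0 : 0 <= E by rewrite !mulr_ge0 ?exprn_ge0 ?mulr_ge0// ltW.
have GE t : normc (G t) <= E * rho (row t - r^-1 *: u) ^+ k.+1.
  set e := row t - _; have rowE : r *: row t = u + r *: e.
    by rewrite scalerBr scalerA divff ?gt_eqF// scale1r addrC subrK.
  have toCE : r%:C *: toC (row t) - toC u = toC (r *: e).
    rewrite /e scalerBr scalerA divff ?gt_eqF// scale1r.
    by apply/rowP => i; rewrite !mxE rmorphB rmorphM.
  rewrite /G /dilate /Pr /P toCE rowE.
  apply: le_trans (taylor_remainder_modulus n0 mw fk u (r *: e) rr) _.
  (* The remainder is taken at the increment r e, so that r^k splits off and the growth is measured
     in multiples of r. *)
  have ne : `|e| <= rho e by apply: rV_norm_le => [|i]; [exact: rho_ge0|exact: rho_coord].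
  rewrite (_ : `|r *: e| = r * `|e|); last by rewrite normrZ gtr0_norm.
  rewrite (_ : r * `|e| / r = `|e|); last by rewrite mulrAC divff ?gt_eqF// mul1r.
  rewrite (exprMn k r) -/W.
  have H1 : `|e| ^+ k <= rho e ^+ k by rewrite lerXn2r ?nnegrE ?rho_ge0.
  have H2 : 1 + `|e| <= 2 * rho e by have := rho_ge1 e; lra.
  have H3 : `|e| ^+ k * (1 + `|e|) <= 2 * rho e ^+ k.+1.
    by rewrite exprSr mulrCA ler_pM ?exprn_ge0 ?addr_ge0.
  rewrite (_ : 2 * _ = 2 * (2 * n%:R) ^+ k * r ^+ k * (W * w r) * (`|e| ^+ k * (1 + `|e|))); last by ring.
  rewrite (_ : E * _ = 2 * (2 * n%:R) ^+ k * r ^+ k * (W * w r) * (2 * rho e ^+ k.+1)); last by rewrite /E; ring.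
  by rewrite ler_wpM2l// !mulr_ge0 ?exprn_ge0 ?mulr_ge0// ltW.
have := approximation_bound r0 xr E0 iG KD GE.
rewrite exprVn gtr0_norm ?invr_gt0 ?exprn_gt0// => H.
rewrite ler_pdivrMl ?exprn_gt0// (le_trans H)//.
have -> : r ^+ m * (8 * (2 * n%:R) ^+ k * pi ^+ n * D * W * (r ^+ (k - m) * w r)) =
    8 * (2 * n%:R) ^+ k * pi ^+ n * D * W * (r ^+ (m + (k - m)) * w r).
  by rewrite exprD; ring.
by rewrite subnKC// /E le_eqVlt; apply/orP; left; apply/eqP; ring.
Qed.

End approximation.

Theorem theorem1 (R : realType) (n : nat) (n_gt0 : (0 < n)%N) :
  exists K : 'rV[R[i]]_n -> R[i],
    [/\ (forall (f : 'rV[R]_n -> R[i]) (r : R), in_C0 f -> 0 < r <= 1 ->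
           (forall x : 'rV[R[i]]_n, integrableRn (conv_integrand K r f x)) /\
           entire (conv_op K r f)),
        (forall k : nat, exists c : R, 0 < c /\
           forall (delta : R) (w : R -> R),
             modulus_of_continuity delta w -> semi_separable delta w ->
           forall f : 'rV[R]_n -> R[i], in_Ck_modulus k delta w f ->
           forall (alpha : 'I_n -> nat), (mi_abs alpha <= k)%N ->
           forall r : R, 0 < r -> r <= Num.min 1 delta ->
           forall x : 'rV[R[i]]_n, `|im_vec x| <= r ->
             ((ComplexField.Normc.normc
                 (mi_partial alpha (conv_op K r f) x -
                  taylor (cpartial alpha f) (k - mi_abs alpha)
                    (re_vec x) ('i%C *: toC (im_vec x))))%:E
              <= c%:E * modulus_norm k delta w f *
                 (r ^+ (k - mi_abs alpha) * w r)%:E)%E) &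
        (forall (f : 'rV[R]_n -> R[i]) (r : R), in_C0 f -> 0 < r <= 1 ->
           real_valued f -> real_analytic (conv_op K r f))].
Proof.
have [S S0 cS] := cvg_psum R.
pose K := @approx_kernel R n (S * Num.sqrt pi ^+ n)^-1.
have nK d : nice d K := nice_kernel _ _ d.

exists K; split=> [f r f0 /andP[r0 _]|k|f r f0 /andP[r0 _] fR].
- have [mf pf] := (in_C0_cmeasurable f0, in_C0_poly_bounded f0); split.
    by move=> x; exact: (conv_operE x (nK 2%N) r0 mf pf).1.
  exact: differentiable_conv_op.
- have nA (b : {ffun 'I_n -> 'I_k.+1}) d : nice d (mi_partial (mi_of b) K).
    rewrite mi_partialE.
    (* Only the niceness of the derivatives is taken from here; the data 1 and the dilation 1 are
       arbitrary. *)
    exact: (pword_cconv _ 1 nK (cmeasurable_cst _ 1) (@poly_bounded1 R n)).1.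
  pose D b := sval (cid2 (nice_decays (nA b 0%N) k.+2 1)).
  have D0 b : 0 <= D b by rewrite /D; case: cid2.
  have DP b z : strip 1 z -> normc (mi_partial (mi_of b) K z) * crho z ^+ k.+2 <= D b.
    by rewrite /D; case: cid2 => ? ? H; exact: H.
  (* Finitely many multi-indices occur for given k, so the sum of their bounds serves all alpha; the
     summand 1 makes the constant positive. *)
  pose T := 1 + \sum_b D b.
  have T0 : 0 < T by rewrite ltr_pwDl// sumr_ge0.
  have n2 : (0 : R) < 2 * n%:R by rewrite mulr_gt0// ltr0n.
  exists (8 * (2 * n%:R) ^+ k * pi ^+ n * T).
  split; first by rewrite !mulr_gt0 ?exprn_gt0// pi_gt0.
  move=> delta w mw _ f fk alpha ak r r0; rewrite le_min => /andP[_ rd] x xr.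
  rewrite (modulus_norm_fine n_gt0 mw fk) -!EFinM lee_fin.
  have [b bE] := mi_ofK ak; have := DP b; rewrite bE => bD.
  have w0 : 0 < w r by rewrite (modulus_gt0 mw)// r0 rd.
  apply: le_trans (approximation_error n_gt0 nK _ bD mw fk ak r0 rd xr) _.
    by move=> P y cP; exact: cconv_kernel_cpoly.
  rewrite ler_wpM2r ?mulr_ge0 ?exprn_ge0 ?(ltW r0) ?(ltW w0)//.
  rewrite ler_wpM2r ?(modulus_norm_ge0 n_gt0 mw fk)//.
  rewrite ler_wpM2l ?mulr_ge0 ?exprn_ge0 ?(ltW n2) ?pi_ge0//.
  rewrite /T (bigD1 b)//= addrCA lerDl addr_ge0// sumr_ge0//.
- have [mf pf] := (in_C0_cmeasurable f0, in_C0_poly_bounded f0); split.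
    exact: differentiable_conv_op.
  by move=> u; apply: real_conv_op => // v; exact: kernel_real.
Qed.
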